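(* Assume that the system $g(p,x)\in C$ enjoys Robinson stability at $(\bar p,\bar x)$, and that strict complementarity holds for the system $g(\bar p,x)\in C$ at $(\bar x,\bar x^* )$. Then for every $v=(q,u)\in{\cal P}\times X$, $$D\Psi(\bar p,\bar x,\bar x^* )(v)\subset\bigcup\Big\{\big(\nabla(\nabla_xg(\cdot)^*\hat\lambda)(\bar z)+{\cal H}_{\hat\lambda}\big)v+\pi_{X^*}\big(N_{{\cal K}_{\operatorname{gph}\Gamma}(\bar z,z^* )}(v)\big)\ \Big|\ z^*\in N_{T_{\operatorname{gph}\Gamma}(\bar z)}(v),\ \pi_{X^*}(z^* )=\bar x^*,\ \hat\lambda\in\Lambda(\bar z,z^* )\Big\}.$$ This inclusion holds as an equality if in addition $$\nabla h(g(\bar z))\nabla^2g(\bar z)(v,v)+\nabla^2h(g(\bar z))\big(\nabla g(\bar z)v,\nabla g(\bar z)v\big)\in\operatorname{rge}\big(\nabla h(g(\bar z))\circ\nabla g(\bar z)\big)+\operatorname{lin}K,$$ which is satisfied in particular when $\nabla g(\bar z)$ is surjective.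
   Context: Notation: $X=\mathbb R^n$, $P=\mathbb R^m$, $Y=\mathbb R^l$, $Z:=P\times X$, and $E$ is finite-dimensional. Dual spaces are distinguished from primal ones, $Z^*=P^*\times X^*$, and $\pi_{X^*}(p^*,x^* ):=x^*$. $A^*$ denotes the adjoint of a linear map $A$, and $\operatorname{rge}A$ its range. For $\lambda\in Y^*$, $\nabla(\nabla_xg(\cdot)^*\lambda)(\bar z)v\in X^*$ is the derivative at $\bar z$ of $z\mapsto\nabla_xg(z)^*\lambda$, applied to $v$. For a cone $A$, $A^*:=\{a^*:\langle a^*,a\rangle\le0\ \forall a\in A\}$ is its polar, and for a closed convex cone $K$, $\operatorname{lin}K:=K\cap(-K)$; $\operatorname{ri}$ is the relative interior. For a closed set $\Omega$ and $\bar z\in\Omega$: the tangent cone is $T_\Omega(\bar z):=\{w:\exists\, t_k\downarrow0,\ w_k\to w \text{ with } \bar z+t_kw_k\in\Omega\}$; the regular normal cone is $N_\Omega(\bar z):=\{z^*:\limsup_{z\to\bar z,\,z\in\Omega}\langle z^*,z-\bar z\rangle/\|z-\bar z\|\le0\}$ (for convex sets, this is the normal cone of convex analysis); and, for $z^*\in N_\Omega(\bar z)$, the critical cone is ${\cal K}_\Omega(\bar z,z^* ):=T_\Omega(\bar z)\cap\{z^*\}^\perp$. For a set-valued map $\Phi$, the graphical derivative is $D\Phi(\bar z,\bar u)(w):=\{v:(w,v)\in T_{\operatorname{gph}\Phi}(\bar z,\bar u)\}$. Setting: $g\colon P\times X\to Y$ is $C^2$ around $\bar z=(\bar p,\bar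 x)$. The set $C\subset Y$ is closed and $C^2$-cone reducible at $g(\bar z)$ to a closed convex cone $K\subset E$: there exist a neighborhood $V$ of $g(\bar z)$ and a $C^2$ map $h\colon V\to E$ with $h(g(\bar z))=0$, $\nabla h(g(\bar z))$ surjective, and $C\cap V=\{y\in V:h(y)\in K\}$. Set $\Gamma(p):=\{x:g(p,x)\in C\}$ with $\bar x\in\Gamma(\bar p)$, $\Psi(p,x):=N_{\Gamma(p)}(x)$, and fix $\bar x^*\in N_{\Gamma(\bar p)}(\bar x)$. Let $G:=h\circ g$ near $\bar z$. The system $g(p,x)\in C$ enjoys Robinson stability at $(\bar p,\bar x)$ if there are $\kappa\ge0$ and neighborhoods $W$ of $\bar p$ and $U$ of $\bar x$ with ${\rm dist}(x;\Gamma(p))\le\kappa\,{\rm dist}(g(p,x);C)$ for all $(p,x)\in W\times U$. Strict complementarity holds for $g(\bar p,x)\in C$ at $(\bar x,\bar x^* )$ if there is $\lambda\in\operatorname{ri}N_C(g(\bar z))$ with $\nabla_xg(\bar z)^*\lambda=\bar x^*$. The characteristic subspace is ${\cal P}:=\{q\in P:\nabla_pG(\bar z)q\in\operatorname{rge}\nabla_xG(\bar z)+\operatorname{lin}K\}$; equivalently, ${\cal P}=\{q:\nabla_pg(\bar z)q\in\operatorname{rge}\nabla_xg(\bar z)+\operatorname{lin}T_C(g(\bar z))\}$. Multipliers: for $\lambda\in N_C(g(\bar z))$, let $(\nabla h(g(\bar z))^* )^{-1}\lambda$ denote the unique $\mu\in E^*$ with $\nabla h(g(\bar z))^*\mu=\lambda$.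 For $z^*\in N_{\operatorname{gph}\Gamma}(\bar z)$, set $\Lambda(\bar z,z^* ):=\{\lambda\in N_C(g(\bar z)):\nabla g(\bar z)^*\lambda=z^*\}$. For $\lambda\in N_C(g(\bar z))$, the linear map ${\cal H}_\lambda\colon Z\to X^*$ is ${\cal H}_\lambda v:=\nabla_xg(\bar z)^*\nabla^2\langle(\nabla h(g(\bar z))^* )^{-1}\lambda,h(\cdot)\rangle(g(\bar z))\nabla g(\bar z)v$, where $\nabla^2\langle\mu,h(\cdot)\rangle(y)$ is the Hessian of $y\mapsto\langle\mu,h(y)\rangle$, viewed as a linear map $Y\to Y^*$. *)

(* Defs.v *)
From Stdlib Require Import Reals.
From Stdlib Require List.
From mathcomp Require Import all_boot.
Set Implicit Arguments. Unset Strict Implicit. Unset Printing Implicit Defensive.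
Local Open Scope R_scope.

(* ---------- Euclidean spaces R^k (dual spaces identified via the dot product) *)
Definition vec (k : nat) := 'I_k -> R.
Definition vset (k : nat) := vec k -> Prop.

Definition vzero {k : nat} : vec k := fun _ => 0.
Definition vadd {k : nat} (u v : vec k) : vec k := fun i => u i + v i.
Definition vopp {k : nat} (u : vec k) : vec k := fun i => - u i.
Definition vsub {k : nat} (u v : vec k) : vec k := fun i => u i - v i.
Definition vscal {k : nat} (a : R) (u : vec k) : vec k := fun i => a * u i.
Definition dot {k : nat} (u v : vec k) : R := \big[Rplus/0]_(i < k) (u i * v i).
Definition vnorm {k : nat} (u : vec k) : R := sqrt (dot u u).
Definition basis {k : nat} (i : 'I_k) : vec k := fun j => if i == j then 1 else 0.

Definition vpair {a b : nat} (u : vec a) (v : vec b) : vec (a + b) :=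
  fun k => match fintype.split k with inl i => u i | inr j => v j end.
Definition fstv {a b : nat} (w : vec (a + b)) : vec a := fun i => w (lshift b i).
Definition sndv {a b : nat} (w : vec (a + b)) : vec b := fun j => w (rshift a j).
Definition proj2_set {a b : nat} (S : vset (a + b)) : vset b :=
  fun y => exists x : vec a, S (vpair x y).

Definition closed_vset {k : nat} (S : vset k) : Prop :=
  forall x, (forall eps, 0 < eps -> exists y, S y /\ vnorm (vsub x y) < eps) -> S x.
Definition convex_set {k : nat} (S : vset k) : Prop :=
  forall x y t, S x -> S y -> 0 <= t <= 1 -> S (vadd (vscal t x) (vscal (1 - t) y)).
Definition is_cone {k : nat} (S : vset k) : Prop :=
  (exists x, S x) /\ forall x t, S x -> 0 <= t -> S (vscal t x).
Definition lin_part {k : nat} (K : vset k) : vset k := fun y => K y /\ K (vopp y).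

Definition lin_comb {k : nat} (l : list (R * vec k)) : vec k :=
  foldr (fun p acc => vadd (vscal p.1 p.2) acc) vzero l.
Definition coef_sum {k : nat} (l : list (R * vec k)) : R :=
  foldr (fun p s => p.1 + s) 0 l.
Definition aff_hull {k : nat} (A : vset k) : vset k :=
  fun b => exists l : list (R * vec k),
    (forall p, List.In p l -> A p.2) /\ coef_sum l = 1 /\ b = lin_comb l.
Definition rel_interior {k : nat} (A : vset k) : vset k :=
  fun a => A a /\ exists eps, 0 < eps /\
    forall b, aff_hull A b -> vnorm (vsub b a) < eps -> A b.

(* distance: d = dist(x; A) = inf { |x - a| : a in A } (A nonempty) *)
Definition is_dist {k : nat} (A : vset k) (x : vec k) (d : R) : Prop :=
  (forall a, A a -> d <= vnorm (vsub x a)) /\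
  (forall eps, 0 < eps -> exists a, A a /\ vnorm (vsub x a) < d + eps).

Definition tangent_cone {k : nat} (O : vset k) (zb : vec k) : vset k :=
  fun w => exists (t : nat -> R) (ws : nat -> vec k),
    (forall j, 0 < t j) /\ Un_cv t 0 /\
    Un_cv (fun j => vnorm (vsub (ws j) w)) 0 /\
    (forall j, O (vadd zb (vscal (t j) (ws j)))).

(* regular normal cone (limsup condition written out); empty if zb not in O *)
Definition normal_cone {k : nat} (O : vset k) (zb : vec k) : vset k :=
  fun zs => O zb /\
    forall eps, 0 < eps -> exists delta, 0 < delta /\
      forall z, O z -> vnorm (vsub z zb) < delta ->
        dot zs (vsub z zb) <= eps * vnorm (vsub z zb).

Definition critical_cone {k : nat} (O : vset k) (zb zs : vec k) : vset k :=
  fun w => tangent_cone O zb w /\ dot zs w = 0.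

Definition graph_deriv {a b : nat} (gph : vset (a + b)) (z : vec a) (u : vec b)
  (w : vec a) : vset b :=
  fun v => tangent_cone gph (vpair z u) (vpair w v).

Definition is_linear {a b : nat} (L : vec a -> vec b) : Prop :=
  forall u v s t, L (vadd (vscal s u) (vscal t v)) = vadd (vscal s (L u)) (vscal t (L v)).
Definition surjective_lin {a b : nat} (L : vec a -> vec b) : Prop :=
  forall y, exists x, L x = y.
Definition adj {a b : nat} (L : vec a -> vec b) (y : vec b) : vec a :=
  fun i => dot y (L (basis i)).

Definition frechet_at {a b : nat} (f : vec a -> vec b) (L : vec a -> vec b) (x : vec a) : Prop :=
  is_linear L /\
  forall eps, 0 < eps -> exists delta, 0 < delta /\
    forall hh, vnorm hh < delta ->
      vnorm (vsub (vsub (f (vadd x hh)) (f x)) (L hh)) <= eps * vnorm hh.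
Definition continuous_at_v {a : nat} (f : vec a -> R) (x : vec a) : Prop :=
  forall eps, 0 < eps -> exists delta, 0 < delta /\
    forall y, vnorm (vsub y x) < delta -> Rabs (f y - f x) < eps.
Definition C2_on {a b : nat} (f : vec a -> vec b) (Df : vec a -> vec a -> vec b)
  (D2f : vec a -> vec a -> vec a -> vec b) (x0 : vec a) (r : R) : Prop :=
  forall x, vnorm (vsub x x0) < r ->
    frechet_at f (Df x) x /\
    (forall w, frechet_at (fun z => Df z w) (fun v => D2f x v w) x) /\
    (forall v w i, continuous_at_v (fun z => D2f z v w i) x).

Section Setting.
Variables (m n l e : nat).
Implicit Types (g : vec (m + n) -> vec l) (C : vset l) (K : vset e).

Definition Gamma g C (p : vec m) : vset n := fun x => C (g (vpair p x)).
Definition gphGamma g C : vset (m + n) := fun z => Gamma g C (fstv z) (sndv z).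
Definition Psi g C (p : vec m) (x : vec n) : vset n := normal_cone (Gamma g C p) x.
Definition gphPsi g C : vset ((m + n) + n) :=
  fun w => Psi g C (fstv (fstv w)) (sndv (fstv w)) (sndv w).

Definition Dx (Dg : vec (m + n) -> vec (m + n) -> vec l) (z : vec (m + n)) (u : vec n) : vec l :=
  Dg z (vpair (vzero : vec m) u).
Definition Dp (Dg : vec (m + n) -> vec (m + n) -> vec l) (z : vec (m + n)) (q : vec m) : vec l :=
  Dg z (vpair q (vzero : vec n)).

Definition cone_reducible C K (h : vec l -> vec e) (Dh : vec l -> vec l -> vec e)
  (D2h : vec l -> vec l -> vec l -> vec e) (y0 : vec l) : Prop :=
  closed_vset K /\ convex_set K /\ is_cone K /\
  exists r, 0 < r /\ C2_on h Dh D2h y0 r /\ h y0 = vzero /\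
    surjective_lin (Dh y0) /\
    (forall y, vnorm (vsub y y0) < r -> (C y <-> K (h y))).

Definition robinson_stable g C (pb : vec m) (xb : vec n) : Prop :=
  exists kappa delta, 0 <= kappa /\ 0 < delta /\
    forall (p : vec m) (x : vec n),
      vnorm (vsub p pb) < delta -> vnorm (vsub x xb) < delta ->
      forall d2, is_dist C (g (vpair p x)) d2 ->
        exists d1, is_dist (Gamma g C p) x d1 /\ d1 <= kappa * d2.

Definition strict_complementarity g Dg C (pb : vec m) (xb xbs : vec n) : Prop :=
  exists lam, rel_interior (normal_cone C (g (vpair pb xb))) lam /\
    adj (Dx Dg (vpair pb xb)) lam = xbs.

(* characteristic subspace P, with grad G = grad h (g zb) o grad g (zb) *)
Definition char_subspace g Dg K (Dh : vec l -> vec l -> vec e) (zb : vec (m + n)) : vset m :=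
  fun q => exists (u : vec n) (k : vec e), lin_part K k /\
    Dh (g zb) (Dp Dg zb q) = vadd (Dh (g zb) (Dx Dg zb u)) k.

Definition multipliers g Dg C (zb zs : vec (m + n)) : vset l :=
  fun lam => normal_cone C (g zb) lam /\ adj (Dg zb) lam = zs.

(* grad( grad_x g(.)^* lam )(zb) v *)
Definition dx_adj_deriv (D2g : vec (m + n) -> vec (m + n) -> vec (m + n) -> vec l)
  (zb : vec (m + n)) (lam : vec l) (v : vec (m + n)) : vec n :=
  fun j => dot lam (D2g zb v (vpair (vzero : vec m) (basis j))).

(* H_lambda v, where mu = (grad h(g zb)^* )^{-1} lambda *)
Definition Hmap g Dg (D2h : vec l -> vec l -> vec l -> vec e) (zb : vec (m + n))
  (mu : vec e) (v : vec (m + n)) : vec n :=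
  adj (Dx Dg zb) (fun i => dot mu (D2h (g zb) (Dg zb v) (basis i))).

Definition second_order_cond g Dg (D2g : vec (m + n) -> vec (m + n) -> vec (m + n) -> vec l)
  K (Dh : vec l -> vec l -> vec e) (D2h : vec l -> vec l -> vec l -> vec e)
  (zb v : vec (m + n)) : Prop :=
  exists (w : vec (m + n)) (k : vec e), lin_part K k /\
    vadd (Dh (g zb) (D2g zb v v)) (D2h (g zb) (Dg zb v) (Dg zb v))
    = vadd (Dh (g zb) (Dg zb w)) k.

Definition rhs_set g Dg D2g C (Dh : vec l -> vec l -> vec e) D2h
  (zb : vec (m + n)) (xbs : vec n) (v : vec (m + n)) : vset n :=
  fun ys => exists (zs : vec (m + n)) (lam : vec l) (mu : vec e) (ns : vec n),
    normal_cone (tangent_cone (gphGamma g C) zb) v zs /\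
    sndv zs = xbs /\
    multipliers g Dg C zb zs lam /\
    adj (Dh (g zb)) mu = lam /\
    proj2_set (normal_cone (critical_cone (gphGamma g C) zb zs) v) ns /\
    ys = vadd (vadd (dx_adj_deriv D2g zb lam v) (Hmap g Dg D2h zb mu v)) ns.

End Setting.

(* Main.v *)
(* With G = h o g, A = DG(zb), A_x its restriction to the second factor and K° the polar of K:

   - Robinson stability transfers to a local error bound for [G(p, x) in K], so that every
     normal to Gamma(p) near zb is [G_x^* mu] with mu in K°, <mu, G> = 0 and |mu| controlled.
   - Strict complementarity provides mb in ri K° with A_x^* mb = xbs.  For v = (q, u) with q in the
     characteristic subspace and any multiplier mu with <mu, A v> = 0 this forces A v in lin K,
     and it makes the cone of all A_x^*(a - s mu), a in K°, s >= 0, equal to the subspace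
     orthogonal to {u | A_x u in lin K}.
   - Inclusion: along a sequence realising ys, the multipliers cluster at some mu, and
     ys - <mu, D^2 G(v, (0, .))> is orthogonal to {u | A_x u in lin K}.
   - Equality: the second-order condition gives a curve z(t) = zb + t v - t^2 w / 2 with G(z(t))
     within o(t^2) of lin K.  Minimising -<xbs + t ys, d> + rho/2 |d|^2 over the feasible
     displacements d of its x-component yields exact normals; the Lagrangian bound given by the
     multipliers mu + t (a - s mu) shows that the minimisers are o(t). *)
From HB Require Import structures.
Require Import Defs.
From Stdlib Require Import Reals Lra ClassicalEpsilon FunctionalExtensionality.
From Stdlib Require Import IndefiniteDescription.
From mathcomp Require Import all_boot.
Local Open Scope R_scope.

Set Implicit Arguments.

(** * Euclidean vectors *)

(** Multipliers need not be unique, so arbitrary multipliers of nearby normals could escape to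
    infinity. The error bound selects one whose norm is at most a constant times that of the normal,
    by a dominated extension of the normal itself; only such a selection is sure to cluster. For
    equality the obstacle is that points of the graph of [Psi] carry exact normals, while no normal
    is given along the curve. Optimality over the true feasible set manufactures exact ones, at the
    price of a displacement d of the point and an error rho d in the normal. Both are divided by t
    in the graphical derivative, hence the need for |d| = o(t). Comparing values bounds |d|^2 by a
    multiple of the defect of the curve plus terms eps t |d|; a defect O(t^2) would give only |d| =
    O(t). This explains the t^2 correction of the curve, and why its image is compared with lin K,
    where every polar vector vanishes. *)

Lemma Rplus_associative : associative Rplus.
Proof. by move=> x y z; rewrite Rplus_assoc. Qed.

HB.instance Definition _ :=
  Monoid.isComLaw.Build R 0 Rplus Rplus_associative Rplus_comm Rplus_0_l.
HB.instance Definition _ := Monoid.isMulLaw.Build R 0 Rmult Rmult_0_l Rmult_0_r.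
HB.instance Definition _ :=
  Monoid.isAddLaw.Build R Rmult Rplus Rmult_plus_distr_r Rmult_plus_distr_l.

(** Limits are mostly taken by this rule: an inequality is proved up to eps times a fixed constant,
    which avoids handling convergent sequences. *)
Lemma Rle_eps a b c : 0 <= c -> (forall eps, 0 < eps -> a <= b + eps * c) -> a <= b.
Proof.
move=> hc H; case: (Rle_lt_dec a b) => // hab.
have := H ((a - b) / (2 * (c + 1))).
have hp : 0 < (a - b) / (2 * (c + 1)) by apply: Rdiv_lt_0_compat; lra.
move/(_ hp).
have E : (a - b) / (2 * (c + 1)) * (c + 1) = (a - b) / 2 by field; lra.
nra.
Qed.

Section Vectors.
Context {k : nat}.
Implicit Types u v w : vec k.

Lemma vext u v : (forall i, u i = v i) -> u = v.
Proof. by move=> H; apply: functional_extensionality. Qed.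

Lemma dotC u v : dot u v = dot v u.
Proof. by apply: eq_bigr => i _; rewrite Rmult_comm. Qed.

Lemma dotDl u v w : dot (vadd u v) w = dot u w + dot v w.
Proof.
rewrite /dot -big_split /=; apply: eq_bigr => i _.
by rewrite /vadd Rmult_plus_distr_r.
Qed.

Lemma dotZl a u w : dot (vscal a u) w = a * dot u w.
Proof. by rewrite /dot big_distrr /=; apply: eq_bigr => i _; rewrite /vscal Rmult_assoc. Qed.

Lemma dotDr u v w : dot w (vadd u v) = dot w u + dot w v.
Proof. by rewrite dotC dotDl !(dotC w). Qed.

Lemma dotZr a u w : dot w (vscal a u) = a * dot w u.
Proof. by rewrite dotC dotZl (dotC w). Qed.

Lemma dot_sqrD u v : dot (vadd u v) (vadd u v) = dot u u + 2 * dot u v + dot v v.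
Proof. by rewrite dotDl !dotDr (dotC v u); ring. Qed.

Lemma vsubE u v : vsub u v = vadd u (vscal (-1) v).
Proof. by apply: vext => i; rewrite /vsub /vadd /vscal; ring. Qed.

Lemma voppE u : vopp u = vscal (-1) u.
Proof. by apply: vext => i; rewrite /vopp /vscal; ring. Qed.

Lemma dotBl u v w : dot (vsub u v) w = dot u w - dot v w.
Proof. by rewrite vsubE dotDl dotZl; ring. Qed.

Lemma dotBr u v w : dot w (vsub u v) = dot w u - dot w v.
Proof. by rewrite vsubE dotDr dotZr; ring. Qed.

Lemma dotNl u w : dot (vopp u) w = - dot u w.
Proof. by rewrite voppE dotZl; ring. Qed.

Lemma dotNr u w : dot w (vopp u) = - dot w u.
Proof. by rewrite voppE dotZr; ring. Qed.

Lemma dot0l w : dot vzero w = 0.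
Proof. by rewrite /dot big1 // => i _; rewrite /vzero Rmult_0_l. Qed.

Lemma dot0r w : dot w vzero = 0.
Proof. by rewrite dotC dot0l. Qed.

Lemma sum_ge0 (F : 'I_k -> R) : (forall i, 0 <= F i) -> 0 <= \big[Rplus/0]_(i < k) F i.
Proof.
move=> H; elim/big_ind: _ => [|x y|i _]; [lra| lra| exact: H].
Qed.

Lemma sum_le (F F' : 'I_k -> R) : (forall i, F i <= F' i) ->
  \big[Rplus/0]_(i < k) F i <= \big[Rplus/0]_(i < k) F' i.
Proof. by move=> H; elim/big_ind2: _ => [|x x' y y'|i _]; [lra | lra | exact: H]. Qed.

Lemma sq_coord_le u i : u i * u i <= dot u u.
Proof.
rewrite /dot (bigD1 i) //=.
rewrite -[X in X <= _]Rplus_0_r; apply: Rplus_le_compat_l.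
elim/big_ind: _ => [|x y|j _]; [lra| lra| nra].
Qed.

Lemma dot_ge0 u : 0 <= dot u u.
Proof. by apply: sum_ge0 => i; nra. Qed.

Lemma vnorm_sqr u : vnorm u * vnorm u = dot u u.
Proof. exact: sqrt_sqrt (dot_ge0 u). Qed.

Lemma vnorm_ge0 u : 0 <= vnorm u.
Proof. exact: sqrt_pos. Qed.

Lemma vnorm_le a u : 0 <= a -> dot u u <= a * a -> vnorm u <= a.
Proof.
move=> ha H; case: (Rle_lt_dec (vnorm u) a) => // hlt.
by have := vnorm_sqr u; nra.
Qed.

Lemma dot_eq0 u : dot u u <= 0 -> u = vzero.
Proof. by move=> H; apply: vext => i; have := sq_coord_le u i; rewrite /vzero; nra. Qed.

(** Cauchy-Schwarz: expand the square of |v| u - |u| v and divide by |u| |v|, zero vectors being set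
    apart. *)
Lemma dot_le u v : dot u v <= vnorm u * vnorm v.
Proof.
have hu := vnorm_ge0 u; have hv := vnorm_ge0 v.
have su := vnorm_sqr u; have sv := vnorm_sqr v.
case: (Req_dec (vnorm u) 0) => [z|nu].
  have -> : u = vzero by apply: dot_eq0; rewrite -su z; lra.
  by rewrite dot0l; have := vnorm_ge0 (vzero : vec k); nra.
case: (Req_dec (vnorm v) 0) => [z|nv].
  have -> : v = vzero by apply: dot_eq0; rewrite -sv z; lra.
  by rewrite dot0r; have := vnorm_ge0 (vzero : vec k); nra.
have := dot_ge0 (vsub (vscal (vnorm v) u) (vscal (vnorm u) v)).
rewrite dotBl !dotBr !dotZl !dotZr (dotC v u) -su -sv => H.
have p0 : 0 < vnorm u * vnorm v by nra.
by nra.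
Qed.

Lemma dot_abs_le u v : Rabs (dot u v) <= vnorm u * vnorm v.
Proof.
apply: Rabs_le; split; last exact: dot_le.
have := dot_le (vopp u) v; rewrite dotNl.
have -> : vnorm (vopp u) = vnorm u by rewrite /vnorm dotNl dotNr Ropp_involutive.
lra.
Qed.

Lemma dot_ge u v : - (vnorm u * vnorm v) <= dot u v.
Proof. by have := dot_abs_le u v; have := Rle_abs (- dot u v); rewrite Rabs_Ropp; lra. Qed.

Lemma vnormD u v : vnorm (vadd u v) <= vnorm u + vnorm v.
Proof.
have hu := vnorm_ge0 u; have hv := vnorm_ge0 v.
apply: vnorm_le; first lra.
rewrite dot_sqrD -!vnorm_sqr; have := dot_le u v; lra.
Qed.

Lemma vnormZ a u : vnorm (vscal a u) = Rabs a * vnorm u.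
Proof.
rewrite /vnorm dotZl dotZr -Rmult_assoc sqrt_mult_alt; last by nra.
by rewrite -sqrt_Rsqr_abs.
Qed.

Lemma vnorm0 : vnorm (vzero : vec k) = 0.
Proof. by rewrite /vnorm dot0l sqrt_0. Qed.

Lemma vnormN u : vnorm (vopp u) = vnorm u.
Proof. by rewrite /vnorm dotNl dotNr Ropp_involutive. Qed.

Lemma vsub_opp u v : vsub u v = vopp (vsub v u).
Proof. by apply: vext => i; rewrite /vsub /vopp; ring. Qed.

Lemma vnormBC u v : vnorm (vsub u v) = vnorm (vsub v u).
Proof. by rewrite vsub_opp vnormN. Qed.

Lemma vnormB u v : vnorm (vsub u v) <= vnorm u + vnorm v.
Proof. by rewrite vsubE -(vnormN v) voppE; exact: vnormD. Qed.

Lemma vnorm_dist w u v : vnorm (vsub u v) <= vnorm (vsub u w) + vnorm (vsub w v).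
Proof.
have -> : vsub u v = vadd (vsub u w) (vsub w v).
  by apply: vext => i; rewrite /vsub /vadd; ring.
exact: vnormD.
Qed.

Lemma vnormB_ge u v : vnorm u - vnorm v <= vnorm (vsub u v).
Proof.
have -> : u = vadd (vsub u v) v by apply: vext => i; rewrite /vsub /vadd; ring.
have -> : vsub (vadd (vsub u v) v) v = vsub u v.
  by apply: vext => i; rewrite /vsub /vadd; ring.
have := vnormD (vsub u v) v; lra.
Qed.

Lemma coord_le u i : Rabs (u i) <= vnorm u.
Proof.
have := sq_coord_le u i; rewrite -vnorm_sqr => H; have := vnorm_ge0 u => h.
by apply: Rabs_le; nra.
Qed.

Lemma vnorm0_eq u : vnorm u <= 0 -> u = vzero.
Proof.
move=> H; apply: vext => i; have := coord_le u i => Hi.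
have := Rabs_pos (u i) => H2; rewrite /vzero.
have E : Rabs (u i) = 0 by lra.
by case: (Req_dec (u i) 0) => // /Rabs_no_R0.
Qed.

Lemma vsub_eq0 u v : vnorm (vsub u v) <= 0 -> u = v.
Proof.
move/vnorm0_eq => H; apply: vext => i.
by have := f_equal (fun f : vec k => f i) H; rewrite /vsub /vzero; lra.
Qed.

Lemma vnorm_coord u M : 0 <= M -> (forall i, Rabs (u i) <= M) -> vnorm u <= INR k * M.
Proof.
move=> hM H.
have hs : dot u u <= INR k * (M * M).
  have -> : INR k * (M * M) = \big[Rplus/0]_(i < k) (M * M).
    rewrite big_const_ord; elim: (k) => [|j IH]; first by rewrite /=; ring.
    by rewrite S_INR /= -IH; ring.
  apply: sum_le => i; have Hi := H i.
  have := Rabs_pos (u i); have -> : u i * u i = Rabs (u i) * Rabs (u i).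
    by rewrite -Rabs_mult Rabs_pos_eq //; nra.
  nra.
have hk := pos_INR k.
apply: vnorm_le; first nra.
have hj : forall j, INR j = 0 \/ 1 <= INR j.
  by case=> [|j]; [left | right; rewrite S_INR; have := pos_INR j; lra].
by case: (hj k) => hj'; nra.
Qed.

End Vectors.

(** * Linear maps, pairs, compactness *)

Section LinearMaps.
Context {a b : nat}.
Implicit Types (L : vec a -> vec b) (u v : vec a).

Lemma vscal1 k (u : vec k) : vscal 1 u = u.
Proof. by apply: vext => i; rewrite /vscal Rmult_1_l. Qed.

Lemma vscal0 k (u : vec k) : vscal 0 u = vzero.
Proof. by apply: vext => i; rewrite /vscal Rmult_0_l. Qed.

Lemma vaddv0 k (u : vec k) : vadd u vzero = u.
Proof. by apply: vext => i; rewrite /vadd Rplus_0_r. Qed.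

Lemma linD L u v : is_linear L -> L (vadd u v) = vadd (L u) (L v).
Proof. by move=> hL; have := hL u v 1 1; rewrite !vscal1. Qed.

Lemma linZ L c u : is_linear L -> L (vscal c u) = vscal c (L u).
Proof. by move=> hL; have := hL u u c 0; rewrite !vscal0 !vaddv0. Qed.

Lemma lin0 L : is_linear L -> L vzero = vzero.
Proof. by move=> hL; rewrite -(vscal0 vzero) linZ // vscal0. Qed.

Lemma linB L u v : is_linear L -> L (vsub u v) = vsub (L u) (L v).
Proof. by move=> hL; rewrite !vsubE linD // linZ. Qed.

Lemma linN L u : is_linear L -> L (vopp u) = vopp (L u).
Proof. by move=> hL; rewrite !voppE linZ. Qed.

Lemma functional_expand (phi : vec a -> R) :
  (forall u v s t, phi (vadd (vscal s u) (vscal t v)) = s * phi u + t * phi v) ->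
  forall u, phi u = \big[Rplus/0]_(i < a) (u i * phi (basis i)).
Proof.
move=> hphi u.
(* The expansion of [u] in the basis is a fold over an enumeration, evaluated once under [phi] and
   once coordinatewise. *)
pose S r : vec a := foldr (fun i acc => vadd (vscal (u i) (basis i)) acc) vzero r.
have hS r : phi (S r) = \big[Rplus/0]_(i <- r) (u i * phi (basis i)).
  elim: r => [|i r IH].
    by rewrite big_nil /=; have := hphi vzero vzero 0 0; rewrite !vscal0 vaddv0; lra.
  rewrite big_cons -IH /= -[in LHS](vscal1 (S r)) hphi; ring.
rewrite -hS; congr phi; apply: vext => j.
have -> r : S r j = \big[Rplus/0]_(i <- r) (u i * basis i j).
  by elim: r => [|i r IH]; rewrite ?big_nil ?big_cons //= -IH.
rewrite (bigD1 j) //= big1 => [|i /negbTE ne]; rewrite /basis ?eqxx ?ne; lra.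
Qed.

Lemma dot_adj L y u : is_linear L -> dot (adj L y) u = dot y (L u).
Proof.
move=> hL; rewrite (functional_expand (fun u => dot y (L u))) => [|u1 u2 s t].
  by apply: eq_bigr => i _; rewrite Rmult_comm.
by rewrite hL dotDr !dotZr.
Qed.

(** |L u|^2 is the pairing of u with the adjoint at L u, whose coordinates are the products with
    [L (basis i)]; one factor |L u| then cancels. *)
Lemma lin_op_le L M u : is_linear L -> 0 <= M -> (forall i, vnorm (L (basis i)) <= M) ->
  vnorm (L u) <= INR a * M * vnorm u.
Proof.
move=> hL hM H.
have E := dot_adj (L u) u hL; rewrite -vnorm_sqr in E.
have h0 := vnorm_ge0 (L u); have hu := vnorm_ge0 u; have ha := pos_INR a.
have : vnorm (adj L (L u)) <= INR a * (vnorm (L u) * M).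
  apply: vnorm_coord => [|i]; first nra.
  by have := dot_abs_le (L u) (L (basis i)); have := H i; rewrite /adj; nra.
have := dot_le (adj L (L u)) u; rewrite E => H1 H2.
have H3 : vnorm (L u) * vnorm (L u) <= vnorm (L u) * (INR a * M * vnorm u) by nra.
case: (Req_dec (vnorm (L u)) 0) => [->|ne]; last by apply: (Rmult_le_reg_l (vnorm (L u))); lra.
by apply: Rmult_le_pos => //; nra.
Qed.

Lemma lin_bounded L : is_linear L -> exists c, 0 < c /\ forall u, vnorm (L u) <= c * vnorm u.
Proof.
move=> hL.
have [M [hM H]] : exists M, 0 <= M /\ forall i, vnorm (L (basis i)) <= M.
  suff [M [hM H]] : exists M, 0 <= M /\ forall i, i \in enum 'I_a -> vnorm (L (basis i)) <= M.
    by exists M; split=> // i; apply: H; rewrite mem_enum.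
  elim: (enum _) => [|i r [M [hM IH]]]; first by exists 0; split=> //; lra.
  exists (Rmax M (vnorm (L (basis i)))).
  split; first by have := Rmax_l M (vnorm (L (basis i))); lra.
  move=> j; rewrite inE => /orP[/eqP ->|/IH h]; first exact: Rmax_r.
  by have := Rmax_l M (vnorm (L (basis i))); lra.
exists (INR a * M + 1); split; first by have := pos_INR a; nra.
by move=> u; have := lin_op_le u hL hM H; have := vnorm_ge0 u; nra.
Qed.

Lemma lin_comp c L (L' : vec b -> vec c) : is_linear L -> is_linear L' ->
  is_linear (fun u => L' (L u)).
Proof. by move=> h h' u v s t; rewrite h h'. Qed.

End LinearMaps.

Lemma common_radius (k : nat) (P : 'I_k -> R -> Prop) :
  (forall i d d', P i d -> 0 < d' <= d -> P i d') ->
  (forall i, exists d, 0 < d /\ P i d) -> exists d, 0 < d /\ forall i, P i d.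
Proof.
move=> hmono H.
suff [d [hd h]] : exists d, 0 < d /\ forall i, i \in enum 'I_k -> P i d.
  by exists d; split=> // i; apply: h; rewrite mem_enum.
elim: (enum _) => [|i r [d [hd IH]]]; first by exists 1; split=> //; lra.
have [d' [hd' hi]] := H i.
have hm : 0 < Rmin d d' by apply: Rmin_glb_lt.
exists (Rmin d d'); split=> // j; rewrite inE => /orP[/eqP ->|/IH h].
  by apply: (hmono _ d') => //; split=> //; apply: Rmin_r.
by apply: (hmono _ d) => //; split=> //; apply: Rmin_l.
Qed.

Section Pairs.
Context {a b : nat}.
Implicit Types (p q : vec a) (x u : vec b) (z w : vec (a + b)).

Lemma fstv_pair p x : fstv (vpair p x) = p.
Proof. by apply: vext => i; rewrite /fstv /vpair (unsplitK (inl i)). Qed.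

Lemma sndv_pair p x : sndv (vpair p x) = x.
Proof. by apply: vext => i; rewrite /sndv /vpair (unsplitK (inr i)). Qed.

Lemma vpair_eta z : vpair (fstv z) (sndv z) = z.
Proof.
apply: vext => i; rewrite /vpair -[in RHS](splitK i).
by case: (split i).
Qed.

Lemma vpairD p q x u : vadd (vpair p x) (vpair q u) = vpair (vadd p q) (vadd x u).
Proof. by apply: vext => i; rewrite /vadd /vpair; case: (split i). Qed.

Lemma vpairZ c p x : vscal c (vpair p x) = vpair (vscal c p) (vscal c x).
Proof. by apply: vext => i; rewrite /vscal /vpair; case: (split i). Qed.

Lemma dot_pair p q x u : dot (vpair p x) (vpair q u) = dot p q + dot x u.
Proof.
rewrite /dot big_split_ord /=; congr (_ + _); apply: eq_bigr => i _.
  by rewrite /vpair !(unsplitK (inl i)).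
by rewrite /vpair !(unsplitK (inr i)).
Qed.

Lemma vnorm_pair0l x : vnorm (vpair (vzero : vec a) x) = vnorm x.
Proof. by rewrite /vnorm dot_pair dot0l Rplus_0_l. Qed.

Lemma vnorm_pair0r p : vnorm (vpair p (vzero : vec b)) = vnorm p.
Proof. by rewrite /vnorm dot_pair dot0l Rplus_0_r. Qed.

Lemma vnorm_fstv z : vnorm (fstv z) <= vnorm z.
Proof.
rewrite -{2}(vpair_eta z); apply: vnorm_le; first exact: vnorm_ge0.
rewrite vnorm_sqr dot_pair; have := dot_ge0 (sndv z); lra.
Qed.

Lemma vnorm_sndv z : vnorm (sndv z) <= vnorm z.
Proof.
rewrite -{2}(vpair_eta z); apply: vnorm_le; first exact: vnorm_ge0.
rewrite vnorm_sqr dot_pair; have := dot_ge0 (fstv z); lra.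
Qed.

Lemma vnorm_pair p x : vnorm (vpair p x) <= vnorm p + vnorm x.
Proof.
rewrite -(vnorm_pair0l x) -(vnorm_pair0r p).
have -> : vpair p x = vadd (vpair p vzero) (vpair vzero x).
  rewrite vpairD vaddv0; congr vpair.
  by apply: vext => i; rewrite /vadd /vzero Rplus_0_l.
exact: vnormD.
Qed.

Lemma vpair_basisr (i : 'I_b) : vpair (vzero : vec a) (basis i) = basis (rshift a i).
Proof.
apply: vext => j; rewrite -(splitK j) /vpair unsplitK.
by case: (split j) => j' /=; rewrite /basis ?eq_rlshift ?eq_rshift.
Qed.

Lemma linear_sndr : is_linear (fun x => vpair (vzero : vec a) x).
Proof.
move=> u v s t; rewrite !vpairZ vpairD; congr vpair.
by apply: vext => i; rewrite /vadd /vscal /vzero; ring.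
Qed.

End Pairs.

Section Compactness.

(** The index map satisfies only j <= s j: this suffices for cofinality and is stable under
    composition. *)
Lemma real_cluster (u : nat -> R) M : (forall j, Rabs (u j) <= M) ->
  exists (s : nat -> nat) (l : R), (forall j, (j <= s j)%N) /\ Un_cv (fun j => u (s j)) l.
Proof.
move=> H.
have [j|l hl] := Bolzano_Weierstrass u _ (compact_P3 (-M) M).
  by have := H j; have := Rle_abs (u j); have := Rle_abs (- u j); rewrite Rabs_Ropp; lra.
have /functional_choice[s hs] : forall j, exists p, (j <= p)%N /\ Rabs (u p - l) < / INR j.+1.
  move=> j; have hp : 0 < / INR j.+1 by apply: Rinv_0_lt_compat; apply: lt_0_INR; apply/ltP.
  have hn : neighbourhood (disc l (mkposreal _ hp)) l.
    by exists (mkposreal _ hp) => y.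
  by have [p [/leP h1 h2]] := hl _ j hn; exists p.
exists s, l; split=> [j|eps he]; first by have [] := hs j.
have [N [hN hN']] := archimed_cor1 eps he.
exists N => j /leP hj; have [_ h] := hs j.
apply: Rlt_trans h _; apply: Rle_lt_trans hN; apply: Rinv_le_contravar.
  exact: lt_0_INR.
by apply: le_INR; apply/leP; apply: leqW.
Qed.

Lemma bolzano_weierstrass k (u : nat -> vec k) M : (forall j, vnorm (u j) <= M) ->
  exists a, forall eps N, 0 < eps -> exists j, (N <= j)%N /\ vnorm (vsub (u j) a) < eps.
Proof.
move=> H.
have [s [a [hs ha]]] : exists (s : nat -> nat) (a : vec k), (forall j, (j <= s j)%N) /\
    forall i, i \in enum 'I_k -> Un_cv (fun j => u (s j) i) (a i).
  elim: (enum 'I_k) => [|i r [s [a [hs IH]]]]; first by exists id, vzero; split.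
  have [|s' [l [hs' hl]]] := @real_cluster (fun j => u (s j) i) M.
    by move=> j; apply: Rle_trans (coord_le _ _) (H _).
  exists (fun j => s (s' j)), (fun i' => if i' == i then l else a i'); split.
    by move=> j; apply: leq_trans (hs' j) (hs _).
  move=> i'; rewrite inE; case: eqP => [->|_] //= /IH h eps he.
  have [N hN] := h eps he; exists N => j hj; apply: hN.
  by apply/leP; apply: leq_trans (hs' j); apply/leP.
exists a => eps N he.
have he' : 0 < eps / (INR k + 1) by apply: Rdiv_lt_0_compat => //; have := pos_INR k; lra.
have [N1 h1] : exists N1, forall i, i \in enum 'I_k -> forall j, (N1 <= j)%N ->
    Rabs (u (s j) i - a i) <= eps / (INR k + 1).
  elim: (enum 'I_k) ha => [|i r IH] ha; first by exists 0%N.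
  have [|N1 h1] := IH; first by move=> i' hi'; apply: ha; rewrite inE hi' orbT.
  have [|N2 h2] := ha i _ _ he'; first by rewrite inE eqxx.
  exists (maxn N1 N2) => i'; rewrite inE => /orP[/eqP->|hi'] j; rewrite geq_max => /andP[j1 j2].
    by apply: Rlt_le; apply: h2; apply/leP.
  exact: h1.
exists (s (maxn N N1)); split; first by apply: leq_trans (hs _); apply: leq_maxl.
have : vnorm (vsub (u (s (maxn N N1))) a) <= INR k * (eps / (INR k + 1)).
  apply: vnorm_coord => [|i]; first lra.
  by apply: h1; [rewrite mem_enum | apply: leq_maxr].
have E : (INR k + 1) * (eps / (INR k + 1)) = eps by field; have := pos_INR k; lra.
lra.
Qed.

Lemma lsc_attains_min k (S : vset k) (f : vec k -> R) M m :
  closed_vset S -> (exists x, S x) -> (forall x, S x -> vnorm x <= M) ->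
  (forall x, S x -> m <= f x) ->
  (forall x, S x -> forall eps, 0 < eps -> exists d, 0 < d /\
     forall y, S y -> vnorm (vsub y x) < d -> f x - eps < f y) ->
  exists x, S x /\ forall y, S y -> f x <= f y.
Proof.
move=> hc [x0 hx0] hM hm hf.
have [|| I [ub lub]] := completeness (fun r => exists x, S x /\ r = - f x).
- by exists (- m) => r [x [hx ->]]; have := hm x hx; lra.
- by exists (- f x0), x0.
have hI x : S x -> - I <= f x by move=> hx; have := ub (- f x) (ex_intro _ x (conj hx erefl)); lra.
have /functional_choice[u hu] : forall j : nat, exists x, S x /\ f x < - I + / INR j.+1.
  move=> j; apply: NNPP => hn.
  have hp : 0 < / INR j.+1 by apply: Rinv_0_lt_compat; apply: lt_0_INR; apply/ltP.
  suff : I <= I - / INR j.+1 by lra.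
  apply: lub => r [x [hx ->]]; case: (Rle_lt_dec (- f x) (I - / INR j.+1)) => // h.
  by case: hn; exists x; split=> //; lra.
have [a ha] := bolzano_weierstrass u (fun j => hM _ (proj1 (hu j))).
have Sa : S a.
  apply: hc => eps he; have [j [_ hj]] := ha eps 0%N he.
  by exists (u j); split; [exact: (proj1 (hu j)) | rewrite vnormBC].
exists a; split=> // y hy.
suff : f a <= - I by have := hI y hy; lra.
apply: (@Rle_eps _ _ 2) => [|eps he]; first lra.
have [d [hd h]] := hf a Sa eps he.
have [N [hN hN']] := archimed_cor1 eps he.
have [j [hj hj2]] := ha d N hd; have [Sj fj] := hu j.
have := h _ Sj hj2.
have : / INR j.+1 < eps.
  apply: Rle_lt_trans hN; apply: Rinv_le_contravar; first exact: lt_0_INR.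
  by apply: le_INR; apply/leP; apply: leqW.
lra.
Qed.

End Compactness.

(** * Differential calculus *)

Ltac vring :=
  apply: vext => ?; rewrite /vsub /vopp /vadd /vscal /vzero; first [ring | field; lra].

Section Frechet.
Context {a b : nat}.
Implicit Types (f : vec a -> vec b) (L : vec a -> vec b).

Lemma frechet_lip f L x : frechet_at f L x ->
  exists c d, 0 < c /\ 0 < d /\
    forall h, vnorm h < d -> vnorm (vsub (f (vadd x h)) (f x)) <= c * vnorm h.
Proof.
move=> [hL H]; have [c [hc hcL]] := lin_bounded hL; have [d [hd h1]] := H 1 Rlt_0_1.
exists (c + 1), d; split; first lra; split=> // h hh.
have := h1 h hh; have := hcL h => K1 K2.
have -> : vsub (f (vadd x h)) (f x) = vadd (vsub (vsub (f (vadd x h)) (f x)) (L h)) (L h).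
  by vring.
have := vnormD (vsub (vsub (f (vadd x h)) (f x)) (L h)) (L h); lra.
Qed.

Lemma frechet_continuous f L x : frechet_at f L x -> forall eps, 0 < eps ->
  exists d, 0 < d /\ forall y, vnorm (vsub y x) < d -> vnorm (vsub (f y) (f x)) < eps.
Proof.
move=> /frechet_lip[c [d [hc [hd H]]]] eps he.
have he' : 0 < eps / c by apply: Rdiv_lt_0_compat.
exists (Rmin d (eps / c)); split; first exact: Rmin_glb_lt.
move=> y hy; have := Rmin_l d (eps / c); have := Rmin_r d (eps / c) => h1 h2.
have {1}-> : y = vadd x (vsub y x) by vring.
apply: Rle_lt_trans (H _ _) _; first lra.
have -> : eps = c * (eps / c) by field; lra.
apply: Rmult_lt_compat_l; lra.
Qed.

(** Uniformity over directions [v'] near [v] is what tangent cones call for, since they perturb the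
    direction together with the step. *)
Lemma frechet_dir f L x v eps : frechet_at f L x -> 0 < eps ->
  exists d, 0 < d /\ forall t v', 0 < t < d -> vnorm (vsub v' v) < d ->
    vnorm (vsub (vsub (f (vadd x (vscal t v'))) (f x)) (vscal t (L v))) <= eps * t.
Proof.
move=> [hL H] he; have [c [hc hcL]] := lin_bounded hL.
have hv := vnorm_ge0 v.
have e1 : 0 < eps / (2 * (vnorm v + 1)) by apply: Rdiv_lt_0_compat; lra.
have [d [hd h1]] := H _ e1.
set d1 := d / (vnorm v + 1); set d2 := eps / (2 * c).
have p1 : 0 < d1 by apply: Rdiv_lt_0_compat; lra.
have p2 : 0 < d2 by apply: Rdiv_lt_0_compat; lra.
exists (Rmin (Rmin d1 d2) 1); split.
  by apply: Rmin_glb_lt; [exact: Rmin_glb_lt | lra].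
move=> t v' [t0 ht] hv'.
have := Rmin_l (Rmin d1 d2) 1; have := Rmin_r (Rmin d1 d2) 1.
have := Rmin_l d1 d2; have := Rmin_r d1 d2 => m1 m2 m3 m4.
have nv' : vnorm v' <= vnorm v + 1 by have := vnormB_ge v' v; lra.
have ntv : vnorm (vscal t v') = t * vnorm v' by rewrite vnormZ Rabs_pos_eq; lra.
have hv0 := vnorm_ge0 v'.
have ed : d1 * (vnorm v + 1) = d by rewrite /d1; field; lra.
have lt : vnorm (vscal t v') < d.
  by rewrite ntv -ed; apply: Rle_lt_trans (_ : t * (vnorm v + 1) < _); nra.
have := h1 _ lt; rewrite ntv => K1.
have K2 := hcL (vsub v' v).
have -> : vsub (vsub (f (vadd x (vscal t v'))) (f x)) (vscal t (L v)) =
  vadd (vsub (vsub (f (vadd x (vscal t v'))) (f x)) (L (vscal t v'))) (vscal t (L (vsub v' v))).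
  by rewrite (linB _ _ hL) (linZ _ _ hL); vring.
have := vnormD (vsub (vsub (f (vadd x (vscal t v'))) (f x)) (L (vscal t v')))
  (vscal t (L (vsub v' v))); rewrite [vnorm (vscal t (L _))]vnormZ (Rabs_pos_eq t); last lra.
have E1 : eps / (2 * (vnorm v + 1)) * (vnorm v + 1) = eps / 2 by field; lra.
have E2 : c * d2 = eps / 2 by rewrite /d2; field; lra.
have K3 : vnorm (L (vsub v' v)) <= eps / 2.
  by rewrite -E2; apply: Rle_trans K2 _; apply: Rmult_le_compat_l; lra.
have K4 : eps / (2 * (vnorm v + 1)) * (t * vnorm v') <= eps / 2 * t.
  rewrite -E1; apply: Rle_trans (_ : eps / (2 * (vnorm v + 1)) * (t * (vnorm v + 1)) <= _); last lra.
  by apply: Rmult_le_compat_l; [lra | apply: Rmult_le_compat_l; lra].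
have K5 : t * vnorm (L (vsub v' v)) <= t * (eps / 2) by apply: Rmult_le_compat_l; lra.
lra.
Qed.

Lemma ball_segment (x0 x d : vec a) r s : 0 <= s <= 1 -> vnorm (vsub x x0) < r ->
  vnorm (vsub (vadd x d) x0) < r -> vnorm (vsub (vadd x (vscal s d)) x0) < r.
Proof.
move=> hs h1 h2.
have -> : vsub (vadd x (vscal s d)) x0 =
  vadd (vscal (1 - s) (vsub x x0)) (vscal s (vsub (vadd x d) x0)) by vring.
have := vnormD (vscal (1 - s) (vsub x x0)) (vscal s (vsub (vadd x d) x0)).
rewrite !vnormZ !Rabs_pos_eq; [|lra|lra].
set A := vnorm (vsub x x0) in h1 *; set B := vnorm (vsub (vadd x d) x0) in h2 *.
have hA := Rmax_l A B; have hB := Rmax_r A B.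
have hM : Rmax A B < r by apply: Rmax_lub_lt.
have : (1 - s) * A <= (1 - s) * Rmax A B by apply: Rmult_le_compat_l; lra.
have : s * B <= s * Rmax A B by apply: Rmult_le_compat_l; lra.
lra.
Qed.

Lemma frechet_line f L (mu : vec b) x d s : frechet_at f L (vadd x (vscal s d)) ->
  derivable_pt_lim (fun s => dot mu (f (vadd x (vscal s d)))) s (dot mu (L d)).
Proof.
move=> hf eps he; have hm := vnorm_ge0 mu; have hL := proj1 hf.
have e1 : 0 < eps / (2 * (vnorm mu + 1)) by apply: Rdiv_lt_0_compat; lra.
have hd := vnorm_ge0 d.
have e2 : 0 < eps / (2 * (vnorm mu + 1)) / (vnorm d + 1) by apply: Rdiv_lt_0_compat; lra.
have [r [hr H]] := proj2 hf _ e2.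
have p1 : 0 < r / (vnorm d + 1) by apply: Rdiv_lt_0_compat; lra.
exists (mkposreal _ p1) => h h0 hh /=.
have hh' : Rabs h < r / (vnorm d + 1) by [].
have nh : vnorm (vscal h d) < r.
  rewrite vnormZ; have -> : r = r / (vnorm d + 1) * (vnorm d + 1) by field; lra.
  by have := Rabs_pos h; nra.
have := H _ nh; rewrite vnormZ (linZ _ _ hL).
have -> : vadd (vadd x (vscal s d)) (vscal h d) = vadd x (vscal (s + h) d) by vring.
set w := vsub _ (vscal h (L d)) => K.
have -> : (dot mu (f (vadd x (vscal (s + h) d))) - dot mu (f (vadd x (vscal s d)))) / h -
    dot mu (L d) = dot mu w / h.
  by rewrite /w !dotBr dotZr; field.
have ha : 0 < Rabs h by apply: Rabs_pos_lt.
rewrite /Rdiv Rabs_mult Rabs_inv.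
have K1 := dot_abs_le mu w.
have K2 : vnorm w <= eps / (2 * (vnorm mu + 1)) * Rabs h.
  apply: Rle_trans K _.
  have -> : eps / (2 * (vnorm mu + 1)) / (vnorm d + 1) * (Rabs h * vnorm d) =
    eps / (2 * (vnorm mu + 1)) * Rabs h * (vnorm d / (vnorm d + 1)) by field; lra.
  have : vnorm d / (vnorm d + 1) <= 1 by apply: (Rmult_le_reg_r (vnorm d + 1)); rewrite ?Rmult_assoc ?Rinv_l; lra.
  have q : 0 < eps / (2 * (vnorm mu + 1)) * Rabs h by nra.
  by nra.
apply: (Rmult_lt_reg_r (Rabs h)) => //.
rewrite Rmult_assoc Rinv_l; last lra.
rewrite Rmult_1_r; apply: Rle_lt_trans K1 _.
have E : eps / (2 * (vnorm mu + 1)) * (vnorm mu + 1) = eps / 2 by field; lra.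
have : vnorm mu * vnorm w <= vnorm mu * (eps / (2 * (vnorm mu + 1)) * Rabs h) by nra.
nra.
Qed.

(** The intermediate point depends on the fixed [mu]; later [mu] is either the very residual to be
    estimated or a multiplier. *)
Lemma mean_value f (Df : vec a -> vec a -> vec b) (mu : vec b) x d :
  (forall s, 0 <= s <= 1 -> frechet_at f (Df (vadd x (vscal s d))) (vadd x (vscal s d))) ->
  exists s, 0 <= s <= 1 /\
    dot mu (vsub (f (vadd x d)) (f x)) = dot mu (Df (vadd x (vscal s d)) d).
Proof.
move=> H.
have [s [E hs]] := MVT_cor2 (fun s => dot mu (f (vadd x (vscal s d))))
  (fun s => dot mu (Df (vadd x (vscal s d)) d)) 0 1 Rlt_0_1
  (fun s hs => frechet_line mu (H s hs)).
exists s; split; first lra.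
move: E; rewrite vscal1 vscal0 vaddv0 dotBr; lra.
Qed.

End Frechet.

(** Second-order regularity in pointwise form: first derivatives on a ball, second ones at its
    centre only, direction by direction. It is stable under composition and yields the expansion
    [taylor2]. *)
Definition twice_at {a b : nat} (f : vec a -> vec b) (Df : vec a -> vec a -> vec b)
  (D2 : vec a -> vec a -> vec b) (x0 : vec a) (r : R) : Prop :=
  0 < r /\ (forall x, vnorm (vsub x x0) < r -> frechet_at f (Df x) x) /\
  (forall w, frechet_at (fun z => Df z w) (fun v => D2 v w) x0).

(** * Expansions at a point of twice differentiability *)

Section Twice.
Context {a b : nat}.
Variables (f : vec a -> vec b) (Df : vec a -> vec a -> vec b) (D2 : vec a -> vec a -> vec b).
Variables (x0 : vec a) (r : R).
Hypothesis tw : twice_at f Df D2 x0 r.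

Lemma twice_linear x : vnorm (vsub x x0) < r -> is_linear (Df x).
Proof. by move=> h; have [_ [H _]] := tw; case: (H x h). Qed.

Lemma vsub_addl k (x h : vec k) : vsub (vadd x h) x = h.
Proof. by vring. Qed.

Lemma vsubvv k (x : vec k) : vsub x x = vzero.
Proof. by vring. Qed.

Lemma twice_linear0 : is_linear (Df x0).
Proof. by apply: twice_linear; rewrite vsubvv vnorm0; case: tw. Qed.

Lemma D2_linear_l w : is_linear (fun v => D2 v w).
Proof. by have [_ [_ H]] := tw; case: (H w). Qed.

(** Inherited in the limit from the difference quotients (Df z w - Df x0 w) / tau, each linear in
    w. *)
Lemma D2_linear_r v : is_linear (D2 v).
Proof.
move=> w1 w2 s t; apply: vsub_eq0.
apply: (@Rle_eps _ _ (1 + Rabs s + Rabs t)) => [|eps he].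
  by have := Rabs_pos s; have := Rabs_pos t; lra.
have [r0 [_ H]] := tw.
have [d1 [p1 h1]] := frechet_dir v (H (vadd (vscal s w1) (vscal t w2))) he.
have [d2 [p2 h2]] := frechet_dir v (H w1) he.
have [d3 [p3 h3]] := frechet_dir v (H w2) he.
set d4 := r / (vnorm v + 1); have hv := vnorm_ge0 v.
have p4 : 0 < d4 by apply: Rdiv_lt_0_compat; lra.
pose m := Rmin (Rmin d1 d2) (Rmin d3 d4).
have mp : 0 < m by do !apply: Rmin_glb_lt.
have [m1 m2] : m <= Rmin d1 d2 /\ m <= Rmin d3 d4 by split; [apply: Rmin_l | apply: Rmin_r].
have := Rmin_l d1 d2; have := Rmin_r d1 d2; have := Rmin_l d3 d4; have := Rmin_r d3 d4.
move=> n1 n2 n3 n4.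
have nv d : 0 < d -> vnorm (vsub v v) < d by rewrite vsubvv vnorm0.
have {}h1 := h1 (m/2) v ltac:(lra) (nv _ p1).
have {}h2 := h2 (m/2) v ltac:(lra) (nv _ p2).
have {}h3 := h3 (m/2) v ltac:(lra) (nv _ p3).
set z := vadd x0 (vscal (m / 2) v) in h1 h2 h3.
have hz : vnorm (vsub z x0) < r.
  rewrite /z vsub_addl vnormZ Rabs_pos_eq; last lra.
  have E : d4 * (vnorm v + 1) = r by rewrite /d4; field; lra.
  by nra.
rewrite (twice_linear _ hz) (twice_linear0) in h1.
set A := D2 v _ in h1 *; clearbody z; set tau := m / 2 in h1 h2 h3 *.
have tp : 0 < tau by rewrite /tau; lra.
apply: (Rmult_le_reg_l tau) => //.
have -> : tau * vnorm (vsub A (vadd (vscal s (D2 v w1)) (vscal t (D2 v w2)))) =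
   vnorm (vscal tau (vsub A (vadd (vscal s (D2 v w1)) (vscal t (D2 v w2))))).
  by rewrite vnormZ Rabs_pos_eq; lra.
move: h1 h2 h3; set X1 := vsub _ (vscal tau A); set X2 := vsub _ (vscal tau (D2 v w1));
  set X3 := vsub _ (vscal tau (D2 v w2)) => h1 h2 h3.
have -> : vscal tau (vsub A (vadd (vscal s (D2 v w1)) (vscal t (D2 v w2)))) =
  vsub (vadd (vscal s X2) (vscal t X3)) X1 by rewrite /X1 /X2 /X3; vring.
have := vnormB (vadd (vscal s X2) (vscal t X3)) X1; have := vnormD (vscal s X2) (vscal t X3).
rewrite !vnormZ => K1 K2.
have : Rabs s * vnorm X2 <= Rabs s * (eps * tau) by apply: Rmult_le_compat_l => //; exact: Rabs_pos.
have : Rabs t * vnorm X3 <= Rabs t * (eps * tau) by apply: Rmult_le_compat_l => //; exact: Rabs_pos.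
lra.
Qed.

Lemma D2_bounded : exists c, 0 < c /\ forall v w, vnorm (D2 v w) <= c * vnorm v * vnorm w.
Proof.
have [c [hc H]] : exists c, 0 < c /\ forall i : 'I_a, (forall v, vnorm (D2 v (basis i)) <= c * vnorm v).
  (* Applied to reciprocals: a bound with constant 1 / d persists when d decreases, so a common
     radius yields a common constant. *)
  have [||d [hd H]] := @common_radius a (fun i d => forall v, vnorm (D2 v (basis i)) <= / d * vnorm v).
  - move=> i d d' h hd v; apply: Rle_trans (h v) _; apply: Rmult_le_compat_r; first exact: vnorm_ge0.
    by apply: Rinv_le_contravar; lra.
  - move=> i; have [c [hc h]] := lin_bounded (D2_linear_l (basis i)).
    exists (/ c); split; first exact: Rinv_0_lt_compat.
    by move=> v; rewrite Rinv_inv.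
  by exists (/ d); split => //; apply: Rinv_0_lt_compat.
have ha := pos_INR a.
exists (INR a * c + 1); split; first nra.
move=> v w; have := lin_op_le w (D2_linear_r v) _ (fun i => H i v).
have := vnorm_ge0 v; have := vnorm_ge0 w => hw hv.
move/(_ ltac:(nra)); have : 0 <= vnorm v * vnorm w by nra.
lra.
Qed.

(** [twice_at] treats one direction [w] at a time; linearity in [w] reduces uniformity to the
    finitely many basis vectors. *)
Lemma Df_first_order eps : 0 < eps -> exists d, 0 < d /\ forall h w, vnorm h < d ->
  vnorm (vsub (vsub (Df (vadd x0 h) w) (Df x0 w)) (D2 h w)) <= eps * vnorm h * vnorm w.
Proof.
move=> he; have ha := pos_INR a.
have e1 : 0 < eps / (INR a + 1) by apply: Rdiv_lt_0_compat; lra.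
have [r0 [_ H]] := tw.
have [||d [hd h]] := @common_radius a (fun i d => forall h, vnorm h < d ->
  vnorm (vsub (vsub (Df (vadd x0 h) (basis i)) (Df x0 (basis i))) (D2 h (basis i)))
    <= eps / (INR a + 1) * vnorm h).
- by move=> i d d' hi hd h hh; apply: hi; lra.
- by move=> i; have [_ h] := H (basis i); exact: h.
exists (Rmin d r); split; first exact: Rmin_glb_lt.
move=> u w hu; have := Rmin_l d r; have := Rmin_r d r => m1 m2.
have hl : is_linear (Df (vadd x0 u)) by apply: twice_linear; rewrite vsub_addl; lra.
have hl' : is_linear (fun w => vsub (vsub (Df (vadd x0 u) w) (Df x0 w)) (D2 u w)).
  by move=> w1 w2 s t; rewrite hl twice_linear0 D2_linear_r; vring.
have hn := vnorm_ge0 u; have hw := vnorm_ge0 w.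
have := @lin_op_le _ _ _ (eps / (INR a + 1) * vnorm u) w hl' _ (fun i => h i u ltac:(lra)).
move/(_ ltac:(nra)) => K; apply: Rle_trans K _.
have E : eps = (INR a + 1) * (eps / (INR a + 1)) by field; lra.
rewrite {2}E; have : 0 <= vnorm u * vnorm w by nra.
nra.
Qed.

Lemma Df_continuous eps : 0 < eps -> exists d, 0 < d /\ forall x w, vnorm (vsub x x0) < d ->
  vnorm (vsub (Df x w) (Df x0 w)) <= eps * vnorm w.
Proof.
move=> he; have [d [hd h]] := Df_first_order Rlt_0_1; have [c [hc hD]] := D2_bounded.
have p : 0 < eps / (c + 1) by apply: Rdiv_lt_0_compat; lra.
exists (Rmin d (eps / (c + 1))); split; first exact: Rmin_glb_lt.
move=> x w; have := Rmin_l d (eps / (c + 1)); have := Rmin_r d (eps / (c + 1)) => m1 m2.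
have {2}-> : x = vadd x0 (vsub x x0) by vring.
set u := vsub x x0 => hu; have := h u w ltac:(lra); have := hD u w => K1 K2.
have -> : vsub (Df (vadd x0 u) w) (Df x0 w) =
  vadd (vsub (vsub (Df (vadd x0 u) w) (Df x0 w)) (D2 u w)) (D2 u w) by vring.
apply: Rle_trans (vnormD _ _) _.
have hw := vnorm_ge0 w; have hn := vnorm_ge0 u.
have E : (c + 1) * (eps / (c + 1)) = eps by field; lra.
have : (c + 1) * vnorm u <= eps by nra.
nra.
Qed.

Lemma strict_differentiability eps : 0 < eps -> exists d, 0 < d /\ forall x u,
  vnorm (vsub x x0) < d -> vnorm (vsub (vadd x u) x0) < d ->
  vnorm (vsub (vsub (f (vadd x u)) (f x)) (Df x0 u)) <= eps * vnorm u.
Proof.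
move=> he; have [d [hd h]] := Df_continuous he; have [r0 [H _]] := tw.
exists (Rmin d r); split; first exact: Rmin_glb_lt.
move=> x u h1 h2; have := Rmin_l d r; have := Rmin_r d r => m1 m2.
(* The residual is paired with itself: the mean value theorem gives |mu|^2 <= |mu| eps |u|, and one
   factor cancels. *)
set mu := vsub _ (Df x0 u).
have [s [hs E]] : exists s, 0 <= s <= 1 /\
    dot mu (vsub (f (vadd x u)) (f x)) = dot mu (Df (vadd x (vscal s u)) u).
  apply: mean_value => s hs; apply: H.
  by have := ball_segment _ _ _ hs h1 h2; lra.
have K : vnorm mu * vnorm mu <= vnorm mu * (eps * vnorm u).
  rewrite vnorm_sqr {2}/mu dotBr E -dotBr; apply: Rle_trans (dot_le _ _) _.
  apply: Rmult_le_compat_l; first exact: vnorm_ge0.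
  by apply: h; have := ball_segment _ _ _ hs h1 h2; lra.
have := vnorm_ge0 mu; have := vnorm_ge0 u => hu hm.
case: (Req_dec (vnorm mu) 0) => [->|ne]; first nra.
by apply: (Rmult_le_reg_l (vnorm mu)); lra.
Qed.

Lemma taylor2 eps : 0 < eps -> exists d, 0 < d /\ forall u, vnorm u < d ->
  vnorm (vsub (vsub (vsub (f (vadd x0 u)) (f x0)) (Df x0 u)) (vscal (/ 2) (D2 u u)))
    <= eps * (vnorm u * vnorm u).
Proof.
move=> he; have [d [hd h]] := Df_first_order he; have [r0 [H _]] := tw.
exists (Rmin d r); split; first exact: Rmin_glb_lt.
move=> u hu; have := Rmin_l d r; have := Rmin_r d r => m1 m2.
set mu := vsub _ (vscal _ _).
have hn := vnorm_ge0 u.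
have hsu s : 0 <= s <= 1 -> vnorm (vscal s u) <= vnorm u.
  by move=> hs; rewrite vnormZ Rabs_pos_eq; nra.
(* Again paired with the residual: phi 1 - phi 0 = |mu|^2, while [phi'] pairs [mu] with the
   first-order remainder of [Df] along the segment. *)
pose phi s := dot mu (f (vadd x0 (vscal s u))) - s * dot mu (Df x0 u)
  - s * s * (/ 2 * dot mu (D2 u u)).
pose phi' s := dot mu (Df (vadd x0 (vscal s u)) u) - 1 * dot mu (Df x0 u)
  - 2 * s * (/ 2 * dot mu (D2 u u)).
have hd' s : 0 <= s <= 1 -> derivable_pt_lim phi s (phi' s).
  move=> hs; apply: derivable_pt_lim_minus; first apply: derivable_pt_lim_minus.
  - apply: frechet_line; apply: H; rewrite vsub_addl; have := hsu s hs; lra.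
  - rewrite -[X in derivable_pt_lim _ _ X]Rplus_0_r -(Rmult_0_r s).
    by apply: (@derivable_pt_lim_mult id (fun=> _)); [exact: derivable_pt_lim_id | exact: derivable_pt_lim_const].
  - have -> : 2 * s * (/ 2 * dot mu (D2 u u)) =
      (1 * s + s * 1) * (/ 2 * dot mu (D2 u u)) + (s * s) * 0 by ring.
    apply: (@derivable_pt_lim_mult (fun s => s * s) (fun=> _)); last exact: derivable_pt_lim_const.
    by apply: (@derivable_pt_lim_mult id id); exact: derivable_pt_lim_id.
have [s [E hs]] := MVT_cor2 phi phi' 0 1 Rlt_0_1 hd'.
have Em : vnorm mu * vnorm mu = phi' s.
  move: E; rewrite /phi vscal1 vscal0 vaddv0.
  move=> E; rewrite vnorm_sqr {2}/mu !dotBr dotZr; lra.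
have hs' : 0 <= s <= 1 by lra.
have K := h (vscal s u) u ltac:(have := hsu s hs'; lra).
have K2 : phi' s <= vnorm mu * (eps * (vnorm u * vnorm u)).
  have -> : phi' s = dot mu (vsub (vsub (Df (vadd x0 (vscal s u)) u) (Df x0 u)) (D2 (vscal s u) u)).
    by rewrite /phi' (linZ s u (D2_linear_l u)) !dotBr dotZr; field.
  apply: Rle_trans (dot_le _ _) _; apply: Rmult_le_compat_l; first exact: vnorm_ge0.
  apply: Rle_trans K _; rewrite Rmult_assoc; apply: Rmult_le_compat_l; first lra.
  by apply: Rmult_le_compat_r => //; apply: hsu.
have := vnorm_ge0 mu => hm.
case: (Req_dec (vnorm mu) 0) => [->|ne]; first by apply: Rmult_le_pos; nra.
by apply: (Rmult_le_reg_l (vnorm mu)); lra.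
Qed.

End Twice.

Lemma C2_on_twice {a b : nat} (f : vec a -> vec b) Df D2f x0 r :
  0 < r -> C2_on f Df D2f x0 r -> twice_at f Df (D2f x0) x0 r.
Proof.
move=> hr H; split=> //; split=> [x hx|w]; first by have [] := H x hx.
by have [|_ []] := H x0; first rewrite vsubvv vnorm0.
Qed.

Lemma frechet_comp {a b c : nat} (f : vec a -> vec b) (g : vec b -> vec c) L M x :
  frechet_at f L x -> frechet_at g M (f x) ->
  frechet_at (fun z => g (f z)) (fun v => M (L v)) x.
Proof.
move=> hf hg; have hL := proj1 hf; have hM := proj1 hg.
split=> [|eps he]; first exact: lin_comp.
have [cf [df [pc [pd hlip]]]] := frechet_lip hf.
have [cm [pm hcm]] := lin_bounded hM.
have e1 : 0 < eps / (2 * cf) by apply: Rdiv_lt_0_compat; lra.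
have e2 : 0 < eps / (2 * cm) by apply: Rdiv_lt_0_compat; lra.
have [d1 [q1 h1]] := proj2 hg _ e1; have [d2 [q2 h2]] := proj2 hf _ e2.
have q3 : 0 < d1 / cf by apply: Rdiv_lt_0_compat.
exists (Rmin (d1 / cf) (Rmin d2 df)); split; first by do !apply: Rmin_glb_lt.
move=> u hu; have := Rmin_l (d1 / cf) (Rmin d2 df); have := Rmin_r (d1 / cf) (Rmin d2 df).
have := Rmin_l d2 df; have := Rmin_r d2 df => m1 m2 m3 m4.
set k := vsub (f (vadd x u)) (f x).
have hk : vnorm k <= cf * vnorm u by apply: hlip; lra.
have hk1 : vnorm k < d1.
  apply: Rle_lt_trans hk _; have -> : d1 = cf * (d1 / cf) by field; lra.
  by apply: Rmult_lt_compat_l; lra.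
have E : f (vadd x u) = vadd (f x) k by rewrite /k; vring.
have K1 := h1 k hk1; rewrite -E in K1.
have K2 := h2 u ltac:(lra); rewrite -/k in K2.
have K3 := hcm (vsub k (L u)).
have -> : vsub (vsub (g (f (vadd x u))) (g (f x))) (M (L u)) =
  vadd (vsub (vsub (g (f (vadd x u))) (g (f x))) (M k)) (M (vsub k (L u))).
  by rewrite (linB _ _ hM); vring.
apply: Rle_trans (vnormD _ _) _.
have E1 : eps / (2 * cf) * (cf * vnorm u) = eps / 2 * vnorm u by field; lra.
have E2 : cm * (eps / (2 * cm) * vnorm u) = eps / 2 * vnorm u by field; lra.
have : eps / (2 * cf) * vnorm k <= eps / (2 * cf) * (cf * vnorm u) by apply: Rmult_le_compat_l; lra.
have : cm * vnorm (vsub k (L u)) <= cm * (eps / (2 * cm) * vnorm u) by apply: Rmult_le_compat_l; lra.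
lra.
Qed.

Lemma twice_comp {a b c : nat} (g : vec a -> vec b) Dg D2g (h : vec b -> vec c) Dh D2h x0 r s :
  twice_at g Dg D2g x0 r -> twice_at h Dh D2h (g x0) s ->
  exists rho, twice_at (fun z => h (g z)) (fun z w => Dh (g z) (Dg z w))
    (fun v w => vadd (Dh (g x0) (D2g v w)) (D2h (Dg x0 v) (Dg x0 w))) x0 rho.
Proof.
move=> tg th; have [r0 [Hg Hg2]] := tg; have [s0 [Hh Hh2]] := th.
have g0 : frechet_at g (Dg x0) x0 by apply: Hg; rewrite vsubvv vnorm0.
have [d [hd hc]] := frechet_continuous g0 s0.
exists (Rmin d r); split; first exact: Rmin_glb_lt.
split=> [x hx|w].
  have := Rmin_l d r; have := Rmin_r d r => m1 m2.
  by apply: frechet_comp; [apply: Hg; lra | apply: Hh; apply: hc; lra].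
have lh := twice_linear0 th; have lg := twice_linear0 tg.
split.
  move=> u v p q; rewrite (D2_linear_l tg w) lh lg (D2_linear_l th); vring.
move=> eps he.
have F1 : frechet_at (fun z => Dh (g z) (Dg x0 w)) (fun v => D2h (Dg x0 v) (Dg x0 w)) x0.
  exact: (@frechet_comp _ _ _ g (fun y => Dh y (Dg x0 w)) (Dg x0) (fun v => D2h v (Dg x0 w))).
have e3 : 0 < eps / 3 by lra.
have [d1 [p1 h1]] := proj2 F1 _ e3.
have [cl [dl [pcl [pdl hl]]]] := frechet_lip (Hg2 w).
have [ch [pch hch]] := lin_bounded lh.
have e4 : 0 < eps / (3 * cl) by apply: Rdiv_lt_0_compat; lra.
have [d2 [p2 h2]] := Df_continuous th e4.
have [d3 [p3 h3]] := frechet_continuous g0 p2.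
have e5 : 0 < eps / (3 * ch) by apply: Rdiv_lt_0_compat; lra.
have [d4 [p4 h4]] := proj2 (Hg2 w) _ e5.
pose m := Rmin (Rmin (Rmin d1 dl) (Rmin d3 d4)) d.
have mp : 0 < m by do !apply: Rmin_glb_lt.
have n0 : m <= d by apply: Rmin_r.
have n5 : m <= Rmin (Rmin d1 dl) (Rmin d3 d4) by apply: Rmin_l.
have := Rmin_l (Rmin d1 dl) (Rmin d3 d4); have := Rmin_r (Rmin d1 dl) (Rmin d3 d4).
have := Rmin_l d1 dl; have := Rmin_r d1 dl; have := Rmin_l d3 d4; have := Rmin_r d3 d4.
move=> n1 n2 n3 n4 n6 n7.
exists m; split=> // u hu.
have hnu : vnorm (vsub (vadd x0 u) x0) = vnorm u by rewrite vsub_addl.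
have K1 := h1 u ltac:(lra).
have K2 := hl u ltac:(lra).
have K3 := h2 (g (vadd x0 u)) (vsub (Dg (vadd x0 u) w) (Dg x0 w)) (h3 (vadd x0 u) ltac:(lra)).
have K4 := h4 u ltac:(lra).
have K5 := hch (vsub (vsub (Dg (vadd x0 u) w) (Dg x0 w)) (D2g u w)).
have lz : is_linear (Dh (g (vadd x0 u))) by apply: (twice_linear th); apply: hc; lra.
(* Three errors of size eps / 3: [X1] expands [Dh] along g with the direction [Dg x0 w] frozen, [X2]
   is the change of [Dh] applied to the change of [Dg], a product of two small factors, and [X3] is
   the remainder of [Dg] under [Dh (g x0)]. *)
move: K1 K3 K5; set X1 := vsub _ (D2h _ _); set X2 := vsub (Dh _ (vsub _ _)) _;
  set X3 := Dh (g x0) (vsub _ _) => K1 K3 K5.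
have -> : vsub (vsub (Dh (g (vadd x0 u)) (Dg (vadd x0 u) w)) (Dh (g x0) (Dg x0 w)))
   (vadd (Dh (g x0) (D2g u w)) (D2h (Dg x0 u) (Dg x0 w))) = vadd X1 (vadd X2 X3).
  by rewrite /X1 /X2 /X3 !(linB _ _ lh) !(linB _ _ lz); vring.
have := vnormD X1 (vadd X2 X3); have := vnormD X2 X3.
have E1 : eps / (3 * cl) * (cl * vnorm u) = eps / 3 * vnorm u by field; lra.
have E2 : ch * (eps / (3 * ch) * vnorm u) = eps / 3 * vnorm u by field; lra.
have : eps / (3 * cl) * vnorm (vsub (Dg (vadd x0 u) w) (Dg x0 w)) <= eps / 3 * vnorm u.
  by rewrite -E1; apply: Rmult_le_compat_l; lra.
have : ch * vnorm (vsub (vsub (Dg (vadd x0 u) w) (Dg x0 w)) (D2g u w)) <= eps / 3 * vnorm u.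
  by rewrite -E2; apply: Rmult_le_compat_l; lra.
lra.
Qed.

(** * Extension of functionals, convex cones *)

Lemma Rle_eps1 a b c : 0 <= c -> (forall eps, 0 < eps <= 1 -> a <= b + eps * c) -> a <= b.
Proof.
move=> hc H; apply: (@Rle_eps _ _ c) => // eps he.
have := Rmin_l eps 1; have := Rmin_r eps 1 => h1 h2.
have := H (Rmin eps 1) (conj (Rmin_glb_lt _ _ _ he Rlt_0_1) h1); nra.
Qed.

Lemma dot_basis k (i : 'I_k) (y : vec k) : dot (basis i) y = y i.
Proof.
rewrite /dot (bigD1 i) //= big1 => [|j /negbTE ne]; rewrite /basis ?eqxx; first lra.
by rewrite eq_sym ne; lra.
Qed.

Section Extension.
Context {N : nat}.
Implicit Types (y xi : vec N).

Let supp (c : nat) y := forall i : 'I_N, (c <= i)%N -> y i = 0.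

(** Hahn-Banach, one coordinate at a time. [U y r] stands for p(y) <= r with p sublinear, so that p,
    an infimum in the application, is never evaluated. The functional is first dominated on vectors
    supported in the first [c0] coordinates. *)
Lemma riesz_extension (U : vec N -> R -> Prop) (c0 : nat) xi :
  (forall y r y' r', U y r -> U y' r' -> U (vadd y y') (r + r')) ->
  (forall y r s, 0 < s -> U y r -> U (vscal s y) (s * r)) ->
  (forall y, exists r, U y r) ->
  (forall y r, U y r -> (forall i : 'I_N, (c0 <= i)%N -> y i = 0) -> dot xi y <= r) ->
  exists xi', (forall i : 'I_N, (i < c0)%N -> xi' i = xi i) /\
    forall y r, U y r -> dot xi' y <= r.
Proof.
move=> hadd hscal hex.
move E : (N - c0)%N => d; elim: d c0 xi E => [|d IH] c xi E hdom.
  exists xi; split=> // y r hy; apply: hdom => // i hi.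
  by have := ltn_ord i; move/eqP: E; rewrite subn_eq0 => h1; rewrite ltnNge (leq_trans h1 hi).
have hc : (c < N)%N by rewrite -subn_gt0 E.
pose i := Ordinal hc.
pose xi0 := vsub xi (vscal (xi i) (basis i)).
have supp1 y : supp c.+1 y -> y i = 0 -> supp c y.
  move=> h1 h2 j; rewrite leq_eqVlt => /orP[/eqP ej|]; last exact: h1.
  by have -> : j = i by apply: val_inj.
have hdom0 y r : U y r -> supp c.+1 y -> y i = 0 -> dot xi0 y <= r.
  move=> h1 h2 h3; rewrite dotBl dotZl dot_basis h3 Rmult_0_r Rminus_0_r.
  by apply: hdom => //; apply: supp1.
have suppi : supp c.+1 (basis i).
  move=> j hj; rewrite /basis; case: eqP => // ej; move: hj; rewrite -ej /=.
  by rewrite ltnn.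
have bi : basis i i = 1 by rewrite /basis eqxx.
have [r1 U1] := hex (basis i); have [r2 U2] := hex (vscal (-1) (basis i)).
have suppi2 : supp c.+1 (vscal (-1) (basis i)) by move=> j hj; rewrite /vscal suppi //; ring.
have sum y r y' r' : U y r -> U y' r' -> supp c.+1 y -> supp c.+1 y' -> y i + y' i = 0 ->
    dot xi0 y + dot xi0 y' <= r + r'.
  move=> h1 h2 s1 s2 e; rewrite -dotDr; apply: hdom0 => //; first exact: hadd.
  by move=> j hj; rewrite /vadd (s1 j hj) (s2 j hj); ring.
(* The new coordinate is the supremum of its lower constraints, from vectors with [y i = -1]. Each
   lies below every upper constraint, because vectors with opposite i-th coordinates add up to one
   of smaller support. *)
have [|| tau [ub lub]] := completeness (fun t => exists y r, U y r /\ supp c.+1 y /\ y i = -1 /\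
    t = dot xi0 y - r).
- exists (r1 - dot xi0 (basis i)) => t [y [r [h1 [h2 [h3 ->]]]]].
  by have := sum _ _ _ _ h1 U1 h2 suppi ltac:(rewrite h3 bi; lra); lra.
- exists (dot xi0 (vscal (-1) (basis i)) - r2), (vscal (-1) (basis i)), r2.
  by do !split=> //; rewrite /vscal bi; ring.
have [||xi' [h1 h2]] := IH c.+1 (vadd xi0 (vscal tau (basis i))).
- by rewrite subnS E.
- move=> y r Uy sy; rewrite dotDl dotZl dot_basis.
  have [ypos|[y0|yneg]] : 0 < y i \/ y i = 0 \/ y i < 0 by lra.
  + suff H : tau <= / y i * r - dot xi0 (vscal (/ y i) y).
      rewrite dotZr in H.
      have := Rmult_le_compat_l _ _ _ (Rlt_le _ _ ypos) H.
      have -> : y i * (/ y i * r - / y i * dot xi0 y) = r - dot xi0 y by field; lra.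
      lra.
    apply: lub => t [y' [r' [q1 [q2 [q3 ->]]]]].
    have := sum _ _ _ _ q1 (hscal _ _ _ (Rinv_0_lt_compat _ ypos) Uy) q2.
    have s' : supp c.+1 (vscal (/ y i) y) by move=> j hj; rewrite /vscal (sy j hj); ring.
    move/(_ s'); rewrite q3 /vscal Rinv_l; last lra.
    move/(_ ltac:(lra)); rewrite -/(vscal _ _); lra.
  + by have := hdom0 y r Uy sy y0; rewrite y0; lra.
  + have yp : 0 < - y i by lra.
    have H : dot xi0 (vscal (/ - y i) y) - / - y i * r <= tau.
      apply: ub; exists (vscal (/ - y i) y), (/ - y i * r); split.
        by apply: hscal => //; apply: Rinv_0_lt_compat.
      split; first by move=> j hj; rewrite /vscal (sy j hj); ring.
      by split=> //; rewrite /vscal; field; lra.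
    rewrite dotZr in H; have := Rmult_le_compat_l _ _ _ (Rlt_le _ _ yp) H.
    have -> : - y i * (/ - y i * dot xi0 y - / - y i * r) = dot xi0 y - r by field; lra.
    lra.
- exists xi'; split=> // j hj; rewrite h1; last exact: ltnW.
  rewrite /xi0 /vadd /vsub /vscal /basis; case: eqP => [ej|_]; last ring.
  by move: hj; rewrite -ej /= ltnn.
Qed.

(** [U] is the graph of a linear functional on a subspace, single-valued by the condition at zero.
    Each new coordinate is fixed by one vector of the domain that reaches it, and kept if there is
    none. *)
Lemma graph_extension (U : vec N -> R -> Prop) :
  (forall y r y' r' s t, U y r -> U y' r' -> U (vadd (vscal s y) (vscal t y')) (s * r + t * r')) ->
  (forall r, U vzero r -> r = 0) ->
  exists xi, forall y r, U y r -> dot xi y = r.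
Proof.
move=> hlin h0.
suff [xi H] : exists xi, forall y r, U y r -> supp N y -> dot xi y = r.
  by exists xi => y r hy; apply: H => // i; rewrite leqNgt ltn_ord.
suff H c : (c <= N)%N -> exists xi, forall y r, U y r -> supp c y -> dot xi y = r by exact: H.
elim: c => [_|c IH hc].
  exists vzero => y r hy hs; rewrite dot0l; symmetry; apply: h0.
  by have <- : y = vzero by apply: vext => i; apply: hs.
have [xi hxi] := IH (ltnW hc); pose i := Ordinal hc.
have supp1 y : supp c.+1 y -> y i = 0 -> supp c y.
  move=> h1 h2 j; rewrite leq_eqVlt => /orP[/eqP ej|]; last exact: h1.
  by have -> : j = i by apply: val_inj.
case: (classic (exists y r, U y r /\ supp c.+1 y /\ y i <> 0)) => [[y1 [r1 [U1 [s1 n1]]]]|hn].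
  exists (vadd xi (vscal ((r1 - dot xi y1) / y1 i) (basis i))) => y r Uy sy.
  rewrite dotDl dotZl dot_basis.
  have := hxi _ _ (hlin _ _ _ _ 1 (- (y i / y1 i)) Uy U1); rewrite dotDr !dotZr => H.
  suff /H E : supp c (vadd (vscal 1 y) (vscal (- (y i / y1 i)) y1)).
    have -> : r = 1 * dot xi y + - (y i / y1 i) * dot xi y1 + y i / y1 i * r1 by lra.
    field; lra.
  apply: supp1 => [j hj|]; first by rewrite /vadd /vscal (sy j hj) (s1 j hj); ring.
  by rewrite /vadd /vscal; field.
exists xi => y r Uy sy; apply: hxi => //; apply: supp1 => //.
by apply: NNPP => ne; case: hn; exists y, r.
Qed.

Lemma subspace_separation (S : vset N) nu : S vzero ->
  (forall y y' s t, S y -> S y' -> S (vadd (vscal s y) (vscal t y'))) ->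
  ~ S nu -> exists u, (forall y, S y -> dot u y = 0) /\ dot u nu = 1.
Proof.
move=> h0 hS hn.
(* This relation is the functional y + r nu -> r for y in S, well defined since nu is outside S. *)
have [||u hu] := @graph_extension (fun y r => S (vsub y (vscal r nu))).
- move=> y r y' r' s t h1 h2; have := hS _ _ s t h1 h2.
  congr S; vring.
- move=> r hr; apply: NNPP => r0; case: hn.
  have := hS _ _ (- / r) 0 hr h0; congr S; apply: vext => i.
  by rewrite /vadd /vscal /vsub /vzero; field.
- exists u; split=> [y hy|]; apply: hu.
    by move: hy; congr S; vring.
  by move: h0; congr S; vring.
Qed.

End Extension.

(** * Polar cones, projection and the bipolar theorem *)

Definition polar {k : nat} (K : vset k) : vset k := fun mu => forall y, K y -> dot mu y <= 0.

Section Cones.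
Context {k : nat}.
Variable K : vset k.
Hypotheses (Kc : closed_vset K) (Kv : convex_set K) (Kk : is_cone K).

Lemma coneZ y t : 0 <= t -> K y -> K (vscal t y).
Proof. by move=> ht hy; apply: (proj2 Kk). Qed.

Lemma cone0 : K vzero.
Proof. by have [[x hx] _] := Kk; rewrite -(vscal0 x); apply: coneZ => //; lra. Qed.

Lemma coneD x y : K x -> K y -> K (vadd x y).
Proof.
move=> hx hy; have := @coneZ _ 2 ltac:(lra) (@Kv x y (/ 2) hx hy ltac:(lra)).
by congr K; vring.
Qed.

Lemma polarD mu nu : polar K mu -> polar K nu -> polar K (vadd mu nu).
Proof. by move=> h1 h2 y hy; rewrite dotDl; have := h1 y hy; have := h2 y hy; lra. Qed.

Lemma polarZ mu t : 0 <= t -> polar K mu -> polar K (vscal t mu).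
Proof. by move=> ht h y hy; rewrite dotZl; have := h y hy; nra. Qed.

Lemma polar_lin mu y : polar K mu -> lin_part K y -> dot mu y = 0.
Proof. by move=> h [h1 h2]; have := h _ h1; have := h _ h2; rewrite dotNr; lra. Qed.

Lemma lin_partZ y t : lin_part K y -> lin_part K (vscal t y).
Proof.
move=> [h1 h2]; case: (Rle_lt_dec 0 t) => ht; split.
- exact: coneZ.
- by have := coneZ ht h2; congr K; vring.
- have ht' : 0 <= - t by lra.
  by have := coneZ ht' h2; congr K; vring.
- have ht' : 0 <= - t by lra.
  by have := coneZ ht' h1; congr K; vring.
Qed.

Lemma lin_partD y y' : lin_part K y -> lin_part K y' -> lin_part K (vadd y y').
Proof.
move=> [h1 h2] [h3 h4]; split; first exact: coneD.
by have := coneD h2 h4; congr K; vring.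
Qed.

Lemma closed_ball (x : vec k) r : closed_vset (fun y => vnorm (vsub y x) <= r).
Proof.
move=> y H; apply: (@Rle_eps _ _ 1) => [|eps he]; first lra.
have [z [hz hz']] := H eps he; have := vnorm_dist z y x; lra.
Qed.

Lemma closed_setI (A B : vset k) : closed_vset A -> closed_vset B ->
  closed_vset (fun y => A y /\ B y).
Proof.
by move=> hA hB x H; split; [apply: hA | apply: hB] => eps he;
  have [y [[h1 h2] h3]] := H eps he; exists y.
Qed.

(** Moreau decomposition. Restricting to the ball around [y] through the origin gives compactness
    and keeps the nearest point; optimality is then tested along elements of K and along - k0. *)
Lemma cone_projection y : exists k0, K k0 /\ polar K (vsub y k0) /\ dot (vsub y k0) k0 = 0.
Proof.
have [||||| k0 [[Kk0 b0] hmin]] := @lsc_attains_min k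
  (fun x => K x /\ vnorm (vsub x y) <= vnorm y) (fun x => vnorm (vsub x y)) (2 * vnorm y) 0.
- by apply: closed_setI => //; apply: closed_ball.
- by exists vzero; split; [exact: cone0 | rewrite vnormBC; have := vnormB y vzero; rewrite vnorm0; lra].
- by move=> x [_ hx]; have := vnormB_ge x y; lra.
- by move=> x _; apply: vnorm_ge0.
- move=> x _ eps he; exists eps; split=> // x' _ hx'.
  by have := vnorm_dist x' x y; rewrite (vnormBC x x'); lra.
have {}hmin x : K x -> vnorm (vsub k0 y) <= vnorm (vsub x y).
  move=> hx; case: (Rle_lt_dec (vnorm (vsub x y)) (vnorm y)) => h; last lra.
  exact: hmin.
have key x : K (vadd k0 x) -> 0 <= 2 * dot (vsub k0 y) x + dot x x.
  move=> /hmin h; have := Rmult_le_compat _ _ _ _ (vnorm_ge0 _) (vnorm_ge0 _) h h.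
  have -> : vsub (vadd k0 x) y = vadd (vsub k0 y) x by vring.
  rewrite !vnorm_sqr dot_sqrD; lra.
have dir x : (forall t, 0 < t <= 1 -> K (vadd k0 (vscal t x))) -> 0 <= dot (vsub k0 y) x.
  move=> h; suff : - (2 * dot (vsub k0 y) x) <= 0 by lra.
  apply: (@Rle_eps1 _ _ (dot x x)) => [|t ht]; first exact: dot_ge0.
  have := key _ (h t ht); rewrite !dotZr dotZl => K1.
  by apply: (Rmult_le_reg_l t); lra.
have neg x : dot (vsub y k0) x = - dot (vsub k0 y) x by rewrite !dotBl; ring.
exists k0; split=> //; split.
  move=> x hx; rewrite neg; suff : 0 <= dot (vsub k0 y) x by lra.
  by apply: dir => t ht; apply: coneD => //; apply: coneZ => //; lra.
have h1 : 0 <= dot (vsub k0 y) k0.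
  by apply: dir => t ht; apply: coneD => //; apply: coneZ => //; lra.
have h2 : 0 <= dot (vsub k0 y) (vopp k0).
  apply: dir => t ht; have -> : vadd k0 (vscal t (vopp k0)) = vscal (1 - t) k0 by vring.
  by apply: coneZ => //; lra.
by move: h2; rewrite neg dotNr; lra.
Qed.

(** With k0 the projection, y - k0 is polar and orthogonal to k0, so |y - k0|^2 = <y - k0, y> <=
    0. *)
Lemma bipolar y : (forall mu, polar K mu -> dot mu y <= 0) -> K y.
Proof.
move=> H; have [k0 [h0 [h1 h2]]] := cone_projection y.
suff -> : y = k0 by [].
apply: vsub_eq0; apply: vnorm_le; first lra.
by have := H _ h1; rewrite dotBr h2; lra.
Qed.

End Cones.

Section RightInverse.

Lemma linear_eq_basis a b (L L' : vec a -> vec b) : is_linear L -> is_linear L' ->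
  (forall i, L (basis i) = L' (basis i)) -> forall u, L u = L' u.
Proof.
move=> h h' H u; apply: vext => j.
rewrite (functional_expand (fun u => L u j)) => [|u1 u2 s t]; last by rewrite h.
rewrite (functional_expand (fun u => L' u j)) => [|u1 u2 s t]; last by rewrite h'.
by apply: eq_bigr => i _; rewrite H.
Qed.

Lemma linear_right_inverse a b (L : vec a -> vec b) : is_linear L -> surjective_lin L ->
  exists D : vec b -> vec a, is_linear D /\ forall y, L (D y) = y.
Proof.
move=> hL hs; have [d hd] := functional_choice _ (fun i : 'I_b => hs (basis i)).
pose D (y : vec b) : vec a := fun j => dot y (fun i => d i j).
have hD : is_linear D.
  by move=> u v s t; apply: vext => j; rewrite /D /vadd /vscal -/(vadd _ _) dotDl !dotZl.
exists D; split=> // y.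
rewrite (@linear_eq_basis b b (fun y => L (D y)) id) //.
- exact: (@lin_comp _ _ _ D L).
- by move=> i; rewrite -[RHS]hd; congr L; apply: vext => j; rewrite /D dot_basis.
Qed.

End RightInverse.

(** * Cone reducibility and Robinson stability *)

Lemma dist_exists k (A : vset k) x : (exists a, A a) -> exists d, is_dist A x d.
Proof.
move=> [a0 ha0].
have [|| d [ub lub]] := completeness (fun r => exists a, A a /\ r = - vnorm (vsub x a)).
- by exists 0 => r [a [_ ->]]; have := vnorm_ge0 (vsub x a); lra.
- by exists (- vnorm (vsub x a0)), a0.
exists (- d); split=> [a ha|eps he].
  by have := ub _ (ex_intro _ a (conj ha erefl)); lra.
apply: NNPP => hn; suff : d <= d - eps by lra.
apply: lub => r [a [ha ->]]; case: (Rle_lt_dec (- vnorm (vsub x a)) (d - eps)) => // h.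
by case: hn; exists a; split=> //; lra.
Qed.

(* Lyusternik-Graves: at a minimiser y1 of |h y' - zeta| + alpha |y' - y|, a step along a right
   inverse of [Dh y0] would decrease the residual if it were nonzero. *)
Lemma metric_regularity a b (h : vec a -> vec b) Dh D2h y0 r rho :
  twice_at h Dh D2h y0 r -> surjective_lin (Dh y0) -> 0 < rho ->
  exists c d, 0 < c /\ 0 < d /\ forall y zeta,
    vnorm (vsub y y0) < d -> vnorm (vsub (h y) zeta) < d ->
    exists y', h y' = zeta /\ vnorm (vsub y' y0) < rho /\
      vnorm (vsub y' y) <= c * vnorm (vsub (h y) zeta).
Proof.
move=> tw hs hrho; have [r0 [H _]] := tw; have hl := twice_linear0 tw.
have [D [hD hD1]] := linear_right_inverse hl hs.
have [c0 [pc hc0]] := lin_bounded hD.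
(* With this [al], the step u, |u| <= c0 |rr|, leaves a residual of at most |rr| / 4 and costs at
   most |rr| / 4 in distance, so the objective drops by |rr| / 2. It stays in the ball of radius 4
   c0 s because 4 c0 |rr| + |y1 - y| <= 4 c0 s at the minimiser. *)
pose al := / (4 * c0); have pal : 0 < al by apply: Rinv_0_lt_compat; lra.
have [d1 [p1 h1]] := strict_differentiability tw pal.
pose m := Rmin (Rmin d1 r) rho; have pm : 0 < m by do !apply: Rmin_glb_lt.
have m3 : m <= rho by apply: Rmin_r.
have m0 : m <= Rmin d1 r by apply: Rmin_l.
have m1 : Rmin d1 r <= d1 by apply: Rmin_l.
have m2 : Rmin d1 r <= r by apply: Rmin_r.
pose d := m / (2 * (4 * c0 + 1)); have pd : 0 < d by apply: Rdiv_lt_0_compat; lra.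
have ed : d + 4 * c0 * d = m / 2 by rewrite /d; field; lra.
exists (4 * c0), d; split; first lra; split=> // y zeta hy hz.
set s := vnorm (vsub (h y) zeta) in hz *.
have ps : 0 <= s by apply: vnorm_ge0.
have ss : 4 * c0 * s <= 4 * c0 * d by apply: Rmult_le_compat_l; lra.
have inball y' : vnorm (vsub y' y) <= 4 * c0 * s -> vnorm (vsub y' y0) < m.
  by move=> hh; have := vnorm_dist y y' y0; lra.
have eal : al * (4 * c0) = 1 by rewrite /al; field; lra.
have [||||| y1 [b1 hmin]] := @lsc_attains_min a (fun y' => vnorm (vsub y' y) <= 4 * c0 * s)
  (fun y' => vnorm (vsub (h y') zeta) + al * vnorm (vsub y' y)) (vnorm y + 4 * c0 * s) 0.
- exact: closed_ball.
- by exists y; rewrite vsubvv vnorm0; nra.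
- by move=> x hx; have := vnormB_ge x y; lra.
- move=> x _; have := vnorm_ge0 (vsub (h x) zeta); have := vnorm_ge0 (vsub x y); nra.
- move=> x hx eps he.
  have hx' := inball _ hx.
  have fx : frechet_at h (Dh x) x by apply: H; lra.
  have he2 : 0 < eps / 2 by lra.
  have [e1 [pe1 k1]] := frechet_continuous fx he2.
  have pe2 : 0 < eps / (2 * al) by apply: Rdiv_lt_0_compat; lra.
  exists (Rmin e1 (eps / (2 * al))); split; first exact: Rmin_glb_lt.
  move=> x' _ hx2; have := Rmin_l e1 (eps / (2 * al)); have := Rmin_r e1 (eps / (2 * al)).
  move=> n1 n2; have := k1 x' ltac:(lra).
  have := vnorm_dist (h x') (h x) zeta; rewrite (vnormBC (h x) (h x')).
  have := vnorm_dist x' x y; rewrite (vnormBC x x').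
  have : al * vnorm (vsub x' x) < al * (eps / (2 * al)) by apply: Rmult_lt_compat_l; lra.
  have -> : al * (eps / (2 * al)) = eps / 2 by field; lra.
  nra.
have b1' := inball _ b1.
exists y1; split; last by split=> //; lra.
apply: NNPP => hne.
set rr := vsub (h y1) zeta.
have hrr : 0 < vnorm rr.
  case: (Rle_lt_dec (vnorm rr) 0) => // h0; case: hne; exact: vsub_eq0.
have hs0 := hmin y ltac:(rewrite vsubvv vnorm0; nra).
rewrite vsubvv vnorm0 Rmult_0_r Rplus_0_r -/rr -/s in hs0.
set u := D (vopp rr).
have hu : vnorm u <= c0 * vnorm rr by have := hc0 (vopp rr); rewrite vnormN.
have b2 : vnorm (vsub (vadd y1 u) y) <= 4 * c0 * s.
  have -> : vsub (vadd y1 u) y = vadd (vsub y1 y) u by vring.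
  apply: Rle_trans (vnormD _ _) _.
  have := Rmult_le_compat_l _ _ _ (_ : 0 <= 4 * c0) hs0; move/(_ ltac:(lra)).
  have -> : 4 * c0 * (vnorm rr + al * vnorm (vsub y1 y)) =
    4 * c0 * vnorm rr + al * (4 * c0) * vnorm (vsub y1 y) by ring.
  rewrite eal; nra.
have b2' := inball _ b2.
have := hmin _ b2; rewrite -/rr.
have := h1 y1 u ltac:(lra) ltac:(lra).
have -> : vsub (vsub (h (vadd y1 u)) (h y1)) (Dh y0 u) = vsub (h (vadd y1 u)) zeta.
  by rewrite /u hD1 /rr; vring.
have -> : vsub (vadd y1 u) y = vadd (vsub y1 y) u by vring.
have : al * vnorm u <= al * (c0 * vnorm rr) by apply: Rmult_le_compat_l; lra.
have -> : al * (c0 * vnorm rr) = vnorm rr / 4 by rewrite /al; field; lra.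
have := vnormD (vsub y1 y) u.
nra.
Qed.

Section Reducible.
Context {l e : nat}.
Variables (C : vset l) (K : vset e) (h : vec l -> vec e) (Dh : vec l -> vec l -> vec e).
Variables (D2h : vec l -> vec l -> vec l -> vec e) (y0 : vec l).
Hypothesis red : cone_reducible C K h Dh D2h y0.

Lemma reducible_cone : closed_vset K /\ convex_set K /\ is_cone K.
Proof. by have [? [? [? _]]] := red. Qed.

Lemma reducible_twice : exists r, twice_at h Dh (D2h y0) y0 r.
Proof.
by have [_ [_ [_ [r [hr [hC _]]]]]] := red; exists r; apply: C2_on_twice.
Qed.

Lemma reducible_linear : is_linear (Dh y0).
Proof. by have [r tw] := reducible_twice; apply: twice_linear0 tw. Qed.

Lemma reducible_base : h y0 = vzero.
Proof. by have [_ [_ [_ [r [_ [_ [h0 _]]]]]]] := red. Qed.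

(** Metric regularity solves [h y' = k] exactly, and near y0 membership in C is read off h. *)
Lemma reducible_projection : exists c d, 0 < c /\ 0 < d /\ forall y k,
  vnorm (vsub y y0) < d -> K k -> vnorm (vsub (h y) k) < d ->
  exists y', C y' /\ vnorm (vsub y' y) <= c * vnorm (vsub (h y) k).
Proof.
have [_ [_ [_ [r [hr [hC [h0 [hs hCK]]]]]]]] := red.
have [c [d [hc [hd H]]]] := metric_regularity (C2_on_twice hr hC) hs hr.
exists c, d; split=> //; split=> // y k hy hk hyk.
have [y' [E [h1 h2]]] := H y k hy hyk; exists y'; split=> //.
by apply/(hCK _ h1); rewrite E.
Qed.

Lemma reducible_frechet : frechet_at h (Dh y0) y0.
Proof. by have [r [r0 [H _]]] := reducible_twice; apply: H; rewrite vsubvv vnorm0. Qed.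

Lemma polar_normal mu : polar K mu -> C y0 -> normal_cone C y0 (adj (Dh y0) mu).
Proof.
move=> hmu hy0; split=> // eps he.
have [_ [_ [_ [r [hr [_ [h0 [_ hCK]]]]]]]] := red.
have hm := vnorm_ge0 mu.
have e1 : 0 < eps / (vnorm mu + 1) by apply: Rdiv_lt_0_compat; lra.
have [hl Hf] := reducible_frechet; have [d [hd hf]] := Hf _ e1.
exists (Rmin d r); split; first exact: Rmin_glb_lt.
move=> y hy hyd; have := Rmin_l d r; have := Rmin_r d r => m1 m2.
have hk : K (h y) by apply/hCK => //; lra.
have := hf (vsub y y0) ltac:(lra).
have -> : vadd y0 (vsub y y0) = y by vring.
set w := vsub _ (Dh y0 (vsub y y0)) => hw.
rewrite dot_adj //.
have -> : Dh y0 (vsub y y0) = vsub (h y) w by rewrite /w h0; vring.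
rewrite dotBr; have := hmu _ hk; have := dot_abs_le mu w; have := Rle_abs (- dot mu w).
rewrite Rabs_Ropp => k1 k2 k3.
have hn := vnorm_ge0 (vsub y y0).
have E : eps = (vnorm mu + 1) * (eps / (vnorm mu + 1)) by field; lra.
have : vnorm mu * vnorm w <= vnorm mu * (eps / (vnorm mu + 1) * vnorm (vsub y y0)) by nra.
have : eps * vnorm (vsub y y0) = (vnorm mu + 1) * (eps / (vnorm mu + 1)) * vnorm (vsub y y0).
  by rewrite -E.
nra.
Qed.

(** h (y0 + t v) is within eps t of t Dh v, a point of K, so y0 + t v lies within O(eps t) of C.
    Hence v is tangent to C and pairs nonpositively with normals. *)
Lemma normal_tangent lam v : normal_cone C y0 lam -> K (Dh y0 v) -> dot lam v <= 0.
Proof.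
move=> [hy0 hlam] hv.
have [_ [_ hKk]] := reducible_cone.
have [c [d [hc [hd H]]]] := reducible_projection.
have hn := vnorm_ge0 v; have hnl := vnorm_ge0 lam.
apply: (@Rle_eps1 _ _ (vnorm v + c + vnorm lam * c)) => [|eps he]; first nra.
have [dl [pdl hdl]] := hlam eps (proj1 he).
have [df [pdf hdf]] := frechet_dir v reducible_frechet (proj1 he).
pose m := Rmin (Rmin d dl) (Rmin df 1); pose t := m / (2 * (vnorm v + c + 1)).
have pm : 0 < m by do !apply: Rmin_glb_lt => //; lra.
have pt : 0 < t by apply: Rdiv_lt_0_compat; lra.
have et : t * (vnorm v + c + 1) = m / 2 by rewrite /t; field; lra.
have m1 : m <= Rmin d dl by apply: Rmin_l.
have m2 : m <= Rmin df 1 by apply: Rmin_r.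
have m3 : Rmin d dl <= d by apply: Rmin_l.
have m4 : Rmin d dl <= dl by apply: Rmin_r.
have m5 : Rmin df 1 <= df by apply: Rmin_l.
have tv : 0 <= t * vnorm v by nra.
have tc : 0 <= t * c by nra.
have t1 : t <= m / 2 by lra.
have := hdf t v ltac:(lra) ltac:(rewrite vsubvv vnorm0; lra).
have -> : vsub (vsub (h (vadd y0 (vscal t v))) (h y0)) (vscal t (Dh y0 v)) =
   vsub (h (vadd y0 (vscal t v))) (vscal t (Dh y0 v)) by rewrite reducible_base; vring.
move=> h1.
have ntv : vnorm (vscal t v) = t * vnorm v by rewrite vnormZ Rabs_pos_eq; lra.
have et1 : eps * t <= t by nra.
have [||| y' [hy' hy2]] := H (vadd y0 (vscal t v)) (vscal t (Dh y0 v)).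
- by rewrite vsub_addl ntv; lra.
- by apply: coneZ => //; lra.
- lra.
have h2 : vnorm (vsub y' (vadd y0 (vscal t v))) <= c * (eps * t) by nra.
have ce : c * (eps * t) <= t * c by nra.
have h3 : vnorm (vsub y' y0) <= t * vnorm v + c * (eps * t).
  have -> : vsub y' y0 = vadd (vsub y' (vadd y0 (vscal t v))) (vscal t v) by vring.
  by apply: Rle_trans (vnormD _ _) _; lra.
have := hdl y' hy' ltac:(lra).
have E : vsub y' y0 = vadd (vsub y' (vadd y0 (vscal t v))) (vscal t v) by vring.
rewrite {1}E dotDr dotZr.
have := dot_abs_le lam (vsub y' (vadd y0 (vscal t v))).
have := Rle_abs (- dot lam (vsub y' (vadd y0 (vscal t v)))); rewrite Rabs_Ropp => k1 k2 k3.
have k4 : vnorm lam * vnorm (vsub y' (vadd y0 (vscal t v))) <= vnorm lam * (c * (eps * t)) by nra.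
have k5 : eps * vnorm (vsub y' y0) <= eps * (t * vnorm v + t * c) by nra.
by apply: (Rmult_le_reg_l t) => //; nra.
Qed.

(** For v in the kernel of [Dh y0] both v and - v are tangent, so lam vanishes on the kernel and
    factors through a linear right inverse. *)
Lemma normal_adj lam : normal_cone C y0 lam -> exists mu, adj (Dh y0) mu = lam.
Proof.
move=> hlam; have [_ [_ [_ [r [_ [_ [_ [hs _]]]]]]]] := red.
have [_ [_ hKk]] := reducible_cone; have hl := reducible_linear.
have [D [hD hD1]] := linear_right_inverse hl hs.
have ker v : Dh y0 v = vzero -> dot lam v = 0.
  move=> hv; have h1 := @normal_tangent _ v hlam ltac:(rewrite hv; exact: cone0).
  have := @normal_tangent _ (vopp v) hlam; rewrite (linN _ hl) hv dotNr.
  have -> : vopp (vzero : vec e) = vzero by vring.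
  by move/(_ (cone0 hKk)); lra.
exists (adj D lam); apply: vext => i.
rewrite /adj dot_adj // -(Rplus_0_r (dot _ _)) -(@ker (vsub (basis i) (D (Dh y0 (basis i))))).
  by rewrite dotBr (dotC _ (basis i)) dot_basis; ring.
by rewrite (linB _ _ hl) hD1 vsubvv.
Qed.

Lemma normal_polar mu : normal_cone C y0 (adj (Dh y0) mu) -> polar K mu.
Proof.
move=> hn; have [_ [_ [_ [r [_ [_ [_ [hs _]]]]]]]] := red.
move=> k hk; have [v hv] := hs k; rewrite -hv -dot_adj; last exact: reducible_linear.
by apply: normal_tangent => //; rewrite hv.
Qed.

(** Relative interiority in its algebraic form: a small move along any difference of polar vectors
    stays polar. It comes from the affine combination of normals with weights 1, t, - t. *)
Lemma relint_normal lam : rel_interior (normal_cone C y0) lam -> exists mu,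
  adj (Dh y0) mu = lam /\ polar K mu /\
  forall al be, polar K al -> polar K be ->
    exists eps, 0 < eps /\ polar K (vadd mu (vscal eps (vsub al be))).
Proof.
move=> [hlam [d [hd H]]]; have hy0 := proj1 hlam.
have [mu E] := normal_adj hlam; have hl := reducible_linear.
exists mu; split=> //; split; first by apply: normal_polar; rewrite E.
move=> al be hal hbe.
set A := adj (Dh y0) al; set B := adj (Dh y0) be.
have hn := vnorm_ge0 (vsub A B).
pose t := d / (2 * (vnorm (vsub A B) + 1)).
have pt : 0 < t by apply: Rdiv_lt_0_compat; lra.
exists t; split=> //; apply: normal_polar.
have -> : adj (Dh y0) (vadd mu (vscal t (vsub al be))) = vadd lam (vscal t (vsub A B)).
  by rewrite -E; apply: vext => i; rewrite /A /B /adj /vadd /vscal /vsub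
    -/(vadd _ _) dotDl -/(vscal _ _) dotZl -/(vsub _ _) dotBl.
apply: H.
  exists [:: (1, lam); (t, A); (- t, B)]; split.
    move=> p /= [<-|[<-|[<-|]]] //=; exact: polar_normal.
  split; first by rewrite /=; ring.
  by rewrite /=; vring.
rewrite vsub_addl vnormZ Rabs_pos_eq; last lra.
have : t * (vnorm (vsub A B) + 1) = d / 2 by rewrite /t; field; lra.
lra.
Qed.

End Reducible.

Section Robinson.
Context {m n l e : nat}.
Variables (g : vec (m + n) -> vec l) (C : vset l) (K : vset e).
Variables (h : vec l -> vec e) (Dh : vec l -> vec l -> vec e) (D2h : vec l -> vec l -> vec l -> vec e).
Variables (pb : vec m) (xb : vec n) (L : vec (m + n) -> vec l).
Let zb := vpair pb xb.
Hypothesis red : cone_reducible C K h Dh D2h (g zb).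
Hypothesis g_diff : frechet_at g L zb.
Hypothesis rob : robinson_stable g C pb xb.
Hypothesis Cb : C (g zb).

(** Chaining [reducible_projection] with Robinson stability replaces the distance to C by the
    distance of h (g (p, x)) to any nearby k in K. The slack [eta] accounts for distances being
    infima. *)
Lemma robinson_cone : exists c d, 0 < c /\ 0 < d /\ forall p x k,
  vnorm (vsub p pb) < d -> vnorm (vsub x xb) < d -> K k ->
  vnorm (vsub (h (g (vpair p x))) k) < d -> forall eta, 0 < eta ->
  exists x', Gamma g C p x' /\
    vnorm (vsub x' x) <= c * vnorm (vsub (h (g (vpair p x))) k) + eta.
Proof.
have [kap [d1 [hk [hd1 H1]]]] := rob.
have [c [d2 [hc [hd2 H2]]]] := reducible_projection red.
have [d3 [hd3 H3]] := frechet_continuous g_diff hd2.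
pose d := Rmin (Rmin d1 d2) (d3 / 2).
have pd : 0 < d by do !apply: Rmin_glb_lt => //; lra.
have m1 : d <= Rmin d1 d2 by apply: Rmin_l.
have m2 : d <= d3 / 2 by apply: Rmin_r.
have m3 : Rmin d1 d2 <= d1 by apply: Rmin_l.
have m4 : Rmin d1 d2 <= d2 by apply: Rmin_r.
exists (kap * c + 1), d; split; first nra; split=> //.
move=> p x k hp hx Kk hyk eta heta.
have hz : vnorm (vsub (vpair p x) zb) < d3.
  have -> : vsub (vpair p x) zb = vpair (vsub p pb) (vsub x xb).
    by rewrite /zb !vsubE vpairZ vpairD.
  by have := vnorm_pair (vsub p pb) (vsub x xb); lra.
have [y' [Cy' hy']] := H2 _ k (H3 _ hz) Kk ltac:(lra).
have [D2 hD2] := @dist_exists l C (g (vpair p x)) (ex_intro _ _ Cb).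
have [D1 [hD1 hle]] := H1 p x ltac:(lra) ltac:(lra) D2 hD2.
have := proj1 hD2 _ Cy'; rewrite vnormBC => hD2'.
have [x' [hx' hx2]] := proj2 hD1 eta heta.
exists x'; split=> //; rewrite vnormBC.
have hn := vnorm_ge0 (vsub (h (g (vpair p x))) k).
have : kap * D2 <= kap * (c * vnorm (vsub (h (g (vpair p x))) k)) by apply: Rmult_le_compat_l; lra.
lra.
Qed.

End Robinson.

(** * The system G(p, x) in K *)

Lemma Req_eps1 a b c : 0 <= c -> (forall eps, 0 < eps <= 1 -> Rabs (a - b) <= eps * c) -> a = b.
Proof.
move=> hc H; apply: Rle_antisym; apply: (@Rle_eps1 _ _ c) => // eps he; have := H eps he.
  by have := Rle_abs (a - b); lra.
by have := Rle_abs (- (a - b)); rewrite Rabs_Ropp; lra.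
Qed.

Lemma dot_close k (mu mu' y y' : vec k) :
  Rabs (dot mu y - dot mu' y') <= vnorm (vsub mu mu') * vnorm y' + vnorm mu * vnorm (vsub y y').
Proof.
have -> : dot mu y - dot mu' y' = dot (vsub mu mu') y' + dot mu (vsub y y').
  by rewrite dotBl dotBr; ring.
apply: Rle_trans (Rabs_triang _ _) _.
by have := dot_abs_le (vsub mu mu') y'; have := dot_abs_le mu (vsub y y'); lra.
Qed.

(** One eps controls step and direction at once; sequences are recovered from eps = 1 / (j + 1). *)
Lemma tangent_coneP k (O : vset k) z w : tangent_cone O z w <->
  forall eps, 0 < eps -> exists t w', 0 < t < eps /\ vnorm (vsub w' w) < eps /\
    O (vadd z (vscal t w')).
Proof.
split=> [[t [ws [tp [t0 [w0 hO]]]]] eps he|H].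
  have [N1 h1] := t0 eps he; have [N2 h2] := w0 eps he.
  exists (t (maxn N1 N2)), (ws (maxn N1 N2)).
  have := h1 (maxn N1 N2) ltac:(apply/leP; exact: leq_maxl).
  have := h2 (maxn N1 N2) ltac:(apply/leP; exact: leq_maxr).
  rewrite /Rdist !Rminus_0_r !Rabs_pos_eq; [|exact: Rlt_le|exact: vnorm_ge0].
  by move=> a1 a2; do !split.
have hinv (j : nat) : 0 < / INR j.+1 by apply: Rinv_0_lt_compat; apply: lt_0_INR; apply/ltP.
have /functional_choice[tw htw] : forall j : nat, exists p : R * vec k,
    0 < p.1 < / INR j.+1 /\ vnorm (vsub p.2 w) < / INR j.+1 /\ O (vadd z (vscal p.1 p.2)).
  by move=> j; have [t [w' h]] := H _ (hinv j); exists (t, w').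
have lim (f : nat -> R) : (forall j, 0 <= f j < / INR j.+1) -> Un_cv f 0.
  move=> hf eps he; have [N [hN hN']] := archimed_cor1 eps he.
  exists N => j /leP hj; rewrite /Rdist Rminus_0_r Rabs_pos_eq; last by have := hf j; lra.
  apply: Rlt_trans (proj2 (hf j)) _; apply: Rle_lt_trans hN; apply: Rinv_le_contravar.
    exact: lt_0_INR.
  by apply: le_INR; apply/leP; apply: leqW.
exists (fun j => (tw j).1), (fun j => (tw j).2); split; first by move=> j; have := htw j; lra.
split; first by apply: lim => j; have := htw j; lra.
split; first by apply: lim => j; split; [exact: vnorm_ge0 | have := htw j; lra].
by move=> j; have [_ []] := htw j.
Qed.

Section ConeSystem.
Context {m n e : nat}.
Variables (G : vec (m + n) -> vec e) (DG : vec (m + n) -> vec (m + n) -> vec e).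
Variables (D2 : vec (m + n) -> vec (m + n) -> vec e).
Variables (K : vset e) (Gam : vec m -> vset n) (pb : vec m) (xb : vec n).
Variables (r c0 d0 : R).
Let zb := vpair pb xb.
Let A := DG zb.
Let ex (u : vec n) : vec (m + n) := vpair (vzero : vec m) u.
Hypothesis tw : twice_at G DG D2 zb r.
Hypothesis G0 : G zb = vzero.
Hypotheses (Kc : closed_vset K) (Kv : convex_set K) (Kk : is_cone K).
Hypotheses (c0pos : 0 < c0) (d0pos : 0 < d0).
Hypothesis Gam_local : forall p x, vnorm (vsub p pb) < d0 -> vnorm (vsub x xb) < d0 ->
  (Gam p x <-> K (G (vpair p x))).
Hypothesis Gam_error_bound : forall p x k,
  vnorm (vsub p pb) < d0 -> vnorm (vsub x xb) < d0 -> K k ->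
  vnorm (vsub (G (vpair p x)) k) < d0 -> forall eta, 0 < eta ->
  exists x', Gam p x' /\ vnorm (vsub x' x) <= c0 * vnorm (vsub (G (vpair p x)) k) + eta.

Lemma vsub_pair p x : vsub (vpair p x) zb = vpair (vsub p pb) (vsub x xb).
Proof. by rewrite /zb !vsubE vpairZ vpairD. Qed.

Lemma vadd_ex p x t u : vadd (vpair p x) (vscal t (ex u)) = vpair p (vadd x (vscal t u)).
Proof. by rewrite /ex vpairZ vpairD; congr vpair; vring. Qed.

Lemma linear_ex z : vnorm (vsub z zb) < r -> is_linear (fun u => DG z (ex u)).
Proof. by move=> hz; apply: (lin_comp linear_sndr); apply: (twice_linear tw). Qed.

Lemma linear_A : is_linear A.
Proof. exact: twice_linear0 tw. Qed.

Lemma linear_Aex : is_linear (fun u => A (ex u)).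
Proof. exact: (lin_comp linear_sndr linear_A). Qed.

(** The vectors k - s G(z) point from G(z) into K. When w is mapped to one of them, x + t w is
    feasible to first order; otherwise the error bound repairs it at a cost c0 t N + o(t), and the
    normal inequality is tested at the repaired point. *)
Lemma normal_slope p x xs w k s :
  vnorm (vsub p pb) < d0 -> vnorm (vsub x xb) < d0 -> vnorm (vsub (vpair p x) zb) < r ->
  normal_cone (Gam p) x xs -> K k -> 0 <= s ->
  dot xs w <= c0 * vnorm xs *
    vnorm (vsub (DG (vpair p x) (ex w)) (vsub k (vscal s (G (vpair p x))))).
Proof.
move=> hp hx hz [gx hN] hk hs; set z := vpair p x in hz *.
set N := vnorm (vsub _ _); have hNn : 0 <= N by apply: vnorm_ge0.
have KG : K (G z) by apply/Gam_local.
have hxs := vnorm_ge0 xs; have hw := vnorm_ge0 w.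
pose Q := vnorm w + c0 * (1 + N) + 1; have hQ : 0 < Q by rewrite /Q; nra.
apply: (@Rle_eps1 _ _ (Q + vnorm xs * (c0 + 1))) => [|eps he]; first nra.
have [dl [pdl hdl]] := hN eps (proj1 he).
have fz : frechet_at G (DG z) z by have [_ [H _]] := tw; exact: H.
have [df [pdf hdf]] := frechet_dir (ex w) fz (proj1 he).
pose mm := Rmin (Rmin df dl) (Rmin d0 (d0 - vnorm (vsub x xb))).
have pm : 0 < mm by do !apply: Rmin_glb_lt => //; lra.
have m1 : mm <= Rmin df dl by apply: Rmin_l.
have m2 : mm <= Rmin d0 (d0 - vnorm (vsub x xb)) by apply: Rmin_r.
have m3 : Rmin df dl <= df by apply: Rmin_l.
have m4 : Rmin df dl <= dl by apply: Rmin_r.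
have m5 : Rmin d0 (d0 - vnorm (vsub x xb)) <= d0 by apply: Rmin_l.
have m6 : Rmin d0 (d0 - vnorm (vsub x xb)) <= d0 - vnorm (vsub x xb) by apply: Rmin_r.
pose W := Q + 1 + N + s * mm.
have hsm : 0 <= s * mm by nra.
have hW : 0 < W by rewrite /W; lra.
(* The denominator dominates Q, 1 + N, |w| and s mm, so one identity gives all of [q1] to [q5]; the
   term s mm is there for t s <= 1. *)
pose t := mm / (2 * (W + s * mm + 1)).
have pt : 0 < t by apply: Rdiv_lt_0_compat; lra.
have et : t * (W + s * mm + 1) = mm / 2 by rewrite /t; field; lra.
have q1 : t * Q <= mm / 2 by rewrite -et; apply: Rmult_le_compat_l; rewrite /W; lra.
have q2 : t * (1 + N) <= mm / 2 by rewrite -et; apply: Rmult_le_compat_l; rewrite /W; lra.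
have q3 : t * 1 <= mm / 2 by rewrite -et; apply: Rmult_le_compat_l; lra.
have q4 : t * vnorm w <= mm / 2.
  by rewrite -et; apply: Rmult_le_compat_l; rewrite /W /Q; nra.
have q5 : t * s <= 1.
  apply: (Rmult_le_reg_r mm) => //.
  have : t * (s * mm) <= mm / 2 by rewrite -et; apply: Rmult_le_compat_l; lra.
  lra.
have et1 : eps * t <= t by nra.
set x1 := vadd x (vscal t w).
have Ez : vpair p x1 = vadd z (vscal t (ex w)) by rewrite /z vadd_ex.
have ntw : vnorm (vscal t w) = t * vnorm w by rewrite vnormZ Rabs_pos_eq; lra.
have hx1 : vnorm (vsub x1 xb) < d0.
  have -> : vsub x1 xb = vadd (vsub x xb) (vscal t w) by rewrite /x1; vring.
  by have := vnormD (vsub x xb) (vscal t w); rewrite ntw; lra.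
(* This is G(z) + t (k - s G(z)), written as a conic combination since t s <= 1. *)
pose kt := vadd (vscal t k) (vscal (1 - t * s) (G z)).
have Kkt : K kt by apply: coneD => //; apply: coneZ => //; lra.
have hk1 : vnorm (vsub (G (vpair p x1)) kt) <= eps * t + t * N.
  have := hdf t (ex w) ltac:(lra) ltac:(rewrite vsubvv vnorm0; lra); rewrite -Ez.
  set X := vsub _ (vscal t (DG z _)) => hX.
  have -> : vsub (G (vpair p x1)) kt =
     vadd X (vscal t (vsub (DG z (ex w)) (vsub k (vscal s (G z))))).
    by rewrite /X /kt; vring.
  by apply: Rle_trans (vnormD _ _) _; rewrite vnormZ Rabs_pos_eq; [rewrite -/N; lra | lra].
have pet : 0 < eps * t by nra.
have [|x' [gx' hx']] := @Gam_error_bound p x1 kt hp hx1 Kkt _ _ pet; first lra.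
have hx2 : vnorm (vsub x' x1) <= c0 * (eps * t + t * N) + eps * t by nra.
have hx3 : vnorm (vsub x' x) <= t * Q.
  have -> : vsub x' x = vadd (vsub x' x1) (vscal t w) by rewrite /x1; vring.
  apply: Rle_trans (vnormD _ _) _; rewrite ntw /Q.
  have : c0 * (eps * t + t * N) <= c0 * (t + t * N) by apply: Rmult_le_compat_l; lra.
  lra.
have k1 := hdl x' gx' ltac:(lra).
have k2 : dot xs (vscal t w) = dot xs (vsub x' x) - dot xs (vsub x' x1).
  by rewrite -dotBr; congr dot; rewrite /x1; vring.
have k3 := dot_abs_le xs (vsub x' x1).
have k4 := Rle_abs (- dot xs (vsub x' x1)); rewrite Rabs_Ropp in k4.
have k5 : vnorm xs * vnorm (vsub x' x1) <= vnorm xs * (c0 * (eps * t + t * N) + eps * t).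
  exact: Rmult_le_compat_l.
have k6 : eps * vnorm (vsub x' x) <= eps * (t * Q) by apply: Rmult_le_compat_l; lra.
rewrite dotZr in k2.
by apply: (Rmult_le_reg_l t) => //; lra.
Qed.

(* The slope bound above says that [xs] is dominated on the range of the partial derivative by a
   multiple of the distance to the tangent cone of [K]; a dominated extension is a multiplier. *)
Lemma normal_multiplier p x xs :
  vnorm (vsub p pb) < d0 -> vnorm (vsub x xb) < d0 -> vnorm (vsub (vpair p x) zb) < r ->
  normal_cone (Gam p) x xs ->
  exists mu, polar K mu /\ dot mu (G (vpair p x)) = 0 /\
    (forall u, dot mu (DG (vpair p x) (ex u)) = dot xs u) /\ vnorm mu <= c0 * vnorm xs.
Proof.
move=> hp hx hz hN; set z := vpair p x in hz *.
have KG : K (G z) by apply/Gam_local => //; case: hN.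
have hl := linear_ex _ hz; set B := fun u => DG z (ex u) in hl.
set M := c0 * vnorm xs; have hM : 0 <= M by have := vnorm_ge0 xs; rewrite /M; nra.
(* Epigraph of (w, c) -> M dist (B w + c, K - R+ G(z)). On c = 0 it dominates <xs, w> by
   [normal_slope]; the second block of the extended functional is the multiplier. *)
pose U (y : vec (n + e)) rr := exists k s, K k /\ 0 <= s /\
  M * vnorm (vsub (vadd (B (fstv y)) (sndv y)) (vsub k (vscal s (G z)))) <= rr.
have K0 := cone0 Kk.
have [||||xi [hxi1 hxi2]] := @riesz_extension (n + e) U n (vpair xs (vzero : vec e)).
- move=> y r1 y' r2 [k [s [hk [hs h1]]]] [k' [s' [hk' [hs' h2]]]].
  exists (vadd k k'), (s + s'); split; first exact: coneD.
  split; first lra.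
  have -> : vsub (vadd (B (fstv (vadd y y'))) (sndv (vadd y y')))
      (vsub (vadd k k') (vscal (s + s') (G z))) =
    vadd (vsub (vadd (B (fstv y)) (sndv y)) (vsub k (vscal s (G z))))
      (vsub (vadd (B (fstv y')) (sndv y')) (vsub k' (vscal s' (G z)))).
    have -> : fstv (vadd y y') = vadd (fstv y) (fstv y') by [].
    rewrite (linD _ _ hl); apply: vext => i; rewrite /vsub /vadd /vscal /sndv; ring.
  set X := vsub _ _ in h1 *; set Y := vsub _ _ in h2 *.
  by have := vnormD X Y; nra.
- move=> y r1 s hs [k [s' [hk [hs' h1]]]].
  exists (vscal s k), (s * s'); split; first by apply: coneZ => //; lra.
  split; first nra.
  have -> : vsub (vadd (B (fstv (vscal s y))) (sndv (vscal s y)))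
      (vsub (vscal s k) (vscal (s * s') (G z))) =
    vscal s (vsub (vadd (B (fstv y)) (sndv y)) (vsub k (vscal s' (G z)))).
    have -> : fstv (vscal s y) = vscal s (fstv y) by [].
    rewrite (linZ _ _ hl); apply: vext => i; rewrite /vsub /vadd /vscal /sndv; ring.
  by rewrite vnormZ Rabs_pos_eq; [nra | lra].
- move=> y; eexists; exists vzero, 0; split=> //; split; first lra.
  exact: Rle_refl.
- move=> y r1 [k [s [hk [hs h1]]]] hy.
  rewrite -[y]vpair_eta dot_pair dot0l Rplus_0_r; apply: Rle_trans h1.
  have -> : sndv y = vzero.
    by apply: vext => i; apply: hy; rewrite /= leq_addr.
  by rewrite vaddv0; apply: normal_slope.
pose mu := sndv xi.
have hxs : fstv xi = xs.
  apply: vext => i; rewrite /fstv hxi1 /=; last exact: ltn_ord.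
  by rewrite -/(fstv _ i) fstv_pair.
have dom w c k s : K k -> 0 <= s ->
    dot xs w + dot mu c <= M * vnorm (vsub (vadd (B w) c) (vsub k (vscal s (G z)))).
  move=> hk hs; have := hxi2 (vpair w c) (M * vnorm (vsub (vadd (B w) c) (vsub k (vscal s (G z))))).
  rewrite -{1}(vpair_eta xi) dot_pair hxs; apply.
  by exists k, s; rewrite fstv_pair sndv_pair; do !split=> //; exact: Rle_refl.
have B0 : B vzero = vzero by exact: lin0.
have zero c k s : c = vsub k (vscal s (G z)) -> K k -> 0 <= s -> dot mu c <= 0.
  move=> hc hk hs; have := @dom vzero c k s hk hs.
  have -> : vsub (vadd (B vzero) c) (vsub k (vscal s (G z))) = vzero.
    by rewrite B0 -hc; vring.
  by rewrite dot0r vnorm0; lra.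
(* On (w, - B w) the distance is zero; applying this to w and - w gives equality. *)
have le1 w : dot xs w <= dot mu (B w).
  have := @dom w (vopp (B w)) vzero 0 K0 (Rle_refl 0).
  have -> : vsub (vadd (B w) (vopp (B w))) (vsub vzero (vscal 0 (G z))) = vzero by vring.
  by rewrite vnorm0 dotNr; lra.
exists mu; split; first by move=> k hk; apply: (@zero k k 0) => //; [vring | lra].
split.
  apply: Rle_antisym; first by apply: (@zero _ (G z) 0) => //; [vring | lra].
  suff : dot mu (vopp (G z)) <= 0 by rewrite dotNr; lra.
  by apply: (@zero _ vzero 1) => //; [vring | lra].
split.
  move=> u; have h1 := le1 u; have := le1 (vopp u).
  by rewrite (linN _ hl) !dotNr -/(B u); lra.
(* At (0, mu), with the distance bounded through the origin, domination reads |mu|^2 <= M |mu|. *)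
have := @dom vzero mu vzero 0 K0 (Rle_refl 0).
have -> : vsub (vadd (B vzero) mu) (vsub vzero (vscal 0 (G z))) = mu by rewrite B0; vring.
rewrite dot0r Rplus_0_l -vnorm_sqr => h.
case: (Req_dec (vnorm mu) 0) => [->|ne] //.
by apply: (Rmult_le_reg_r (vnorm mu)) => //; have := vnorm_ge0 mu; lra.
Qed.


(** K contains G(zb + t w) / t, which tends to A v, and K is closed. With [image_tangent], the
    tangent cone of the graph of Gamma is the preimage of K under A. *)
Lemma tangent_image v :
  tangent_cone (fun z => Gam (fstv z) (sndv z)) zb v -> K (A v).
Proof.
move=> /tangent_coneP H; apply: Kc => eps he.
have fb : frechet_at G A zb by have [r0 [h _]] := tw; apply: h; rewrite vsubvv vnorm0.
have he2 : 0 < eps / 2 by lra.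
have [d [pd hd]] := frechet_dir v fb he2.
have hv := vnorm_ge0 v.
pose q := d0 / (vnorm v + 2); have pq : 0 < q by apply: Rdiv_lt_0_compat; lra.
have eq : q * (vnorm v + 2) = d0 by rewrite /q; field; lra.
have pm : 0 < Rmin d (Rmin q 1) by do !apply: Rmin_glb_lt => //; lra.
have [t [w [ht [hw gw]]]] := H _ pm.
have := Rmin_l d (Rmin q 1); have := Rmin_r d (Rmin q 1).
have := Rmin_l q 1; have := Rmin_r q 1 => m1 m2 m3 m4.
have hwn : vnorm w <= vnorm v + 1 by have := vnormB_ge w v; lra.
have tw1 : vnorm (vscal t w) < d0.
  by rewrite vnormZ Rabs_pos_eq; [have := vnorm_ge0 w; nra | lra].
have KG : K (G (vadd zb (vscal t w))).
  rewrite -(vpair_eta (vadd zb (vscal t w))); apply/Gam_local => //.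
    have -> : vsub (fstv (vadd zb (vscal t w))) pb = fstv (vscal t w).
      by rewrite -{1}(fstv_pair pb xb); apply: vext => i; rewrite /fstv /vsub /vadd /zb; ring.
    by have := vnorm_fstv (vscal t w); lra.
  have -> : vsub (sndv (vadd zb (vscal t w))) xb = sndv (vscal t w).
    by rewrite -{1}(sndv_pair pb xb); apply: vext => i; rewrite /sndv /vsub /vadd /zb; ring.
  by have := vnorm_sndv (vscal t w); lra.
have ti : 0 < / t by apply: Rinv_0_lt_compat; lra.
exists (vscal (/ t) (G (vadd zb (vscal t w)))); split; first by apply: coneZ => //; lra.
have := hd t w ltac:(lra) ltac:(lra); rewrite G0.
have -> : vsub (vsub (G (vadd zb (vscal t w))) vzero) (vscal t (A v)) =
  vscal (- t) (vsub (A v) (vscal (/ t) (G (vadd zb (vscal t w))))) by vring.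
rewrite vnormZ Rabs_Ropp Rabs_pos_eq; last lra.
move=> h; have : vnorm (vsub (A v) (vscal (/ t) (G (vadd zb (vscal t w))))) <= eps / 2.
  by apply: (Rmult_le_reg_l t); lra.
lra.
Qed.

(** * Consequences of a multiplier in the relative interior of the polar cone *)

Variables (xbs : vec n) (mb : vec e).
Hypothesis mb_polar : polar K mb.
Hypothesis mb_ri : forall al be, polar K al -> polar K be ->
  exists eps, 0 < eps /\ polar K (vadd mb (vscal eps (vsub al be))).
Hypothesis mb_eq : forall u, dot mb (A (ex u)) = dot xbs u.

(** A segment from a polar [al] to mb extends slightly beyond mb. Since mb vanishes at k, this
    forces <al, k> >= 0 for all polar [al], and the bipolar theorem puts - k in K. *)
Lemma face_lineality k : K k -> dot mb k = 0 -> lin_part K k.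
Proof.
move=> hk h0; split=> //; apply: bipolar => // al hal.
have [eps [he /(_ _ hk)]] := mb_ri mb_polar hal.
by rewrite dotDl dotZl dotBl dotNr h0; nra.
Qed.

(** Modulo lin K, A (q, u) equals A_x (a + u), where every multiplier of xbs takes the value <xbs, a
    + u>. So mb vanishes on A (q, u) as mu does, and [face_lineality] applies. *)
Lemma critical_direction_lineality (q : vec m) (u : vec n) mu :
  (exists (a : vec n) k, lin_part K k /\ A (vpair q vzero) = vadd (A (ex a)) k) ->
  polar K mu -> (forall u, dot mu (A (ex u)) = dot xbs u) ->
  K (A (vpair q u)) -> dot mu (A (vpair q u)) = 0 -> lin_part K (A (vpair q u)).
Proof.
move=> [a [k [hk ha]]] hmu hxbs hK h0.
have E : A (vpair q u) = vadd (A (ex (vadd a u))) k.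
  have -> : vpair q u = vadd (vpair q vzero) (ex u).
    by rewrite /ex vpairD vaddv0; congr vpair; vring.
  by rewrite (linD _ _ linear_A) ha (linD _ _ linear_Aex); vring.
apply: face_lineality => //; rewrite E dotDr mb_eq (polar_lin mb_polar hk).
by rewrite E dotDr hxbs (polar_lin hmu hk) in h0.
Qed.

(* Strict complementarity makes the cone of directions [A_x^*(K° - s mu)] the whole subspace
   orthogonal to [{u | A_x u in lin K}]: any difference of polar vectors is absorbed by [mb]. *)
Lemma adjoint_range_polar ns mu :
  (forall u, lin_part K (A (ex u)) -> dot ns u = 0) ->
  (forall u, dot mu (A (ex u)) = dot xbs u) ->
  exists a s, polar K a /\ 0 <= s /\
    forall u, dot ns u = dot (vsub a (vscal s mu)) (A (ex u)).
Proof.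
move=> hns hmu.
pose S (y : vec n) := exists al be, polar K al /\ polar K be /\
  forall u, dot y u = dot (vsub al be) (A (ex u)).
have p0 : polar K vzero by move=> k _; rewrite dot0l; lra.
have [al [be [hal [hbe E]]]] : S ns.
  apply: NNPP => hn; have [||u [h1 h2]] := @subspace_separation n S ns _ _ hn.
  - by exists vzero, vzero; do !split=> //; move=> u; rewrite dot0l dotBl dot0l; ring.
  - have Sz y s : S y -> S (vscal s y).
      move=> [al [be [h1 [h2 h3]]]]; case: (Rle_lt_dec 0 s) => hs.
        exists (vscal s al), (vscal s be); split; first exact: polarZ.
        split; first exact: polarZ.
        by move=> u; rewrite dotZl h3 !dotBl !dotZl; ring.
      have hs' : 0 <= - s by lra.
      exists (vscal (- s) be), (vscal (- s) al); split; first exact: polarZ.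
      split; first exact: polarZ.
      by move=> u; rewrite dotZl h3 !dotBl !dotZl; ring.
    move=> y y' s t /(Sz y s)[a1 [b1 [h1 [h2 h3]]]] /(Sz y' t)[a2 [b2 [h4 [h5 h6]]]].
    exists (vadd a1 a2), (vadd b1 b2); split; first exact: polarD.
    split; first exact: polarD.
    by move=> u; rewrite dotDl h3 h6 !dotBl !dotDl; ring.
  - have hA al : polar K al -> dot al (A (ex u)) = 0.
      move=> hal; rewrite -(dot_adj al u linear_Aex) dotC; apply: h1.
      exists al, vzero; do !split=> //.
      by move=> u'; rewrite (dot_adj al u' linear_Aex) dotBl dot0l; ring.
    have : lin_part K (A (ex u)).
      by split; apply: bipolar => // al /hA h; rewrite ?dotNr h; lra.
    by move/hns; rewrite dotC h2; lra.
have [eps [he h]] := mb_ri hal hbe.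
have hi : 0 <= / eps by apply: Rlt_le; apply: Rinv_0_lt_compat.
exists (vscal (/ eps) (vadd mb (vscal eps (vsub al be)))), (/ eps); split; first exact: polarZ.
split=> // u; rewrite E !dotBl !dotZl dotDl dotZl dotBl mb_eq hmu; field; lra.
Qed.

Lemma graph_derivative_multiplier v ys :
  graph_deriv (fun w : vec ((m + n) + n) =>
    normal_cone (Gam (fstv (fstv w))) (sndv (fstv w)) (sndv w)) zb xbs v ys ->
  tangent_cone (fun z => Gam (fstv z) (sndv z)) zb v /\
  exists mu, polar K mu /\ dot mu (A v) = 0 /\ (forall u, dot mu (A (ex u)) = dot xbs u) /\
    forall u, lin_part K (A (ex u)) -> dot ys u = dot mu (D2 v (ex u)).
Proof.
move=> /tangent_coneP H.
have Ew t (w : vec ((m + n) + n)) : vadd (vpair zb xbs) (vscal t w) =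
    vpair (vadd zb (vscal t (fstv w))) (vadd xbs (vscal t (sndv w))).
  by rewrite -{1}(vpair_eta w) vpairZ vpairD.
have dw (w : vec ((m + n) + n)) eps : vnorm (vsub w (vpair v ys)) < eps ->
    vnorm (vsub (fstv w) v) < eps /\ vnorm (vsub (sndv w) ys) < eps.
  move=> h; have -> : vsub (fstv w) v = fstv (vsub w (vpair v ys)).
    by rewrite -{1}(fstv_pair v ys).
  have -> : vsub (sndv w) ys = sndv (vsub w (vpair v ys)).
    by rewrite -{1}(sndv_pair v ys).
  have := vnorm_fstv (vsub w (vpair v ys)); have := vnorm_sndv (vsub w (vpair v ys)).
  lra.
split.
  apply/tangent_coneP => eps he; have [t [w [ht [/dw[h1 h2] h3]]]] := H eps he.
  exists t, (fstv w); do !split; try lra.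
  by move: h3; rewrite Ew fstv_pair sndv_pair => -[].
have hv := vnorm_ge0 v; have hys := vnorm_ge0 ys; have hxbs := vnorm_ge0 xbs.
have r0 : 0 < r by case: tw.
pose q := Rmin d0 r / (vnorm v + 2).
have pdr : 0 < Rmin d0 r by apply: Rmin_glb_lt.
have pq : 0 < q by apply: Rdiv_lt_0_compat; lra.
have eq : q * (vnorm v + 2) = Rmin d0 r by rewrite /q; field; lra.
have mdr1 : Rmin d0 r <= d0 by apply: Rmin_l.
have mdr2 : Rmin d0 r <= r by apply: Rmin_r.
(* Bounds every selected multiplier, as the normals xbs + t y' have t <= 1 and |y'| <= |ys| + 1. *)
pose M := c0 * (vnorm xbs + vnorm ys + 1).
have good eps : 0 < eps -> exists t v' y' mu, 0 < t < eps /\ vnorm (vsub v' v) < eps /\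
    vnorm (vsub y' ys) < eps /\ polar K mu /\ dot mu (G (vadd zb (vscal t v'))) = 0 /\
    (forall u, dot mu (DG (vadd zb (vscal t v')) (ex u)) = dot xbs u + t * dot y' u) /\
    vnorm mu <= M.
  move=> he; pose mm := Rmin eps (Rmin q 1).
  have pmm : 0 < mm by do !apply: Rmin_glb_lt => //; lra.
  have := Rmin_l eps (Rmin q 1); have := Rmin_r eps (Rmin q 1).
  have := Rmin_l q 1; have := Rmin_r q 1; rewrite -/mm => m1 m2 m3 m4.
  have [t [w [ht [/dw[h1 h2] h3]]]] := H mm pmm.
  move: h3; rewrite Ew fstv_pair sndv_pair; set z := vadd zb _; set y := vadd xbs _ => hN.
  have hwn : vnorm (fstv w) <= vnorm v + 1 by have := vnormB_ge (fstv w) v; lra.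
  have hyn : vnorm (sndv w) <= vnorm ys + 1 by have := vnormB_ge (sndv w) ys; lra.
  have tw1 : vnorm (vsub z zb) < Rmin d0 r.
    rewrite /z vsub_addl vnormZ Rabs_pos_eq; last lra.
    by have := vnorm_ge0 (fstv w); nra.
  have Ez : vsub z zb = vpair (vsub (fstv z) pb) (vsub (sndv z) xb).
    by rewrite -vsub_pair vpair_eta.
  have hp : vnorm (vsub (fstv z) pb) < d0.
    by have := vnorm_fstv (vsub z zb); rewrite {1}Ez fstv_pair; lra.
  have hx : vnorm (vsub (sndv z) xb) < d0.
    by have := vnorm_sndv (vsub z zb); rewrite {1}Ez sndv_pair; lra.
  have hz : vnorm (vsub (vpair (fstv z) (sndv z)) zb) < r by rewrite vpair_eta; lra.
  have [mu [g1 [g2 [g3 g4]]]] := normal_multiplier hp hx hz hN.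
  rewrite vpair_eta in g2 g3.
  exists t, (fstv w), (sndv w), mu; do !split=> //; try lra.
    by move=> u; rewrite g3 /y dotDl dotZl.
  apply: Rle_trans g4 _; apply: Rmult_le_compat_l; first lra.
  apply: Rle_trans (vnormD _ _) _; rewrite vnormZ Rabs_pos_eq; last lra.
  by have := vnorm_ge0 (sndv w); nra.
have hinv (j : nat) : 0 < / INR j.+1 by apply: Rinv_0_lt_compat; apply: lt_0_INR; apply/ltP.
have /functional_choice[ms hms] : forall j : nat, exists mu, vnorm mu <= M /\
    exists t v' y', 0 < t < / INR j.+1 /\ vnorm (vsub v' v) < / INR j.+1 /\
    vnorm (vsub y' ys) < / INR j.+1 /\ polar K mu /\ dot mu (G (vadd zb (vscal t v'))) = 0 /\
    (forall u, dot mu (DG (vadd zb (vscal t v')) (ex u)) = dot xbs u + t * dot y' u).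
  move=> j; have [t [v' [y' [mu [h1 [h2 [h3 [h4 [h5 [h6 h7]]]]]]]]]] := good _ (hinv j).
  by exists mu; split=> //; exists t, v', y'.
have [mu hmu] := bolzano_weierstrass ms (fun j => proj1 (hms j)).
have near eps : 0 < eps -> exists t v' y' mu', 0 < t < eps /\
    vnorm (vsub v' v) < eps /\ vnorm (vsub y' ys) < eps /\ vnorm (vsub mu' mu) < eps /\
    polar K mu' /\ dot mu' (G (vadd zb (vscal t v'))) = 0 /\
    forall u, dot mu' (DG (vadd zb (vscal t v')) (ex u)) = dot xbs u + t * dot y' u.
  move=> he; have [N [hN hN']] := archimed_cor1 eps he.
  have [j [hj hj2]] := hmu eps N he.
  have [_ [t [v' [y' [h1 [h2 [h3 [h4 [h5 h6]]]]]]]]] := hms j.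
  have hle : / INR j.+1 < eps.
    apply: Rle_lt_trans hN; apply: Rinv_le_contravar; first exact: lt_0_INR.
    by apply: le_INR; apply/leP; apply: leqW.
  by exists t, v', y', (ms j); do !split=> //; lra.
have hm := vnorm_ge0 mu.
have fb : frechet_at G A zb by have [_ [h _]] := tw; apply: h; rewrite vsubvv vnorm0.
exists mu; split.
  move=> k hk; apply: (@Rle_eps1 _ _ (vnorm k)) => [|eps he]; first exact: vnorm_ge0.
  have [t [v' [y' [mu' [_ [_ [_ [h1 [h2 _]]]]]]]]] := near eps (proj1 he).
  have := h2 k hk; have := dot_abs_le (vsub mu' mu) k.
  have := Rle_abs (- dot (vsub mu' mu) k); rewrite Rabs_Ropp dotBl.
  by have := vnorm_ge0 k; nra.
split.
  apply: (@Req_eps1 _ _ (vnorm (A v) + vnorm mu + 1)) => [|eps he].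
    by have := vnorm_ge0 (A v); lra.
  have [d [pd hd]] := frechet_dir v fb (proj1 he).
  have pm : 0 < Rmin d eps by apply: Rmin_glb_lt => //; lra.
  have := Rmin_l d eps; have := Rmin_r d eps => m1 m2.
  have [t [v' [y' [mu' [h1 [h2 [_ [h3 [_ [h4 _]]]]]]]]]] := near _ pm.
  have := hd t v' ltac:(lra) ltac:(lra); rewrite G0 => h5.
  (* Complementarity is exact along the sequence, so it can be divided by t before the limit; G(zb +
     t v') / t tends to A v. *)
  have E : dot mu (A v) - 0 = dot mu (A v) - dot mu' (vscal (/ t) (G (vadd zb (vscal t v')))).
    by rewrite dotZr h4; ring.
  rewrite E -Ropp_minus_distr Rabs_Ropp.
  apply: Rle_trans (dot_close _ _ _ _) _.
  have h6 : vnorm (vsub (vscal (/ t) (G (vadd zb (vscal t v')))) (A v)) <= eps.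
    apply: (Rmult_le_reg_l t); first lra.
    have E2 : vsub (vsub (G (vadd zb (vscal t v'))) vzero) (vscal t (A v)) =
      vscal t (vsub (vscal (/ t) (G (vadd zb (vscal t v')))) (A v)) by vring.
    by move: h5; rewrite E2 vnormZ Rabs_pos_eq; lra.
  have h7 : vnorm mu' <= vnorm mu + 1 by have := vnormB_ge mu' mu; lra.
  have := vnorm_ge0 mu'; have := vnorm_ge0 (A v).
  have := vnorm_ge0 (vsub (vscal (/ t) (G (vadd zb (vscal t v')))) (A v)).
  by nra.
split.
  move=> u; apply: (@Req_eps1 _ _ (vnorm (A (ex u)) + (vnorm mu + 1) * vnorm (ex u)
    + (vnorm ys + 1) * vnorm u)) => [|eps he].
    have := vnorm_ge0 (A (ex u)); have := vnorm_ge0 (ex u); have := vnorm_ge0 u; nra.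
  have [d [pd hd]] := Df_continuous tw (proj1 he).
  pose q' := d / (vnorm v + 2); have pq' : 0 < q' by apply: Rdiv_lt_0_compat; lra.
  have eq' : q' * (vnorm v + 2) = d by rewrite /q'; field; lra.
  have pm : 0 < Rmin q' eps by apply: Rmin_glb_lt => //; lra.
  have := Rmin_l q' eps; have := Rmin_r q' eps => m1 m2.
  have [t [v' [y' [mu' [h1 [h2 [h3 [h4 [_ [_ h5]]]]]]]]]] := near _ pm.
  have hv' : vnorm v' <= vnorm v + 1 by have := vnormB_ge v' v; lra.
  have hy' : vnorm y' <= vnorm ys + 1 by have := vnormB_ge y' ys; lra.
  have h7 : vnorm mu' <= vnorm mu + 1 by have := vnormB_ge mu' mu; lra.
  have hz : vnorm (vsub (vadd zb (vscal t v')) zb) < d.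
    by rewrite vsub_addl vnormZ Rabs_pos_eq; [have := vnorm_ge0 v'; nra | lra].
  have h6 := hd _ (ex u) hz.
  have -> : dot mu (A (ex u)) - dot xbs u =
     - (dot mu' (DG (vadd zb (vscal t v')) (ex u)) - dot mu (A (ex u))) + t * dot y' u.
    by rewrite h5; ring.
  apply: Rle_trans (Rabs_triang _ _) _; rewrite Rabs_Ropp Rabs_mult (Rabs_pos_eq t); last lra.
  have k1 := dot_close mu' mu (DG (vadd zb (vscal t v')) (ex u)) (A (ex u)).
  have k2 := dot_abs_le y' u.
  have n1 := vnorm_ge0 mu'; have n2 := vnorm_ge0 (A (ex u)); have n3 := vnorm_ge0 (ex u).
  have n4 := vnorm_ge0 u; have n5 := Rabs_pos (dot y' u).
  have k3 : vnorm (vsub mu' mu) * vnorm (A (ex u)) <= eps * vnorm (A (ex u)) by nra.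
  have k4 : vnorm mu' * vnorm (vsub (DG (vadd zb (vscal t v')) (ex u)) (A (ex u))) <=
     (vnorm mu + 1) * (eps * vnorm (ex u)).
    by apply: Rmult_le_compat => //; exact: vnorm_ge0.
  have k5 : t * Rabs (dot y' u) <= eps * ((vnorm ys + 1) * vnorm u).
    by apply: Rmult_le_compat => //; nra.
  lra.
(* For A_x u in lin K, both <xbs, u> and <mu', A_x u> vanish. The multiplier equation then has no
   term of order zero, and division by t leaves <y', u> against <mu', D2 v (0, u)>. *)
move=> u hu.
apply: (@Req_eps1 _ _ (vnorm u + vnorm (D2 v (ex u)) + vnorm mu + 1)) => [|eps he].
  have := vnorm_ge0 u; have := vnorm_ge0 (D2 v (ex u)); lra.
have fD : frechet_at (fun z => DG z (ex u)) (fun v => D2 v (ex u)) zb by have [_ [_ h]] := tw.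
have [d [pd hd]] := frechet_dir v fD (proj1 he).
have pm : 0 < Rmin d eps by apply: Rmin_glb_lt => //; lra.
have := Rmin_l d eps; have := Rmin_r d eps => m1 m2.
have [t [v' [y' [mu' [h1 [h2 [h3 [h4 [h5 [_ h6]]]]]]]]]] := near _ pm.
have h7 := hd t v' ltac:(lra) ltac:(lra).
have xu : dot xbs u = 0 by rewrite -mb_eq (polar_lin mb_polar hu).
set X := vsub (vsub _ _) (vscal t _) in h7.
have E : t * (dot y' u - dot mu' (D2 v (ex u))) = dot mu' X.
  have := h6 u; rewrite xu /X !dotBr dotZr -/A (polar_lin h5 hu) => ->; ring.
have k1 : Rabs (dot y' u - dot mu' (D2 v (ex u))) <= vnorm mu' * eps.
  apply: (Rmult_le_reg_l t); first lra.
  rewrite -{1}(Rabs_pos_eq t); last lra.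
  rewrite -Rabs_mult E; apply: Rle_trans (dot_abs_le _ _) _.
  by have := vnorm_ge0 mu'; nra.
have k2 : vnorm mu' <= vnorm mu + 1 by have := vnormB_ge mu' mu; lra.
have k3 := dot_abs_le (vsub y' ys) u; have k4 := dot_abs_le (vsub mu' mu) (D2 v (ex u)).
have -> : dot ys u - dot mu (D2 v (ex u)) = - dot (vsub y' ys) u +
   (dot y' u - dot mu' (D2 v (ex u))) + dot (vsub mu' mu) (D2 v (ex u)).
  by rewrite !dotBl; ring.
apply: Rle_trans (Rabs_triang _ _) _.
have := Rabs_triang (- dot (vsub y' ys) u) (dot y' u - dot mu' (D2 v (ex u))).
rewrite Rabs_Ropp.
have := vnorm_ge0 mu'; have := vnorm_ge0 u; have := vnorm_ge0 (D2 v (ex u)); nra.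
Qed.

(** The error bound corrects zb + t v by at most (c0 + 1) e1 t, in the x-component alone, so the
    direction changes by less than eps. *)
Lemma image_tangent v :
  K (A v) -> tangent_cone (fun z => Gam (fstv z) (sndv z)) zb v.
Proof.
move=> hA; apply/tangent_coneP => eps he.
have fb : frechet_at G A zb by have [r0 [h _]] := tw; apply: h; rewrite vsubvv vnorm0.
pose e1 := eps / (2 * (c0 + 1)); have pe1 : 0 < e1 by apply: Rdiv_lt_0_compat; lra.
have ee1 : (c0 + 1) * e1 = eps / 2 by rewrite /e1; field; lra.
have [d [pd hd]] := frechet_dir v fb pe1.
have hv := vnorm_ge0 v.
pose q := d0 / (vnorm v + e1 + 1); have pq : 0 < q by apply: Rdiv_lt_0_compat; lra.
have eq : q * (vnorm v + e1 + 1) = d0 by rewrite /q; field; lra.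
have pm : 0 < Rmin (Rmin d eps) q by do !apply: Rmin_glb_lt => //; lra.
have := Rmin_l (Rmin d eps) q; have := Rmin_r (Rmin d eps) q.
have := Rmin_l d eps; have := Rmin_r d eps => m1 m2 m3 m4.
pose t := Rmin (Rmin d eps) q / 2; have ht : 0 < t by rewrite /t; lra.
have ht2 : t < Rmin (Rmin d eps) q by rewrite /t; lra.
have ti : 0 < / t by apply: Rinv_0_lt_compat.
have sm : t * (vnorm v + e1 + 1) < d0 by rewrite -eq; apply: Rmult_lt_compat_r; lra.
have tv0 : 0 <= t * vnorm v by apply: Rmult_le_pos; lra.
have te0 : 0 < e1 * t by apply: Rmult_lt_0_compat; lra.
set b := vadd zb (vscal t v).
have nb : vnorm (vsub b zb) = t * vnorm v by rewrite /b vsub_addl vnormZ Rabs_pos_eq; lra.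
have Eb : vpair (fstv b) (sndv b) = b by apply: vpair_eta.
have hp : vnorm (vsub (fstv b) pb) < d0.
  by have := vnorm_fstv (vsub b zb); rewrite -{1}Eb vsub_pair fstv_pair; lra.
have hx : vnorm (vsub (sndv b) xb) < d0.
  by have := vnorm_sndv (vsub b zb); rewrite -{1}Eb vsub_pair sndv_pair; lra.
have hk : vnorm (vsub (G (vpair (fstv b) (sndv b))) (vscal t (A v))) <= e1 * t.
  have := hd t v ltac:(lra) ltac:(rewrite vsubvv vnorm0; lra); rewrite G0 Eb -/b.
  by congr (vnorm _ <= _); vring.
have Kk' : K (vscal t (A v)) by apply: coneZ => //; lra.
have [|x' [gx' hx']] := @Gam_error_bound _ _ _ hp hx Kk' _ _ te0; first lra.
exists t, (vadd v (ex (vscal (/ t) (vsub x' (sndv b))))).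
split; first lra.
split.
  rewrite vsub_addl /ex vnorm_pair0l vnormZ Rabs_pos_eq; last lra.
  apply: (Rmult_lt_reg_l t) => //; rewrite -Rmult_assoc Rinv_r; last lra.
  have : c0 * vnorm (vsub (G (vpair (fstv b) (sndv b))) (vscal t (A v))) <= c0 * (e1 * t).
    by apply: Rmult_le_compat_l; lra.
  have : t * ((c0 + 1) * e1) = t * (eps / 2) by rewrite ee1.
  have : 0 < t * eps by apply: Rmult_lt_0_compat.
  lra.
have -> : vadd zb (vscal t (vadd v (ex (vscal (/ t) (vsub x' (sndv b)))))) = vpair (fstv b) x'.
  have -> : vpair (fstv b) x' = vadd b (ex (vsub x' (sndv b))).
    by rewrite -{2}Eb /ex vpairD; congr vpair; vring.
  have -> : ex (vsub x' (sndv b)) = vscal t (ex (vscal (/ t) (vsub x' (sndv b)))).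
    by rewrite /ex vpairZ; congr vpair; vring.
  by rewrite /b; vring.
by rewrite fstv_pair sndv_pair.
Qed.

(** Inside the ball, the quadratic expansion of phi at d has slope - (y - rho d) and a remainder rho
    / 2 |d' - d|^2, which normality absorbs. The point [dt] is a competitor bounding the minimal
    value. *)
Lemma penalized_minimizer p x rad rho (y dt : vec n) :
  vnorm (vsub (vpair p x) zb) + rad < Rmin d0 r -> 0 < rho ->
  vnorm dt <= rad -> K (G (vpair p (vadd x dt))) ->
  let phi d := - dot y d + rho / 2 * dot d d in
  exists d, vnorm d <= rad /\ K (G (vpair p (vadd x d))) /\ phi d <= phi dt /\
    (vnorm d < rad -> normal_cone (Gam p) (vadd x d) (vsub y (vscal rho d))).
Proof.
move=> hz hrho hdt Kdt phi.
have [mr1 mr2] : Rmin d0 r <= d0 /\ Rmin d0 r <= r by split; [apply: Rmin_l | apply: Rmin_r].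
have nz d : vsub (vpair p (vadd x d)) zb = vadd (vsub (vpair p x) zb) (ex d).
  by rewrite !vsub_pair /ex vpairD; congr vpair; vring.
have near d : vnorm d <= rad -> vnorm (vsub (vpair p (vadd x d)) zb) < Rmin d0 r.
  move=> hd; rewrite nz; apply: Rle_lt_trans (vnormD _ _) _.
  by rewrite /ex vnorm_pair0l; lra.
have hy := vnorm_ge0 y.
have step d d' : phi d' - phi d = - dot (vsub y (vscal rho d)) (vsub d' d) +
    rho / 2 * dot (vsub d' d) (vsub d' d).
  rewrite /phi !dotBl !dotBr !dotZl (dotC d' d); field.
have [||||| d [[hd Kd] hmin]] := @lsc_attains_min n
  (fun d => vnorm d <= rad /\ K (G (vpair p (vadd x d)))) phi rad (- (vnorm y * rad)).
- move=> d H.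
  have hd : vnorm d <= rad.
    apply: (@Rle_eps _ _ 1) => [|eps he]; first lra.
    have [d' [[h1 _] h2]] := H eps he; have := vnormB_ge d d'; lra.
  split=> //; apply: Kc => eps he.
  have fz : frechet_at G (DG (vpair p (vadd x d))) (vpair p (vadd x d)).
    have [_ [h _]] := tw; apply: h; have := near d hd; lra.
  have [dl [pdl hdl]] := frechet_continuous fz he.
  have [d' [[h1 h2] h3]] := H dl pdl.
  exists (G (vpair p (vadd x d'))); split=> //; rewrite vnormBC; apply: hdl.
  have -> : vsub (vpair p (vadd x d')) (vpair p (vadd x d)) = ex (vsub d' d).
    by rewrite /ex !vsubE vpairZ vpairD; congr vpair; vring.
  by rewrite /ex vnorm_pair0l vnormBC.
- by exists dt.
- by move=> d [].
- move=> d [hd _]; rewrite /phi; have := dot_le y d; have := dot_ge0 d; nra.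
- move=> d [hd _] eps he.
  set W := vnorm (vsub y (vscal rho d)).
  have hW : 0 <= W by apply: vnorm_ge0.
  exists (eps / (W + 1)); split; first by apply: Rdiv_lt_0_compat; lra.
  move=> d' _ hd'; have := step d d'; have := dot_le (vsub y (vscal rho d)) (vsub d' d).
  rewrite -/W; have := dot_ge0 (vsub d' d) => k1 k2 k3.
  have hn := vnorm_ge0 (vsub d' d).
  have k4 : (W + 1) * vnorm (vsub d' d) < (W + 1) * (eps / (W + 1)).
    by apply: Rmult_lt_compat_l; lra.
  have E : (W + 1) * (eps / (W + 1)) = eps by field; lra.
  nra.
exists d; split=> //; split=> //; split; first exact: hmin.
move=> hlt.
have inD d' : vnorm d' <= rad -> vnorm (vsub p pb) < d0 /\ vnorm (vsub (vadd x d') xb) < d0.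
  move/near; rewrite vsub_pair => h; split.
    by have := vnorm_fstv (vpair (vsub p pb) (vsub (vadd x d') xb)); rewrite fstv_pair; lra.
  by have := vnorm_sndv (vpair (vsub p pb) (vsub (vadd x d') xb)); rewrite sndv_pair; lra.
split; first by have [h1 h2] := inD d hd; apply/Gam_local.
move=> eps he.
have pe : 0 < 2 * eps / rho by apply: Rdiv_lt_0_compat; lra.
exists (Rmin (rad - vnorm d) (2 * eps / rho)); split; first by apply: Rmin_glb_lt; lra.
move=> x' gx' hx'.
have := Rmin_l (rad - vnorm d) (2 * eps / rho); have := Rmin_r (rad - vnorm d) (2 * eps / rho).
move=> m1 m2; set ee := vsub x' (vadd x d) in hx' *.
have Ex : x' = vadd x (vadd d ee) by rewrite /ee; vring.
have hd' : vnorm (vadd d ee) <= rad by have := vnormD d ee; lra.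
have Kx : K (G (vpair p (vadd x (vadd d ee)))).
  by have [h1 h2] := inD _ hd'; apply/Gam_local => //; rewrite -Ex.
have := hmin _ (conj hd' Kx); have := step d (vadd d ee); rewrite vsub_addl -vnorm_sqr => k1 k2.
have hn := vnorm_ge0 ee.
have k3 : rho / 2 * vnorm ee <= eps.
  have -> : eps = rho / 2 * (2 * eps / rho) by field; lra.
  by apply: Rmult_le_compat_l; lra.
nra.
Qed.

(** * Equality: the second-order curve and exact normals near it *)

Section SecondOrder.
Variables (v w : vec (m + n)) (k : vec e) (mu : vec e) (ys : vec n).
Hypotheses (Av_lin : lin_part K (A v)) (k_lin : lin_part K k).
Hypothesis second_order : D2 v v = vadd (A w) k.
Hypothesis mu_polar : polar K mu.
Hypothesis mu_eq : forall u, dot mu (A (ex u)) = dot xbs u.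
Hypothesis ys_eq : forall u, lin_part K (A (ex u)) -> dot ys u = dot mu (D2 v (ex u)).

(** The curve is zb + t path(t). In its Taylor expansion [second_order] cancels the two A w terms,
    and [kt t], in lin K, remains up to o(t^2). *)
Let path t := vadd v (vscal (- (t / 2)) w).
Let kt t := vadd (vscal t (A v)) (vscal (t * t / 2) k).
Let V := vnorm v + vnorm w.

Let path_norm t : 0 < t <= 1 -> vnorm (path t) <= V.
Proof.
move=> ht; apply: Rle_trans (vnormD _ _) _; rewrite vnormZ Rabs_Ropp Rabs_pos_eq; last lra.
by rewrite /V; have := vnorm_ge0 w; nra.
Qed.

Lemma kt_lin t : lin_part K (kt t).
Proof. by apply: lin_partD => //; apply: lin_partZ. Qed.

Lemma path_image eps : 0 < eps -> exists d, 0 < d /\ forall t, 0 < t < d ->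
  vnorm (vsub (G (vadd zb (vscal t (path t)))) (kt t)) <= eps * (t * t).
Proof.
move=> he; have [cD [pcD hcD]] := D2_bounded tw.
have hv := vnorm_ge0 v; have hw := vnorm_ge0 w; have hV : 0 <= V by rewrite /V; lra.
have e1 : 0 < eps / (2 * (V * V + 1)) by apply: Rdiv_lt_0_compat; nra.
have [d1 [p1 h1]] := taylor2 tw e1.
pose q1 := d1 / (V + 1); have pq1 : 0 < q1 by apply: Rdiv_lt_0_compat; lra.
have eq1 : q1 * (V + 1) = d1 by rewrite /q1; field; lra.
have hcw : 0 <= cD * vnorm w * V by apply: Rmult_le_pos => //; nra.
pose q2 := eps / (cD * vnorm w * V + 1); have pq2 : 0 < q2 by apply: Rdiv_lt_0_compat; lra.
have eq2 : q2 * (cD * vnorm w * V + 1) = eps by rewrite /q2; field; lra.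
exists (Rmin 1 (Rmin q1 q2)); split; first by do !apply: Rmin_glb_lt => //; lra.
move=> t ht; have := Rmin_l 1 (Rmin q1 q2); have := Rmin_r 1 (Rmin q1 q2).
have := Rmin_l q1 q2; have := Rmin_r q1 q2 => m1 m2 m3 m4.
have hp := @path_norm t ltac:(lra); have hp0 := vnorm_ge0 (path t).
have hh : vnorm (vscal t (path t)) = t * vnorm (path t) by rewrite vnormZ Rabs_pos_eq; lra.
have := h1 (vscal t (path t)) ltac:(rewrite hh; nra); rewrite hh G0 -/A.
set X := vsub _ (vscal (/ 2) _) => hX.
have hl := D2_linear_l tw; have hr := D2_linear_r tw.
set Y := vsub (D2 (path t) (path t)) (D2 v v).
have -> : vsub (G (vadd zb (vscal t (path t)))) (kt t) = vadd X (vscal (t * t / 2) Y).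
  rewrite /X /Y /kt (linZ _ _ (hl _)) (linZ _ _ (hr _)) second_order (linZ _ _ linear_A).
  rewrite [A (path t)](linD _ _ linear_A) (linZ _ _ linear_A); vring.
have hY : vnorm Y <= t * (cD * vnorm w * V).
  have -> : Y = vadd (D2 (vscal (- (t / 2)) w) (path t)) (D2 v (vscal (- (t / 2)) w)).
    have E1 : D2 (path t) (path t) = vadd (D2 v (path t)) (D2 (vscal (- (t / 2)) w) (path t)).
      exact: (linD _ _ (hl _)).
    have E2 : D2 v (path t) = vadd (D2 v v) (D2 v (vscal (- (t / 2)) w)) by exact: (linD _ _ (hr _)).
    by rewrite /Y E1 E2; vring.
  apply: Rle_trans (vnormD _ _) _.
  have := hcD (vscal (- (t / 2)) w) (path t); have := hcD v (vscal (- (t / 2)) w).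
  rewrite !vnormZ Rabs_Ropp Rabs_pos_eq; last lra.
  have hvV : vnorm v <= V by rewrite /V; lra.
  have a0 : 0 <= cD * (t / 2 * vnorm w) by apply: Rmult_le_pos; nra.
  have a1 : cD * (t / 2 * vnorm w) * vnorm (path t) <= cD * (t / 2 * vnorm w) * V.
    by apply: Rmult_le_compat_l.
  have a2 : cD * (t / 2 * vnorm w) * vnorm v <= cD * (t / 2 * vnorm w) * V.
    by apply: Rmult_le_compat_l.
  lra.
apply: Rle_trans (vnormD _ _) _; rewrite vnormZ Rabs_pos_eq; last nra.
have b1 : eps / (2 * (V * V + 1)) * (t * vnorm (path t) * (t * vnorm (path t))) <= eps / 2 * (t * t).
  apply: Rle_trans (_ : eps / (2 * (V * V + 1)) * (t * t * (V * V + 1)) <= _).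
    apply: Rmult_le_compat_l; first lra.
    have : vnorm (path t) * vnorm (path t) <= V * V by apply: Rmult_le_compat.
    nra.
  by apply: Req_le; field; nra.
have b2 : vnorm Y <= eps.
  apply: Rle_trans hY _; rewrite -eq2; apply: Rmult_le_compat; lra.
have : t * t / 2 * vnorm Y <= t * t / 2 * eps by apply: Rmult_le_compat_l; nra.
lra.
Qed.

(** A polar multiplier is nonpositive on G at a feasible point and at least - M eps t^2 at the curve
    point. The mean value expansion of the difference has <xbs + t ys, d> as leading part. *)
Lemma feasible_bound : exists c, 0 < c /\ forall eps, 0 < eps <= 1 -> exists dl, 0 < dl /\
  forall t d, 0 < t < dl -> vnorm d < dl ->
    K (G (vadd (vadd zb (vscal t (path t))) (ex d))) ->
    dot (vadd xbs (vscal t ys)) d <=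
      c * eps * (t * t) + c * eps * (t * vnorm d) + c * (vnorm d * vnorm d).
Proof.
have [cD [pcD hcD]] := D2_bounded tw.
have hl := D2_linear_l tw; have hr := D2_linear_r tw.
have hlex : is_linear (fun u => D2 v (ex u)) by apply: (lin_comp linear_sndr).
have [|a [s [ha [hs hns]]]] :=
    @adjoint_range_polar (vsub ys (adj (fun u => D2 v (ex u)) mu)) mu _ mu_eq.
  by move=> u hu; rewrite dotBl dot_adj // ys_eq //; ring.
set eta := vsub a (vscal s mu) in hns.
have ysE u : dot ys u = dot mu (D2 v (ex u)) + dot eta (A (ex u)).
  by rewrite -hns dotBl dot_adj //; ring.
have hv := vnorm_ge0 v; have hw := vnorm_ge0 w; have hV : 0 <= V by rewrite /V; lra.
have hmu := vnorm_ge0 mu; have heta := vnorm_ge0 eta.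
pose M := vnorm mu + vnorm eta; have hM : 0 <= M by rewrite /M; lra.
(* The summands collect, in order, the defect at the curve point, three terms of size eps t |d|, and
   the terms quadratic in d. *)
pose c := M + (M * (cD * vnorm w) + M * V + vnorm eta * (cD * vnorm v)) + M * (cD + 1) + 1.
have n1 : 0 <= M * (cD * vnorm w) by apply: Rmult_le_pos => //; nra.
have n2 : 0 <= M * V by nra.
have n3 : 0 <= vnorm eta * (cD * vnorm v) by apply: Rmult_le_pos => //; nra.
have n4 : 0 <= M * (cD + 1) by nra.
exists c; split; first by rewrite /c; lra.
move=> eps he.
have [d1 [p1 h1]] := path_image (proj1 he).
have [d2 [p2 h2]] := Df_first_order tw (proj1 he).
have r0 : 0 < r by case: tw.
pose q1 := Rmin d2 r / (2 * (V + 1)).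
have pd2r : 0 < Rmin d2 r by apply: Rmin_glb_lt.
have pq1 : 0 < q1 by apply: Rdiv_lt_0_compat; lra.
have eq1 : q1 * (V + 1) = Rmin d2 r / 2 by rewrite /q1; field; lra.
have ps : 0 < / (s + 1) by apply: Rinv_0_lt_compat; lra.
have es : / (s + 1) * (s + 1) = 1 by field; lra.
pose dl := Rmin (Rmin d1 eps) (Rmin q1 (/ (s + 1))).
have pdl : 0 < dl by do !apply: Rmin_glb_lt => //; lra.
exists dl; split=> // t d ht hd Kd.
have k1 : dl <= Rmin d1 eps by apply: Rmin_l.
have k2 : dl <= Rmin q1 (/ (s + 1)) by apply: Rmin_r.
have k3 : Rmin d1 eps <= d1 by apply: Rmin_l.
have k4 : Rmin d1 eps <= eps by apply: Rmin_r.
have k5 : Rmin q1 (/ (s + 1)) <= q1 by apply: Rmin_l.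
have k6 : Rmin q1 (/ (s + 1)) <= / (s + 1) by apply: Rmin_r.
have k7 : Rmin d2 r <= d2 by apply: Rmin_l.
have k8 : Rmin d2 r <= r by apply: Rmin_r.
have hts : t * s <= 1 by nra.
(* [eta] need not be polar, but mt = (1 - t s) mu + t a is once t s <= 1; hence the bound 1 / (s +
   1) in [dl]. *)
pose mt := vadd mu (vscal t eta).
have mtp : polar K mt.
  have -> : mt = vadd (vscal (1 - t * s) mu) (vscal t a) by rewrite /mt /eta; vring.
  by apply: polarD; apply: polarZ => //; lra.
have mtn : vnorm mt <= M.
  apply: Rle_trans (vnormD _ _) _; rewrite vnormZ Rabs_pos_eq; last lra.
  by rewrite /M; nra.
have mtn0 := vnorm_ge0 mt.
set b := vadd zb (vscal t (path t)) in Kd *.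
have hp := @path_norm t ltac:(lra).
have hn := vnorm_ge0 d.
have nex : vnorm (ex d) = vnorm d by rewrite /ex vnorm_pair0l.
have kap sg : 0 <= sg <= 1 ->
    vnorm (vadd (vscal t (path t)) (vscal sg (ex d))) <= t * V + vnorm d.
  move=> hsg; apply: Rle_trans (vnormD _ _) _.
  rewrite !vnormZ nex !Rabs_pos_eq; [|lra|lra].
  by have := vnorm_ge0 (path t); nra.
have small : t * V + vnorm d < Rmin d2 r by nra.
have Eb sg : vadd b (vscal sg (ex d)) = vadd zb (vadd (vscal t (path t)) (vscal sg (ex d))).
  by rewrite /b; vring.
have [sg [hsg Emv]] : exists sg, 0 <= sg <= 1 /\ dot mt (vsub (G (vadd b (ex d))) (G b)) =
    dot mt (DG (vadd b (vscal sg (ex d))) (ex d)).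
  apply: mean_value => sg hsg; have [_ [H _]] := tw; apply: H.
  by rewrite Eb vsub_addl; have := kap sg hsg; lra.
have K1 := kap sg hsg.
rewrite Eb in Emv; set ka := vadd (vscal t (path t)) _ in K1 Emv.
have := h2 ka (ex d) ltac:(lra); rewrite nex -/A.
set X := vsub (vsub _ _) (D2 ka _) => hX.
have hX2 : vnorm X <= eps * (t * V + vnorm d) * vnorm d.
  by apply: Rle_trans hX _; apply: Rmult_le_compat_r => //; apply: Rmult_le_compat_l; lra.
have E1 : dot mt (DG (vadd zb ka) (ex d)) = dot mt (A (ex d)) + dot mt (D2 ka (ex d)) + dot mt X.
  by rewrite /X !dotBr; ring.
clearbody X.
have E2 : D2 ka (ex d) = vadd (vscal t (D2 v (ex d)))
    (vadd (vscal (- (t * t / 2)) (D2 w (ex d))) (vscal sg (D2 (ex d) (ex d)))).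
  rewrite /ka (linD _ _ (hl _)) !(linZ _ _ (hl _)) /path (linD _ _ (hl _)) (linZ _ _ (hl _)).
  by vring.
have T2 : - (M * (t * t / 2 * (cD * vnorm w * vnorm d))) <= - (t * t / 2) * dot mt (D2 w (ex d)).
  have := dot_le mt (D2 w (ex d)); have := hcD w (ex d); rewrite nex => u1 u2.
  have u3 : dot mt (D2 w (ex d)) <= M * (cD * vnorm w * vnorm d).
    by apply: Rle_trans u2 _; apply: Rmult_le_compat => //; exact: vnorm_ge0.
  nra.
have T3 : - (M * (cD * (vnorm d * vnorm d))) <= sg * dot mt (D2 (ex d) (ex d)).
  have := dot_ge mt (D2 (ex d) (ex d)); have := hcD (ex d) (ex d); rewrite nex => u1 u2.
  have u3 : vnorm mt * vnorm (D2 (ex d) (ex d)) <= M * (cD * vnorm d * vnorm d).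
    by apply: Rmult_le_compat => //; exact: vnorm_ge0.
  have u4 : 0 <= M * (cD * (vnorm d * vnorm d)).
    by apply: Rmult_le_pos => //; apply: Rmult_le_pos; nra.
  nra.
have T4 : - (vnorm eta * (cD * vnorm v * vnorm d)) <= dot eta (D2 v (ex d)).
  have := dot_ge eta (D2 v (ex d)); have := hcD v (ex d); rewrite nex => u1 u2.
  have : vnorm eta * vnorm (D2 v (ex d)) <= vnorm eta * (cD * vnorm v * vnorm d).
    exact: Rmult_le_compat_l.
  lra.
have T5 : - (M * (eps * (t * V + vnorm d) * vnorm d)) <= dot mt X.
  have := dot_ge mt X.
  have : vnorm mt * vnorm X <= M * (eps * (t * V + vnorm d) * vnorm d).
    by apply: Rmult_le_compat => //; exact: vnorm_ge0.
  lra.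
have T6 : - (M * (eps * (t * t))) <= dot mt (G b).
  have -> : G b = vadd (kt t) (vsub (G b) (kt t)) by vring.
  rewrite dotDr (polar_lin mtp (kt_lin t)).
  have := dot_ge mt (vsub (G b) (kt t)); have := h1 t ltac:(lra); rewrite -/b => u1 u2.
  have : vnorm mt * vnorm (vsub (G b) (kt t)) <= M * (eps * (t * t)).
    by apply: Rmult_le_compat => //; exact: vnorm_ge0.
  lra.
have T7 := mtp _ Kd.
(* By [ysE], the term t <eta, A_x d> here and t <mu, D2 v (0, d)> from [E4] add up to t <ys, d>; the
   leftover with factor t^2 is controlled by [T4]. *)
have E3 : dot mt (A (ex d)) = dot xbs d + t * dot eta (A (ex d)).
  by rewrite /mt dotDl dotZl mu_eq.
have E4 : dot mt (D2 v (ex d)) = dot mu (D2 v (ex d)) + t * dot eta (D2 v (ex d)).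
  by rewrite /mt dotDl dotZl.
rewrite dotBr E1 E2 !dotDr !dotZr E3 E4 in Emv.
rewrite dotDl dotZl ysE.
have te : t * t <= eps * t by nra.
have td : 0 <= t * vnorm d by nra.
have T4' : - (t * t * (vnorm eta * (cD * vnorm v * vnorm d))) <=
    t * t * dot eta (D2 v (ex d)) by nra.
have R1 : M * (t * t / 2 * (cD * vnorm w * vnorm d)) <= M * (cD * vnorm w) * (eps * (t * vnorm d)).
  have -> : M * (t * t / 2 * (cD * vnorm w * vnorm d)) =
    M * (cD * vnorm w) * (t * t / 2 * vnorm d) by ring.
  by apply: Rmult_le_compat_l => //; nra.
have R2 : t * t * (vnorm eta * (cD * vnorm v * vnorm d)) <=
    vnorm eta * (cD * vnorm v) * (eps * (t * vnorm d)).
  have -> : t * t * (vnorm eta * (cD * vnorm v * vnorm d)) =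
    vnorm eta * (cD * vnorm v) * (t * t * vnorm d) by ring.
  by apply: Rmult_le_compat_l => //; nra.
have R3 : M * (eps * (vnorm d * vnorm d)) <= M * (vnorm d * vnorm d).
  by apply: Rmult_le_compat_l => //; nra.
have etd : 0 <= eps * (t * vnorm d) by nra.
have ett : 0 <= eps * (t * t) by nra.
have dd : 0 <= vnorm d * vnorm d by nra.
have c1 : M * (eps * (t * t)) <= c * (eps * (t * t)).
  by apply: Rmult_le_compat_r => //; rewrite /c; lra.
have c2 : (M * (cD * vnorm w) + M * V + vnorm eta * (cD * vnorm v)) * (eps * (t * vnorm d)) <=
    c * (eps * (t * vnorm d)).
  by apply: Rmult_le_compat_r => //; rewrite /c; lra.
have c3 : M * (cD + 1) * (vnorm d * vnorm d) <= c * (vnorm d * vnorm d).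
  by apply: Rmult_le_compat_r => //; rewrite /c; lra.
lra.
Qed.

Lemma graph_derivative_sufficient :
  graph_deriv (fun w : vec ((m + n) + n) =>
    normal_cone (Gam (fstv (fstv w))) (sndv (fstv w)) (sndv w)) zb xbs v ys.
Proof.
apply/tangent_coneP => eps he.
have [c1 [pc1 hc1]] := feasible_bound.
have hv := vnorm_ge0 v; have hw := vnorm_ge0 w; have hV : 0 <= V by rewrite /V; lra.
have hys := vnorm_ge0 ys; have hxbs := vnorm_ge0 xbs.
pose Y := vnorm xbs + vnorm ys; have hY : 0 <= Y by rewrite /Y; lra.
(* rho / 2 - c1 = 1: the penalty outweighs the quadratic term of [feasible_bound] and leaves exactly
   |d|^2. *)
pose rho := 2 * c1 + 2.
(* |d| <= e' t shifts the direction by e' and the normal by rho e', together eps / 2; the other half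
   is for t / 2 |w|. *)
pose e' := eps / (2 * (1 + rho)).
have pe' : 0 < e' by apply: Rdiv_lt_0_compat; rewrite /rho; lra.
have ee' : e' * (1 + rho) = eps / 2 by rewrite /e' /rho; field; lra.
pose c2 := Y * (c0 + 1) + rho / 2 * ((c0 + 1) * (c0 + 1)).
have prho : 0 < rho by rewrite /rho; lra.
have pc2 : 0 <= c2.
  have : 0 <= Y * (c0 + 1) by apply: Rmult_le_pos; lra.
  have : 0 <= rho / 2 * ((c0 + 1) * (c0 + 1)) by apply: Rmult_le_pos; nra.
  by rewrite /c2; lra.
pose ka := / e'; have pka : 0 < ka by apply: Rinv_0_lt_compat.
have eka : ka * e' = 1 by rewrite /ka; field; lra.
pose c3 := (c1 + c2) * (ka * ka + ka) + 1.
have pc3 : 1 <= c3.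
  have : 0 <= (c1 + c2) * (ka * ka + ka) by apply: Rmult_le_pos; nra.
  by rewrite /c3; lra.
(* Makes (c1 + c2) e1 (ka^2 + ka) = 1 - e1. If |d| > e' t, then t <= ka |d|, and [main] would give
   |d|^2 <= (1 - e1) |d|^2, which is absurd. *)
pose e1 := / c3.
have pe1 : 0 < e1 by apply: Rinv_0_lt_compat; lra.
have ee1 : e1 * c3 = 1 by rewrite /e1; field; lra.
have he1 : 0 < e1 <= 1 by split=> //; nra.
have [dl [pdl hdl]] := hc1 e1 he1.
have [d1 [p1 h1]] := path_image pe1.
have r0 : 0 < r by case: tw.
pose rad := Rmin dl (Rmin d0 r) / 2.
have pdr : 0 < Rmin d0 r by apply: Rmin_glb_lt.
have prad : 0 < rad by have := Rmin_glb_lt _ _ _ pdl pdr; rewrite /rad; lra.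
have r1 : 2 * rad <= dl by have := Rmin_l dl (Rmin d0 r); rewrite /rad; lra.
have r2 : 2 * rad <= Rmin d0 r by have := Rmin_r dl (Rmin d0 r); rewrite /rad; lra.
have mdr : Rmin d0 r <= d0 by apply: Rmin_l.
pose q1 := rad / (V + c0 + e' + 2).
have pq1 : 0 < q1 by apply: Rdiv_lt_0_compat; lra.
have eq1 : q1 * (V + c0 + e' + 2) = rad by rewrite /q1; field; lra.
pose q2 := eps / (vnorm w + 1).
have pq2 : 0 < q2 by apply: Rdiv_lt_0_compat; lra.
have eq2 : q2 * (vnorm w + 1) = eps by rewrite /q2; field; lra.
pose q := Rmin (Rmin (Rmin d1 eps) (Rmin q1 q2)) (Rmin 1 (Rmin d0 dl)).
have pq : 0 < q by do !apply: Rmin_glb_lt => //; lra.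
have [k1 k2] : q <= Rmin (Rmin d1 eps) (Rmin q1 q2) /\ q <= Rmin 1 (Rmin d0 dl).
  by split; [apply: Rmin_l | apply: Rmin_r].
have [k3 k4] : q <= Rmin d1 eps /\ q <= Rmin q1 q2.
  by have := Rmin_l (Rmin d1 eps) (Rmin q1 q2); have := Rmin_r (Rmin d1 eps) (Rmin q1 q2); lra.
have [k5 k6] : q <= 1 /\ q <= Rmin d0 dl.
  by have := Rmin_l 1 (Rmin d0 dl); have := Rmin_r 1 (Rmin d0 dl); lra.
have [k7 k8] : q <= d1 /\ q <= eps by have := Rmin_l d1 eps; have := Rmin_r d1 eps; lra.
have [k9 k10] : q <= q1 /\ q <= q2 by have := Rmin_l q1 q2; have := Rmin_r q1 q2; lra.
have [k11 k12] : q <= d0 /\ q <= dl by have := Rmin_l d0 dl; have := Rmin_r d0 dl; lra.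
pose t := q / 2; have ht : 0 < t by rewrite /t; lra.
have htq : t < q by rewrite /t; lra.
have s1 : t * (V + c0 + e' + 2) <= rad by rewrite -eq1; apply: Rmult_le_compat_r; lra.
have tV : 0 <= t * V by apply: Rmult_le_pos; lra.
have tc : 0 < t * c0 by apply: Rmult_lt_0_compat; lra.
have te : 0 < t * e' by apply: Rmult_lt_0_compat; lra.
set b := vadd zb (vscal t (path t)).
have hp := @path_norm t ltac:(lra).
have nb : vnorm (vsub b zb) <= t * V.
  rewrite /b vsub_addl vnormZ Rabs_pos_eq; last lra.
  by apply: Rmult_le_compat_l; lra.
pose p := fstv b; pose x := sndv b.
have Eb : vpair p x = b by apply: vpair_eta.
have Ed d : vpair p (vadd x d) = vadd b (ex d).
  by rewrite -Eb /ex vpairD vaddv0.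
have hpb : vnorm (vsub p pb) < d0.
  have := vnorm_fstv (vsub b zb); rewrite -{1}Eb vsub_pair fstv_pair; lra.
have hxb : vnorm (vsub x xb) < d0.
  have := vnorm_sndv (vsub b zb); rewrite -{1}Eb vsub_pair sndv_pair; lra.
have hk := h1 t ltac:(lra); rewrite -/b -Eb in hk.
have tt : t * t <= t by rewrite -[X in _ <= X]Rmult_1_r; apply: Rmult_le_compat_l; lra.
have tt0 : 0 < t * t by apply: Rmult_lt_0_compat; lra.
have ett : 0 < e1 * (t * t) by apply: Rmult_lt_0_compat; lra.
have ett1 : e1 * (t * t) <= t * t.
  by rewrite -[X in _ <= X]Rmult_1_l; apply: Rmult_le_compat_r; lra.
have [|x' [gx' hx']] := @Gam_error_bound p x (kt t) hpb hxb (proj1 (kt_lin t)) _ _ ett.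
  lra.
(* The competitor: the error bound repairs the curve point at a cost of order e1 t^2, so its value
   is of that order too. *)
pose dt := vsub x' x.
have Ex' : x' = vadd x dt by rewrite /dt; vring.
have ndt : vnorm dt <= (c0 + 1) * (e1 * (t * t)) 
  by have := Rmult_le_compat_l c0 _ _ (Rlt_le _ _ c0pos) hk; rewrite /dt; lra.
have ndt2 : vnorm dt <= (c0 + 1) * (t * t).
  by apply: Rle_trans ndt _; apply: Rmult_le_compat_l; lra.
have ndt3 : vnorm dt <= rad.
  apply: Rle_trans ndt2 _; apply: Rle_trans (_ : (c0 + 1) * t <= _); last lra.
  by apply: Rmult_le_compat_l; lra.
have ndt0 := vnorm_ge0 dt.
have Kdt : K (G (vpair p (vadd x dt))).
  rewrite -Ex'; apply/Gam_local => //.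
  have -> : vsub x' xb = vadd dt (vsub x xb) by rewrite /dt; vring.
  have := vnorm_sndv (vsub b zb); rewrite -{1}Eb vsub_pair sndv_pair.
  have := vnormD dt (vsub x xb); lra.
set yt := vadd xbs (vscal t ys).
have nyt : vnorm yt <= Y.
  apply: Rle_trans (vnormD _ _) _; rewrite vnormZ Rabs_pos_eq; last lra.
  have : t * vnorm ys <= 1 * vnorm ys by apply: Rmult_le_compat_r; lra.
  by rewrite /Y; lra.
have [|d [hd [Kd [hphi hnorm]]]] := @penalized_minimizer p x rad rho yt dt _ prho ndt3 Kdt.
  by rewrite Eb; lra.
have hd0 := vnorm_ge0 d.
have LB := hdl t d ltac:(lra) ltac:(lra) ltac:(rewrite -/b -Ed; exact: Kd).
rewrite -/yt in LB.
have UB : - dot yt dt + rho / 2 * dot dt dt <= c2 * (e1 * (t * t)).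
  have u1 := dot_abs_le yt dt; have u2 := Rle_abs (- dot yt dt); rewrite Rabs_Ropp in u2.
  have u3 : vnorm yt * vnorm dt <= Y * ((c0 + 1) * (e1 * (t * t))).
    by apply: Rmult_le_compat => //; exact: vnorm_ge0.
  have u4 : dot dt dt <= (c0 + 1) * (e1 * (t * t)) * ((c0 + 1) * 1).
    rewrite -vnorm_sqr; apply: Rmult_le_compat => //.
    by apply: Rle_trans ndt2 _; apply: Rmult_le_compat_l; lra.
  have u5 : rho / 2 * dot dt dt <= rho / 2 * ((c0 + 1) * (e1 * (t * t)) * ((c0 + 1) * 1)).
    by apply: Rmult_le_compat_l; lra.
  rewrite /c2; lra.
rewrite -vnorm_sqr in hphi.
have main : vnorm d * vnorm d <= (c1 + c2) * e1 * (t * t + t * vnorm d).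
  have : 0 <= c2 * (e1 * (t * vnorm d)).
    by do !apply: Rmult_le_pos; lra.
  by have := Rle_trans _ _ _ hphi UB; rewrite /rho; lra.
have dsmall : vnorm d <= e' * t.
  case: (Rle_lt_dec (vnorm d) (e' * t)) => // hlt.
  have tk : t <= ka * vnorm d.
    have -> : t = ka * (e' * t) by rewrite -Rmult_assoc eka Rmult_1_l.
    by apply: Rmult_le_compat_l; lra.
  have pD : 0 < vnorm d by lra.
  have t1 : t * t + t * vnorm d <= (ka * ka + ka) * (vnorm d * vnorm d).
    have w1 : t * t <= ka * vnorm d * (ka * vnorm d) by apply: Rmult_le_compat; lra.
    have w2 : t * vnorm d <= ka * vnorm d * vnorm d by apply: Rmult_le_compat_r; lra.
    lra.
  have t2 : (c1 + c2) * e1 * (t * t + t * vnorm d) <=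
      (c1 + c2) * e1 * ((ka * ka + ka) * (vnorm d * vnorm d)).
    by apply: Rmult_le_compat_l => //; apply: Rmult_le_pos; lra.
  have t3 : (c1 + c2) * e1 * ((ka * ka + ka) * (vnorm d * vnorm d)) =
    (1 - e1) * (vnorm d * vnorm d).
    by rewrite -ee1 /c3; ring.
  have t4 : 0 < e1 * (vnorm d * vnorm d) by do !apply: Rmult_lt_0_compat.
  lra.
have drad : vnorm d < rad by lra.
have {}hnorm := hnorm drad.
exists t, (vpair (vadd (path t) (ex (vscal (/ t) d))) (vsub ys (vscal (rho / t) d))).
have ti : 0 < / t by apply: Rinv_0_lt_compat.
have nd1 : vnorm (vscal (/ t) d) <= e'.
  rewrite vnormZ Rabs_pos_eq; last lra.
  apply: (Rmult_le_reg_l t) => //; rewrite -Rmult_assoc Rinv_r; lra.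
split; first lra.
split.
  have -> : vsub (vpair (vadd (path t) (ex (vscal (/ t) d))) (vsub ys (vscal (rho / t) d)))
      (vpair v ys) = vpair (vadd (vscal (- (t / 2)) w) (ex (vscal (/ t) d)))
      (vscal (- rho) (vscal (/ t) d)).
    by rewrite !vsubE vpairZ vpairD; congr vpair; rewrite /path; vring.
  apply: Rle_lt_trans (vnorm_pair _ _) _.
  have := vnormD (vscal (- (t / 2)) w) (ex (vscal (/ t) d)).
  rewrite [vnorm (ex _)]vnorm_pair0l [vnorm (vscal (- (t / 2)) w)]vnormZ Rabs_Ropp Rabs_pos_eq; last lra.
  rewrite [vnorm (vscal (- rho) _)]vnormZ Rabs_Ropp Rabs_pos_eq; last lra.
  have w1 : t * (vnorm w + 1) < eps by rewrite -eq2; apply: Rmult_lt_compat_r; lra.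
  have w2 : rho * vnorm (vscal (/ t) d) <= rho * e' by apply: Rmult_le_compat_l; lra.
  lra.
have -> : vadd (vpair zb xbs) (vscal t
   (vpair (vadd (path t) (ex (vscal (/ t) d))) (vsub ys (vscal (rho / t) d)))) =
   vpair (vpair p (vadd x d)) (vsub yt (vscal rho d)).
  rewrite vpairZ vpairD; congr vpair; last by rewrite /yt; vring.
  rewrite Ed /b.
  have -> : ex d = vscal t (ex (vscal (/ t) d)).
    by rewrite /ex vpairZ; congr vpair; vring.
  by vring.
by rewrite !fstv_pair !sndv_pair.
Qed.

End SecondOrder.

End ConeSystem.

(** * The reducible system *)

Lemma normal_cone_nonpos k (O : vset k) z zs :
  O z -> (forall y, O y -> dot zs (vsub y z) <= 0) -> normal_cone O z zs.
Proof.
move=> hz H; split=> // eps he; exists 1; split; first lra.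
move=> y hy _; have := H y hy; have := vnorm_ge0 (vsub y z); nra.
Qed.

Lemma normal_cone_dir k (O : vset k) z zs w :
  normal_cone O z zs -> (forall t, 0 < t -> O (vadd z (vscal t w))) -> dot zs w <= 0.
Proof.
move=> [_ H] hO; have hw := vnorm_ge0 w.
apply: (@Rle_eps _ _ (vnorm w)) => // eps he; have [d [hd h]] := H eps he.
pose t := d / (2 * (vnorm w + 1)); have ht : 0 < t by apply: Rdiv_lt_0_compat; lra.
have et : t * (vnorm w + 1) = d / 2 by rewrite /t; field; lra.
have := h _ (hO t ht); rewrite vsub_addl vnormZ Rabs_pos_eq; last lra.
rewrite dotZr => /(_ ltac:(lra)) h2.
by apply: (Rmult_le_reg_l t); lra.
Qed.

(** The two curvature terms of the formula are one object: the adjoint at mu of u -> D^2 G (v, (0,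
    u)), as computed in [twice_comp]. *)
Lemma second_order_adj (m n l e : nat) (g : vec (m + n) -> vec l) Dg D2g
    (Dh : vec l -> vec l -> vec e) (D2h : vec l -> vec l -> vec l -> vec e) zb v mu :
  is_linear (Dh (g zb)) -> is_linear (D2h (g zb) (Dg zb v)) ->
  vadd (dx_adj_deriv D2g zb (adj (Dh (g zb)) mu) v) (Hmap g Dg D2h zb mu v) =
  adj (fun u => vadd (Dh (g zb) (D2g zb v (vpair (vzero : vec m) u)))
    (D2h (g zb) (Dg zb v) (Dg zb (vpair vzero u)))) mu.
Proof.
move=> h1 h2; apply: vext => j.
have E1 : dx_adj_deriv D2g zb (adj (Dh (g zb)) mu) v j =
  dot mu (Dh (g zb) (D2g zb v (vpair vzero (basis j)))) by rewrite /dx_adj_deriv dot_adj.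
have E2 : Hmap g Dg D2h zb mu v j =
  dot mu (D2h (g zb) (Dg zb v) (Dg zb (vpair vzero (basis j)))) := dot_adj mu _ h2.
by rewrite /adj dotDr -E1 -E2.
Qed.

Unset Implicit Arguments.

Theorem theorem5p6 (m n l e : nat)
  (g : vec (m + n) -> vec l)
  (Dg : vec (m + n) -> vec (m + n) -> vec l)
  (D2g : vec (m + n) -> vec (m + n) -> vec (m + n) -> vec l)
  (C : vset l) (K : vset e)
  (h : vec l -> vec e) (Dh : vec l -> vec l -> vec e)
  (D2h : vec l -> vec l -> vec l -> vec e)
  (pb : vec m) (xb : vec n) (xbs : vec n) :
  (exists r, 0 < r /\ C2_on g Dg D2g (vpair pb xb) r) ->
  closed_vset C ->
  cone_reducible C K h Dh D2h (g (vpair pb xb)) ->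
  Gamma g C pb xb ->
  normal_cone (Gamma g C pb) xb xbs ->
  robinson_stable g C pb xb ->
  strict_complementarity g Dg C pb xb xbs ->
  forall (q : vec m) (u : vec n),
    char_subspace g Dg K Dh (vpair pb xb) q ->
    (forall ys,
       graph_deriv (gphPsi g C) (vpair pb xb) xbs (vpair q u) ys ->
       rhs_set g Dg D2g C Dh D2h (vpair pb xb) xbs (vpair q u) ys) /\
    (second_order_cond g Dg D2g K Dh D2h (vpair pb xb) (vpair q u) ->
     forall ys,
       rhs_set g Dg D2g C Dh D2h (vpair pb xb) xbs (vpair q u) ys ->
       graph_deriv (gphPsi g C) (vpair pb xb) xbs (vpair q u) ys) /\
    (surjective_lin (Dg (vpair pb xb)) ->
     second_order_cond g Dg D2g K Dh D2h (vpair pb xb) (vpair q u)).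
Proof.
move=> [rg [hrg hC2]] _ red Cb _ rob [lam0 [hri hlam0]] q u hq.
set zb := vpair pb xb in hC2 red hlam0 hq *; set v := vpair q u.
have tg := C2_on_twice hrg hC2; have [rh th] := reducible_twice red.
have [rho tw] := twice_comp tg th.
have [Kc [Kv Kk]] := reducible_cone red.
have [rK [hrK [_ [h0 [hs hCK]]]]] := proj2 (proj2 (proj2 red)).
have lDh := twice_linear0 th; have lDg := twice_linear0 tg.
set G := (fun z => h (g z)) in tw; set DG := (fun z w => Dh (g z) (Dg z w)) in tw.
set D2 := (fun v w => vadd _ _) in tw.
have gb : frechet_at g (Dg zb) zb by have [_ [H _]] := tg; apply: H; rewrite vsubvv vnorm0.
have [c0 [d1 [pc0 [pd1 herr]]]] := robinson_cone red gb rob Cb.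
have [d2 [pd2 hcont]] := frechet_continuous gb hrK.
pose d0 := Rmin d1 (d2 / 2); have pd0 : 0 < d0 by apply: Rmin_glb_lt; lra.
have m1 : d0 <= d1 by apply: Rmin_l.
have m2 : d0 <= d2 / 2 by apply: Rmin_r.
have G0 : G zb = vzero by exact: h0.
have loc p x : vnorm (vsub p pb) < d0 -> vnorm (vsub x xb) < d0 ->
    (Gamma g C p x <-> K (G (vpair p x))).
  move=> hp hx; apply: hCK; apply: hcont; rewrite /zb vsub_pair.
  by have := vnorm_pair (vsub p pb) (vsub x xb); lra.
have err p x k : vnorm (vsub p pb) < d0 -> vnorm (vsub x xb) < d0 -> K k ->
    vnorm (vsub (G (vpair p x)) k) < d0 -> forall eta, 0 < eta ->
    exists x', Gamma g C p x' /\ vnorm (vsub x' x) <= c0 * vnorm (vsub (G (vpair p x)) k) + eta.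
  by move=> hp hx hk hGk; apply: herr => //; [lra | lra | exact: Rlt_le_trans hGk m1].
have [mb [Emb [mbp mbri]]] := relint_normal red hri.
have lex := @linear_sndr m n.
have lDx : is_linear (Defs.Dx Dg zb) := lin_comp lex lDg.
have mbeq w : dot mb (DG zb (vpair vzero w)) = dot xbs w.
  by rewrite -hlam0 dot_adj // -Emb dot_adj.
have lA : is_linear (DG zb) := lin_comp lDg lDh.
have lAx : is_linear (fun u => DG zb (vpair vzero u)) := lin_comp lex lA.
have dual mu : adj (Dg zb) (adj (Dh (g zb)) mu) = adj (DG zb) mu.
  by apply: vext => i; rewrite /adj dot_adj.
have sndA mu (xs : vec n) : (forall w, dot mu (DG zb (vpair vzero w)) = dot xs w) ->
    sndv (adj (DG zb) mu) = xs.
  move=> H; apply: vext => j; rewrite /sndv /adj -vpair_basisr H dotC dot_basis //.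
have lD2 : is_linear (D2h (g zb) (Dg zb v)) := D2_linear_r th _.
have lD2x : is_linear (fun u => D2 v (vpair vzero u)) := lin_comp lex (D2_linear_r tw v).
split; last split.
- move=> ys /(graph_derivative_multiplier (Gamma g C) tw G0 Kv Kk pc0 pd0 loc err mbp mbeq).
  move=> [vT [mu [mup [muAv [mueq hys]]]]].
  have KAv := tangent_image (Gamma g C) tw G0 Kc Kk pd0 loc vT.
  have Avlin := critical_direction_lineality tw Kc Kv Kk mbp mbri mbeq q u hq mup mueq KAv muAv.
  (* [E] is the curvature part of ys; what remains is orthogonal to {u | A_x u in lin K}, hence the
     x-part of the adjoint of A at some a - s mu. *)
  pose E := adj (fun u => D2 v (vpair vzero u)) mu.
  have [|a [s [ha [hs0 hns]]]] :=
      @adjoint_range_polar _ _ _ _ _ _ _ _ _ _ tw Kc Kv Kk _ _ mbri mbeq (vsub ys E) mu _ mueq.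
    move=> w hw; rewrite dotBl dot_adj // hys //; ring.
  set eta := vsub a (vscal s mu) in hns.
  exists (adj (DG zb) mu), (adj (Dh (g zb)) mu), mu, (vsub ys E).
  have mut z : tangent_cone (gphGamma g C) zb z -> K (DG zb z).
    by move=> hz; exact: (tangent_image (Gamma g C) tw G0 Kc Kk pd0 loc hz).
  split.
    apply: normal_cone_nonpos => // z /mut Kz.
    by rewrite dot_adj // (linB _ _ lA) dotBr muAv; have := mup _ Kz; lra.
  split; first exact: sndA.
  split; first by split; [exact: (polar_normal red mup Cb) | exact: dual].
  split=> //; split.
    (* The lift of ns is the adjoint of A at [eta]. On the critical cone <mu, A z> = 0, so only a
       counts: <a, A z> <= 0 = <a, A v>, because A v is in lin K. *)
    exists (fstv (adj (DG zb) eta)); rewrite -(sndA eta _ (fun w => esym (hns w))) vpair_eta.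
    apply: normal_cone_nonpos; first by split=> //; rewrite dot_adj.
    move=> z [/mut Kz]; rewrite !dot_adj // => muz.
    rewrite (linB _ _ lA) dotBr /eta !dotBl !dotZl muz muAv (polar_lin ha Avlin).
    by have := ha _ Kz; lra.
  by rewrite second_order_adj // -/E; vring.
- move=> [w [k [hk hsec]]] ys [zs [lam [mu [ns [_ [zsx [[lamN lamz] [mulam [[ps hps] ->]]]]]]]]].
  have Ezs : adj (DG zb) mu = zs by rewrite -dual mulam.
  have mup : polar K mu by apply: (normal_polar red); rewrite mulam.
  (* Normals exist only at points of the set, so v is in the critical cone; this gives A v in K and
     <zs, v> = 0. *)
  have [vT zsv] := proj1 hps.
  have KAv := tangent_image (Gamma g C) tw G0 Kc Kk pd0 loc vT.
  have muAv : dot mu (DG zb v) = 0 by rewrite -dot_adj // Ezs.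
  have mueq w' : dot mu (DG zb (vpair vzero w')) = dot xbs w'.
    by rewrite -dot_adj // Ezs -(vpair_eta zs) dot_pair dot0r zsx Rplus_0_l.
  have Avlin := critical_direction_lineality tw Kc Kv Kk mbp mbri mbeq q u hq mup mueq KAv muAv.
  apply: (graph_derivative_sufficient (Gamma g C) tw G0 Kc Kv Kk pc0 pd0 loc err mbri mbeq v w Avlin hk hsec mup mueq).
  move=> w' hw'; rewrite -mulam second_order_adj // dotDl dot_adj //.
  (* For A_x z in lin K the ray v + t (0, z) stays in the critical cone, so <ns, z> <= 0; the same
     for - z gives orthogonality. *)
  have half z : lin_part K (DG zb (vpair vzero z)) -> dot ns z <= 0.
    move=> hz; have -> : dot ns z = dot (vpair ps ns) (vpair vzero z).
      by rewrite dot_pair dot0r Rplus_0_l.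
    apply: (normal_cone_dir _ hps) => t ht; split.
      apply: (image_tangent (Gamma g C) tw G0 Kk pc0 pd0 err); rewrite (linD _ _ lA) (linZ _ _ lA).
      by apply: coneD => //; apply: coneZ => //; [lra | case: hz].
    by rewrite dotDr dotZr zsv -Ezs dot_adj // (polar_lin mup hz); ring.
  have := half _ hw'; have := half (vopp w').
  have -> : DG zb (vpair vzero (vopp w')) = vopp (DG zb (vpair vzero w')) := linN w' lAx.
  rewrite dotNr voppE; move/(_ (lin_partZ Kk _ hw')); rewrite -/(D2 v (vpair vzero w')); lra.
- move=> hsurj; have [w0 hw0] := hs (vadd (Dh (g zb) (D2g zb v v)) (D2h (g zb) (Dg zb v) (Dg zb v))).
  have [w hw] := hsurj w0; exists w, vzero.
  split; last by rewrite hw hw0 vaddv0.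
  have K0 := cone0 Kk; split=> //.
  by have -> : vopp (vzero : vec e) = vzero by vring.
Qed.
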